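(* Fix any $\tau\in\mathbb H$. Then for almost all $p\in E_\tau\setminus E_\tau[2]$ (with respect to Lebesgue measure), all critical points of $G_p(z)=G_p(z;\tau)$ are non-degenerate.
   Context: $\mathbb H=\{\tau\in\mathbb C:\operatorname{Im}\tau>0\}$. For $\tau\in\mathbb H$: $\Lambda_\tau=\mathbb Z+\mathbb Z\tau$, $E_\tau=\mathbb C/\Lambda_\tau$ is the flat torus of area $|E_\tau|=\operatorname{Im}\tau$, $\omega_0=0,\omega_1=1,\omega_2=\tau,\omega_3=1+\tau$, and $E_\tau[2]=\{\omega_k/2: k=0,1,2,3\}+\Lambda_\tau$. With $z=x+iy$, $\Delta=\partial_x^2+\partial_y^2$. The Green function $G(z;\tau)$ is the unique function with $-\Delta G=\delta_0-\frac1{|E_\tau|}$ on $E_\tau$ and $\int_{E_\tau}G\,dx\,dy=0$, where $\delta_0$ is the Dirac measure at $0$. Put $G_p(z;\tau)=\frac12\big(G(z-p;\tau)+G(z+p;\tau)\big)$. Critical points of $G_p$ are points of $E_\tau\setminus\{\pm p\}$ where $\nabla G_p=0$; a critical point is non-degenerate if the Hessian determinant $\det D^2G_p$ in the real variables $(x,y)$ is nonzero there. *)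

(* Defs.v *)
From HB Require Import structures.
From mathcomp Require Import all_boot all_order all_algebra.
From mathcomp Require Import all_classical all_reals all_analysis.

Set Implicit Arguments.
Unset Strict Implicit.
Unset Printing Implicit Defensive.

Import Order.TTheory GRing.Theory Num.Theory.
Import numFieldNormedType.Exports.

Local Open Scope classical_set_scope.
Local Open Scope ring_scope.

(* The complex plane is R * R, with x + i y written (x, y): only its real vector
   space structure, its Lebesgue measure and its partial derivatives are used.
   The torus E_tau is the quotient of the plane by [lattice tau]; functions on
   E_tau are [lattice_periodic tau] functions on the plane, points of E_tau are
   represented by their lifts, and integrals over E_tau are taken over the
   fundamental parallelogram [cell tau]. *)

Section TorusGreen.
Context {R : realType}.
Implicit Types (tau z p v : R * R) (f G : R * R -> R).

Definition area2 := (@lebesgue_measure R \x @lebesgue_measure R)%E.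

Definition e_x : R * R := (1, 0).
Definition e_y : R * R := (0, 1).

Definition upper_half_plane : set (R * R) := [set tau | 0 < tau.2].

Definition lattice tau : set (R * R) :=
  [set z | exists m n : int, z = m%:~R *: e_x + n%:~R *: tau].

Definition two_torsion tau : set (R * R) :=
  [set z | exists2 w, w \in [:: 0; e_x; tau; e_x + tau] &
                      lattice tau (z - 2^-1 *: w)].

Definition cell tau : set (R * R) :=
  [set z | exists s t : R,
     [/\ 0 <= s < 1, 0 <= t < 1 & z = s *: e_x + t *: tau]].

Definition torus_area tau : R := tau.2.

Definition lattice_periodic tau f :=
  forall z w, lattice tau w -> f (z + w) = f z.

(* For U open this is C^oo on U: every iterated directional derivative is
   differentiable, hence continuous, at every point of U. *)
Definition smooth_on (U : set (R * R)) f :=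
  forall (vs : seq (R * R)) z, U z ->
    differentiable (foldr (fun v (g : R * R -> R) => 'D_v g) f vs) z.

Definition laplacian f z : R := 'D_e_x ('D_e_x f) z + 'D_e_y ('D_e_y f) z.

Definition hessian_det f z : R :=
  'D_e_x ('D_e_x f) z * 'D_e_y ('D_e_y f) z - 'D_e_x ('D_e_y f) z * 'D_e_y ('D_e_x f) z.

Definition torus_integral tau f : R := \int[area2]_(z in cell tau) f z.

(* [green_eqn] is the equation - Laplacian G = delta_0 - 1 / |E_tau| in the sense
   of distributions on E_tau, whose test functions are the smooth periodic
   functions.  It determines G only almost everywhere; [green_smooth] selects
   the representative that is smooth on E_tau minus the origin.  The values of
   G on the lattice, where it is singular, are irrelevant. *)
Record is_green tau G : Prop := IsGreen {
  green_periodic : lattice_periodic tau G;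
  green_smooth : smooth_on (~` lattice tau) G;
  green_integrable : area2.-integrable (cell tau) (EFin \o G);
  green_eqn : forall phi : R * R -> R,
    lattice_periodic tau phi -> smooth_on setT phi ->
    - torus_integral tau (fun z => G z * laplacian phi z) =
    phi 0 - (torus_area tau)^-1 * torus_integral tau phi;
  green_mean0 : torus_integral tau G = 0 }.

Definition green_pair G p z : R := 2^-1 * (G (z - p) + G (z + p)).

Definition critical_point tau G p z :=
  [/\ ~ lattice tau (z - p), ~ lattice tau (z + p),
      'D_e_x (green_pair G p) z = 0 & 'D_e_y (green_pair G p) z = 0].

Definition nondegenerate_at G p z := hessian_det (green_pair G p) z != 0.

End TorusGreen.

(* Main.v *)
(* Write [u = z - p], [v = z + p] and [F] for the gradient of [G]. A degenerate critical point gives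
   [F u + F v = 0] with [DF u + DF v] singular, and [p = (v - u) / 2]. Away from the lattice [G]
   has constant Laplacian [k = 1 / |E_tau| > 0], so [DF] is symmetric of trace [k].

   If [DF u] or [DF v] is invertible, the equation parametrises the pair by one of its two points,
   and in the direction given by the null vector of [DF u + DF v] the difference [v - u] varies only
   to second order; a Sard-type covering by thin strips shows that these [p] are negligible.

   If both are singular, then [DF u = DF v], so the holomorphic function [H = G_xx - k / 2 - i G_xy]
   satisfies [H u = H v] and [|H u| = k / 2]. Such pairs lie on countably many Lipschitz curves
   unless [H] is flat at some point; unique continuation (from Schwarz's lemma) and periodicity of
   [F] exclude flatness.

   That the distributional equation yields the pointwise Laplacian follows by testing it against
   smooth periodic bump functions built from [exp (-1 / (cos x - e))]. *)

Require Import Defs.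
From mathcomp Require Import all_boot all_order all_algebra.
From mathcomp Require Import all_classical all_reals all_analysis.
From mathcomp Require Import measurable_realfun.
From mathcomp Require Import ring lra zify.

Set Implicit Arguments.
Unset Strict Implicit.
Unset Printing Implicit Defensive.

Import Order.TTheory GRing.Theory Num.Theory.
Import numFieldNormedType.Exports.

Local Open Scope classical_set_scope.
Local Open Scope ring_scope.

(** * Differential calculus in the plane *)

(** Degenerate critical points correspond to critical values of [(u, v) |-> (v - u) / 2] on the set
    [F u + F v = 0], so Sard's theorem is the natural tool; the obstacle is that this set need not
    be a surface where both Jacobians are singular. There the trace helps: the singular symmetric
    matrices of trace [k] form a circle of radius [k / 2] in the [(G_xx, G_xy)] plane, centred at
    [(k / 2, 0)]. If the sum is singular too, the midpoint of two points of the circle lies on the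
    circle, and strict convexity makes them equal. No implicit function is constructed: Lipschitz
    estimates for pairs of points replace parametrisations, and explicit coverings replace Sard's
    theorem. The exceptional set is never shown to be measurable; it is enclosed in measurable sets
    of small area. Power series and Cauchy integrals are avoided as well: a holomorphic function is
    carried together with all its derivatives, and Schwarz's lemma comes from a second derivative
    test along lines, which is why the logarithm of the modulus has to be perturbed into a strictly
    subharmonic function. *)

Lemma norm_fst_le (R : realType) (z : R * R) : `|z.1| <= `|z|.
Proof. by rewrite prod_normE le_max lexx. Qed.

Lemma norm_snd_le (R : realType) (z : R * R) : `|z.2| <= `|z|.
Proof. by rewrite prod_normE le_max lexx orbT. Qed.

Lemma norm_prod_le (R : realType) (z : R * R) (e : R) :
  (`|z| <= e) = (`|z.1| <= e) && (`|z.2| <= e).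
Proof. by rewrite prod_normE ge_max. Qed.

Lemma norm_prod_lt (R : realType) (z : R * R) (e : R) :
  (`|z| < e) = (`|z.1| < e) && (`|z.2| < e).
Proof. by rewrite prod_normE gt_max. Qed.

Lemma nearE_norm (R : realType) (V : normedModType R) (z0 : V) (P : V -> Prop) :
  (\forall z \near z0, P z) <->
  exists2 d : R, 0 < d & forall z, `|z - z0| < d -> P z.
Proof.
split=> [/nbhs_ballP[d /= d0 h]|[d d0 h]].
  by exists d => // z zd; apply: h; rewrite -ball_normE /= distrC.
by apply/nbhs_ballP; exists d => //= z; rewrite -ball_normE /= distrC => /h.
Qed.

Lemma open_contains_ball (R : realType) (V : normedModType R) (U : set V) (z0 : V) :
  open U -> U z0 -> exists2 d : R, 0 < d & forall z, `|z - z0| < d -> U z.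
Proof. by move=> oU Uz0; apply/nearE_norm; exact: open_nbhs_nbhs. Qed.

Lemma continuousE_norm (R : realType) (V : normedModType R) (f : V -> R) (z0 : V) :
  {for z0, continuous f} -> forall e, 0 < e ->
  exists2 d : R, 0 < d & forall z, `|z - z0| < d -> `|f z - f z0| < e.
Proof.
move=> /cvgrPdist_lt h e /h /nearE_norm [d d0 {}h]; exists d => // z /h.
by rewrite distrC.
Qed.

Lemma continuousP_norm (R : realType) (V : normedModType R) (f : V -> R) (z0 : V) :
  (forall e, 0 < e -> exists2 d : R, 0 < d & forall z, `|z - z0| < d -> `|f z - f z0| < e) ->
  {for z0, continuous f}.
Proof.
move=> h; apply/cvgrPdist_lt => e e0; have [d d0 hd] := h e e0.
apply/nbhs_ballP; exists d => //= z; rewrite -ball_normE /= distrC => /hd.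
by rewrite distrC.
Qed.

Lemma open_norm (R : realType) (V : normedModType R) (A : set V) :
  (forall z, A z -> exists2 d : R, 0 < d & forall w, `|w - z| < d -> A w) -> open A.
Proof.
move=> h; rewrite openE => z /h[d d0 hd]; apply/nbhs_ballP; exists d => // w.
by rewrite -ball_normE /= distrC => /hd.
Qed.

Lemma continuous_eq_on (R : realType) (U : set (R * R)) (f g : R * R -> R) (z : R * R) :
  open U -> (forall w, U w -> f w = g w) -> U z -> {for z, continuous g} ->
  {for z, continuous f}.
Proof.
move=> oU fg Uz cg; apply: continuousP_norm => e e0; have [d1 d10 h1] := continuousE_norm cg e0.
have [d d0 hd] := open_contains_ball oU Uz.
exists (Num.min d d1); first by rewrite lt_min d0.
by move=> w; rewrite lt_min => /andP[/hd Uw /h1]; rewrite !fg.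
Qed.

Lemma plane_decomp (R : realType) (v : R * R) : v = v.1 *: e_x + v.2 *: e_y.
Proof.
case: v => a b; congr pair; rewrite /= ?scaler0 ?addr0 ?add0r.
  by rewrite [RHS]mulr1.
by rewrite [RHS]mulr1.
Qed.

Lemma dir_deriveE (R : realType) (f : R * R -> R) (z v : R * R) :
  differentiable f z -> 'D_v f z = v.1 * 'D_e_x f z + v.2 * 'D_e_y f z.
Proof.
by move=> df; rewrite !deriveE// {1}(plane_decomp v) linearD !linearZ.
Qed.

Lemma is_derive_line (R : realType) (V : normedModType R) (f : V -> R) (z v : V) (t : R) :
  differentiable f (z + t *: v) ->
  is_derive t 1 (fun s => f (z + s *: v)) ('D_v f (z + t *: v)).
Proof.
move=> df; have E : (fun h : R => h^-1 *: (((fun s => f (z + s *: v)) \o shift t) (h *: 1) -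
    f (z + t *: v))) =
    (fun h : R => h^-1 *: ((f \o shift (z + t *: v)) (h *: v) - f (z + t *: v))).
  apply/funext => h /=; congr (_ *: (f _ - _)).
  by rewrite scalerDl [h *: 1]mulr1 addrCA.
by split; rewrite /derivable /derive E//; exact: diff_derivable.
Qed.

Lemma segment_norm (R : realType) (V : normedModType R) (z0 z w : V) (d t : R) :
  `|z - z0| < d -> `|w - z0| < d -> 0 <= t <= 1 ->
  `|z + t *: (w - z) - z0| < d.
Proof.
move=> zd wd /andP[t0 t1].
have -> : z + t *: (w - z) - z0 = (1 - t) *: (z - z0) + t *: (w - z0).
  have -> : w - z = (w - z0) - (z - z0) by rewrite opprB addrA subrK.
  by rewrite addrAC (scalerBr _ (w - z0)) scalerBl scale1r addrA addrAC.
rewrite (le_lt_trans (ler_normD _ _))// !normrZ (ger0_norm t0) ger0_norm; last lra.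
have [->|t0'] := eqVneq t 0; first by rewrite mul0r addr0 subr0 mul1r.
have tp : 0 < t by rewrite lt_neqAle eq_sym t0'.
nra.
Qed.

Lemma mvt_line (R : realType) (f : R * R -> R) (z v : R * R) :
  (forall t : R, 0 <= t <= 1 -> differentiable f (z + t *: v)) ->
  exists2 t : R, 0 <= t <= 1 & f (z + v) - f z = 'D_v f (z + t *: v).
Proof.
move=> df.
pose g (t : R) : R := f (z + t *: v).
pose dg (t : R) : R := 'D_v f (z + t *: v).
have gdg (t : R) : t \in `[0, 1]%R -> is_derive t 1 g (dg t).
  by rewrite in_itv /= => t01; apply: is_derive_line; exact: df.
have g1 (x : R) : x \in `]0, 1[%R -> is_derive x 1 g (dg x).
  by move=> /subset_itv_oo_cc /gdg.
have g2 : {within `[(0:R), 1], continuous g}.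
  by apply: derivable_within_continuous => t /gdg [].
have h01 : 0 <= 1 :> R by exact: ler01.
have := MVT_segment h01 g1 g2.
move=> [t].
rewrite in_itv /= => t01.
rewrite /g /dg scale1r scale0r addr0 subr0 mulr1 => ->.
by exists t.
Qed.

Lemma mvt_plane (R : realType) (f : R * R -> R) (z0 z w : R * R) (d : R) :
  (forall y, `|y - z0| < d -> differentiable f y) ->
  `|z - z0| < d -> `|w - z0| < d ->
  exists y, [/\ `|y - z0| < d, `|y - z| <= `|w - z| & f w - f z = 'D_(w - z) f y].
Proof.
move=> df zd wd; have [t t01|t t01] := @mvt_line _ f z (w - z).
  by apply: df; exact: segment_norm.
rewrite (addrC z) subrK => ->.
exists (z + t *: (w - z)); split=> //; first exact: segment_norm.
rewrite addrAC subrr add0r normrZ ler_piMl//.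
by case/andP: t01 => t0 t1; rewrite ger0_norm.
Qed.

Lemma lincomb_bound (R : realType) (a b p q N r s : R) :
  `|a| <= N -> `|b| <= N -> `|p| <= r -> `|q| <= s ->
  `|a * p + b * q| <= (r + s) * N.
Proof.
move=> aN bN pr qs; rewrite (le_trans (ler_normD _ _))// !normrM mulrDl.
by rewrite !(mulrC _ N); apply: lerD; apply: ler_pM.
Qed.

(** The partial derivatives are continuous at [z0] only, which is what strict differentiability
    there consumes. *)
Definition C1_at (R : realType) (f : R * R -> R) (z0 : R * R) :=
  [/\ \forall z \near z0, differentiable f z,
      {for z0, continuous ('D_e_x f)} & {for z0, continuous ('D_e_y f)}].

(** The mean value theorem on the segment from [z] to [w] compares the gradient at an intermediate
    point with that at [z0]. Both endpoints are free, as the estimates for pairs of points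
    require. *)
Lemma strict_differentiable (R : realType) (f : R * R -> R) (z0 : R * R) :
  C1_at f z0 -> forall e, 0 < e -> exists2 d : R, 0 < d &
  forall z w, `|z - z0| < d -> `|w - z0| < d ->
   `|f w - f z - ((w - z).1 * 'D_e_x f z0 + (w - z).2 * 'D_e_y f z0)|
     <= e * `|w - z|.
Proof.
move=> [/nearE_norm[d0 d00 df] cx cy] e e0.
have e20 : 0 < e / 2 by lra.
have [d1 d10 h1] := continuousE_norm cx e20.
have [d2 d20 h2] := continuousE_norm cy e20.
exists (Num.min d0 (Num.min d1 d2)); first by rewrite !lt_min d00 d10.
move=> z w zd wd.
have [y|y [yd _ ->]] := @mvt_plane _ f z0 z w (Num.min d0 (Num.min d1 d2)) _ zd wd.
  by rewrite lt_min => /andP[/df].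
move: yd; rewrite !lt_min => /and3P[/df dfy /h1 {}h1 /h2 {}h2].
rewrite (dir_deriveE _ dfy) opprD addrACA -!mulrBr.
move: h1 h2 => /ltW h1 /ltW h2; rewrite (splitr e).
by apply: (lincomb_bound _ _ h1 h2); [exact: norm_fst_le|exact: norm_snd_le].
Qed.

Lemma C1_lipschitz (R : realType) (f : R * R -> R) (z0 : R * R) :
  C1_at f z0 -> exists2 d : R, 0 < d & exists2 K : R, 0 < K &
  forall z w, `|z - z0| < d -> `|w - z0| < d -> `|f w - f z| <= K * `|w - z|.
Proof.
move=> /strict_differentiable /(_ _ ltr01)[d d0 h]; exists d => //.
exists (1 + (`|'D_e_x f z0| + `|'D_e_y f z0|)).
  by rewrite ltr_pwDl// addr_ge0.
move=> z w zd wd; have := h _ _ zd wd.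
rewrite -{2}(subrK ((w - z).1 * 'D_e_x f z0 + (w - z).2 * 'D_e_y f z0) (f w - f z)).
move=> hh; apply: (le_trans (ler_normD _ _)).
rewrite (mulrDl 1); apply: lerD => //.
by apply: lincomb_bound => //; [exact: norm_fst_le|exact: norm_snd_le].
Qed.

(** The gradient at an intermediate point of the segment differs from that at the moving base point
    [z] by a multiple of [|w - z|], so the quadratic remainder is uniform near [z0]. *)
Lemma C1_taylor (R : realType) (f : R * R -> R) (z0 : R * R) :
  C1_at f z0 -> C1_at ('D_e_x f) z0 -> C1_at ('D_e_y f) z0 ->
  exists2 d : R, 0 < d & exists2 K : R, 0 < K &
  forall z w, `|z - z0| < d -> `|w - z0| < d ->
   `|f w - f z - ((w - z).1 * 'D_e_x f z + (w - z).2 * 'D_e_y f z)|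
     <= K * `|w - z| ^+ 2.
Proof.
move=> [/nearE_norm[d0 d00 df] _ _] /C1_lipschitz[d1 d10 [K K0 h1]].
move=> /C1_lipschitz[d2 d20 [K' K0' h2]].
exists (Num.min d0 (Num.min d1 d2)); first by rewrite !lt_min d00 d10.
exists (K + K'); first by lra.
move=> z w; rewrite !lt_min => /and3P[z0d z1d z2d] /and3P[w0d w1d w2d].
have [y'|||y' []] := @mvt_plane _ f z0 z w (Num.min d0 (Num.min d1 d2)).
- by rewrite lt_min => /andP[/df].
- by rewrite !lt_min z0d z1d.
- by rewrite !lt_min w0d w1d.
rewrite !lt_min => /and3P[y0 y1 y2] y'z ->.
rewrite (dir_deriveE _ (df _ y0)) opprD addrACA -!mulrBr expr2 mulrA (mulrDl K).
apply: lincomb_bound; [exact: norm_fst_le|exact: norm_snd_le| |].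
  by apply: (le_trans (h1 _ _ z1d y1)); rewrite ler_pM2l.
by apply: (le_trans (h2 _ _ z2d y2)); rewrite ler_pM2l.
Qed.

Lemma derivative_shift (R : realType) (V W : normedModType R) (f : V -> W) (c y v : V) :
  'D_v (fun x => f (x + c)) y = 'D_v f (y + c).
Proof.
rewrite /derive; have -> : (fun h : R => h^-1 *: (((fun x => f (x + c)) \o shift y) (h *: v)
    - f (y + c))) = (fun h : R => h^-1 *: ((f \o shift (y + c)) (h *: v) - f (y + c))).
  by apply/funext => h /=; rewrite addrA.
by [].
Qed.

Lemma differentiable_shift (R : realType) (V W : normedModType R) (f : V -> W) (c y : V) :
  differentiable f (y + c) -> differentiable (fun x => f (x + c)) y.
Proof.
move=> df.
have h1 : differentiable (id : V -> V) y by exact: ex_diff.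
have h2 : differentiable (cst c : V -> V) y by exact: ex_diff.
have dg := differentiableD h1 h2.
exact: (@differentiable_comp _ _ _ _ (fun x : V => x + c) f).
Qed.

Lemma derive_scale_dir (R : realType) (V : normedModType R) (f : V -> R) (z v : V) (h : R) :
  differentiable f z -> 'D_(h *: v) f z = h * 'D_v f z.
Proof. by move=> df; rewrite !deriveE// linearZ. Qed.

(** The injectivity half of the inverse function theorem, with a Lipschitz inverse: Cramer's rule
    solves the linearised system, and strict differentiability makes the error small enough to be
    absorbed. *)
Lemma inverse_lipschitz (R : realType) (f g : R * R -> R) (z0 : R * R) :
  C1_at f z0 -> C1_at g z0 ->
  'D_e_x f z0 * 'D_e_y g z0 - 'D_e_y f z0 * 'D_e_x g z0 != 0 ->
  exists2 d : R, 0 < d & exists2 K : R, 0 < K &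
  forall z w, `|z - z0| < d -> `|w - z0| < d ->
    `|w - z| <= K * (`|f w - f z| + `|g w - g z|).
Proof.
move=> /strict_differentiable hf /strict_differentiable hg.
move: ('D_e_x f z0) ('D_e_y f z0) ('D_e_x g z0) ('D_e_y g z0) hf hg => a b c e hf hg.
set D := _ - _ => D0; have D0' : 0 < `|D| by rewrite normr_gt0.
pose M := 1 + `|a| + `|b| + `|c| + `|e|.
have Ha := normr_ge0 a; have Hb := normr_ge0 b; have Hc := normr_ge0 c.
have He := normr_ge0 e.
have M0 : 0 < M by rewrite /M; lra.
have [[aM bM] [cM eM]] : (`|a| <= M /\ `|b| <= M) /\ (`|c| <= M /\ `|e| <= M).
  by rewrite /M; lra.
(* With the factor 4, the errors of both components multiplied by the cofactor bound [M] add up to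
   half of [|D| |w - z|]. *)
have eta0 : 0 < `|D| / (4 * M) by rewrite divr_gt0// mulr_gt0.
have [d1 d10 h1] := hf _ eta0; have [d2 d20 h2] := hg _ eta0.
exists (Num.min d1 d2); first by rewrite lt_min d10.
exists (2 * M / `|D|); first by rewrite divr_gt0// mulr_gt0.
move=> z w; rewrite !lt_min => /andP[z1 z2] /andP[w1 w2].
have := h2 _ _ z2 w2; have := h1 _ _ z1 w1.
have : `|w - z| = Num.max `|(w - z).1| `|(w - z).2| by rewrite prod_normE.
move: (w - z).1 (w - z).2 `|w - z| (f w - f z) (g w - g z) => x y N F G NE.
set al := a * x + b * y; set be := c * x + e * y.
have -> : x * a + y * b = al by rewrite /al; ring.
have -> : x * c + y * e = be by rewrite /be; ring.
set t := `|D| / (4 * M) => hF hG.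
have Dx : D * x = e * al - b * be by rewrite /D /al /be; ring.
have Dy : D * y = a * be - c * al by rewrite /D /al /be; ring.
have Mt : 4 * (M * t) = `|D|.
  by rewrite mulrA /t mulrC divfK// gt_eqF// mulr_gt0.
clearbody al be t M D.
have hal : `|al| <= `|F| + t * N.
  rewrite -[al](subKr F) (le_trans (ler_normB _ _))// lerD2l//.
have hbe : `|be| <= `|G| + t * N.
  rewrite -[be](subKr G) (le_trans (ler_normB _ _))// lerD2l//.
have al0 := normr_ge0 al; have be0 := normr_ge0 be.
have lin p q : `|p| <= M -> `|q| <= M -> `|p * al - q * be| <= M * (`|al| + `|be|).
  move=> pM qM; rewrite (le_trans (ler_normB _ _))// !normrM mulrDr.
  by apply: lerD; apply: ler_pM.
have DN : `|D| * N <= M * (`|al| + `|be|).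
  rewrite NE maxr_pMr// -!normrM ge_max Dx Dy; apply/andP; split.
    by exact: lin.
  by rewrite -normrN opprB; exact: lin.
have : M * (`|al| + `|be|) <= M * (`|F| + `|G| + 2 * (t * N)).
  by rewrite ler_pM2l//; lra.
move=> /(le_trans DN) H; rewrite mulrAC ler_pdivlMr//.
have MtN : M * (2 * (t * N)) = `|D| * N / 2 by rewrite -Mt; field.
move: H; rewrite (mulrDr M) MtN.
by move: (`|F| + `|G|) => S; move: (`|D|) D0' => E E0; lra.
Qed.

(** The mean value theorem in direction [v], applied to the increment of [f] by [h *: w], leaves an
    increment of ['D_v f], to which strict differentiability applies. *)
Lemma second_difference (R : realType) (f : R * R -> R) (z0 v w : R * R) :
  (\forall z \near z0, differentiable f z) -> C1_at ('D_v f) z0 ->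
  `|v| = 1 -> `|w| = 1 ->
  forall e, 0 < e -> exists2 d : R, 0 < d & forall h, 0 < h < d ->
   `|f (z0 + h *: v + h *: w) - f (z0 + h *: v) - (f (z0 + h *: w) - f z0)
     - h ^+ 2 * 'D_w ('D_v f) z0| <= e * h ^+ 2.
Proof.
move=> /nearE_norm[d1 d10 df] C v1 w1 e e0.
have dDv : differentiable ('D_v f) z0 by case: C => /nbhs_singleton.
have [d2 d20 hd] := strict_differentiable C e0.
(* Half the radius, so that [y + h *: w] stays in range along with [y]. *)
pose r := Num.min d1 d2 / 2.
have r0 : 0 < r by rewrite divr_gt0// lt_min d10.
have [rd1 rd2] : r + r <= d1 /\ r + r <= d2.
  by rewrite -splitr; split; rewrite ge_min lexx ?orbT.
exists r => // h /andP[h0 hr].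
pose k y := f (y + h *: w) - f y.
have hw : `|h *: w| = h by rewrite normrZ w1 mulr1 gtr0_norm.
have hv : `|h *: v| = h by rewrite normrZ v1 mulr1 gtr0_norm.
have near2 y q : r + r <= q -> `|y - z0| < r -> `|y + h *: w - z0| < q.
  by move=> rq yh; rewrite addrAC (le_lt_trans (ler_normD _ _))// hw; lra.
have dk y : `|y - z0| < r -> differentiable k y.
  move=> yh; apply: differentiableB; last by apply: df; lra.
  by apply: differentiable_shift; apply: df; exact: near2.
have [||y [yr _]] := @mvt_plane _ k z0 z0 (z0 + h *: v) r dk.
- by rewrite subrr normr0.
- by rewrite addrAC subrr add0r hv.
rewrite {1 2}/k => ->.
rewrite addrAC subrr add0r derive_scale_dir; last exact: dk.
have dky : 'D_v k y = 'D_v f (y + h *: w) - 'D_v f y.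
  rewrite /k deriveB; last 2 first.
  - by apply/diff_derivable/differentiable_shift/df/near2.
  - by apply/diff_derivable/df; lra.
  by rewrite derivative_shift.
rewrite dky expr2 -mulrA -mulrBr normrM (gtr0_norm h0) mulrCA ler_pM2l//.
have := hd y (y + h *: w) _ (near2 _ _ rd2 yr).
rewrite (addrAC y) subrr add0r hw.
have -> : h * 'D_w ('D_v f) z0 = (h *: w).1 * 'D_e_x ('D_v f) z0 + (h *: w).2 * 'D_e_y ('D_v f) z0.
  by rewrite -dir_deriveE// derive_scale_dir.
by apply; lra.
Qed.

(** The second difference is symmetric in [v] and [w]; divided by [h ^+ 2] it tends to both iterated
    derivatives. *)
Lemma mixed_derivatives (R : realType) (f : R * R -> R) (z0 v w : R * R) :
  (\forall z \near z0, differentiable f z) -> C1_at ('D_v f) z0 -> C1_at ('D_w f) z0 ->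
  `|v| = 1 -> `|w| = 1 -> 'D_w ('D_v f) z0 = 'D_v ('D_w f) z0.
Proof.
move=> df Cv Cw v1 w1; apply/eqP; rewrite -subr_eq0 -normr_le0.
apply/ler_addgt0Pl => e e0; rewrite addr0.
have e20 : 0 < e / 2 by rewrite divr_gt0.
have [d1 d10 h1] := second_difference df Cv v1 w1 e20.
have [d2 d20 h2] := second_difference df Cw w1 v1 e20.
pose h := Num.min d1 d2 / 2.
have m0 : 0 < Num.min d1 d2 by rewrite lt_min d10.
have h0 : 0 < h by rewrite divr_gt0.
have hm : h < Num.min d1 d2 by rewrite /h; lra.
move: hm; rewrite lt_min => /andP[hd1 hd2].
have := h1 h; have := h2 h; rewrite h0 hd1 hd2 => /(_ erefl) H2 /(_ erefl) H1.
move: H1 H2; rewrite (addrAC z0 (h *: w)).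
move: ('D_w ('D_v f) z0) ('D_v ('D_w f) z0) => p q.
move: (f _) (f _) (f _) (f _) => x1 x2 x3 x4 H1 H2.
have hh0 : 0 < h ^+ 2 by rewrite exprn_gt0.
suff : `|h ^+ 2 * (p - q)| <= h ^+ 2 * e by rewrite normrM (gtr0_norm hh0) ler_pM2l.
have -> : h ^+ 2 * (p - q) = (x4 - x2 - (x3 - x1) - h ^+ 2 * q) - (x4 - x3 - (x2 - x1) - h ^+ 2 * p) by ring.
rewrite (le_trans (ler_normB _ _))// (mulrC _ e) (splitr e) mulrDl.
exact: lerD.
Qed.

Lemma smooth_diff (R : realType) (U : set (R * R)) (f : R * R -> R) (z : R * R) :
  smooth_on U f -> U z -> differentiable f z.
Proof. by move=> /(_ [::]); apply. Qed.

Lemma smooth_derive (R : realType) (U : set (R * R)) (f : R * R -> R) (v : R * R) :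
  smooth_on U f -> smooth_on U ('D_v f).
Proof. by move=> sf vs z Uz; have := sf (rcons vs v) z Uz; rewrite foldr_rcons. Qed.

Lemma smooth_C1 (R : realType) (U : set (R * R)) (f : R * R -> R) (z : R * R) :
  open U -> smooth_on U f -> U z -> C1_at f z.
Proof.
move=> oU sf Uz; split.
- have : \forall z \near z, U z by exact: open_nbhs_nbhs.
  by apply: filterS => y; exact: smooth_diff.
- by apply/differentiable_continuous/(smooth_diff _ Uz)/smooth_derive.
- by apply/differentiable_continuous/(smooth_diff _ Uz)/smooth_derive.
Qed.

Lemma norm_e_x (R : realType) : `|e_x : R * R| = 1.
Proof. by rewrite prod_normE /= normr1 normr0 max_l. Qed.

Lemma norm_e_y (R : realType) : `|e_y : R * R| = 1.
Proof. by rewrite prod_normE /= normr1 normr0 max_r. Qed.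

Lemma smooth_mixed (R : realType) (U : set (R * R)) (f : R * R -> R) (z : R * R) :
  open U -> smooth_on U f -> U z ->
  'D_e_y ('D_e_x f) z = 'D_e_x ('D_e_y f) z.
Proof.
move=> oU sf Uz; apply: mixed_derivatives.
- by case: (smooth_C1 oU sf Uz).
- by apply: smooth_C1 Uz => //; exact: smooth_derive.
- by apply: smooth_C1 Uz => //; exact: smooth_derive.
- exact: norm_e_x.
- exact: norm_e_y.
Qed.

(** * Negligible sets of the plane *)

Lemma lebesgue_itvcc_center (R : realType) (c e : R) : 0 <= e ->
  lebesgue_measure `[c - e, c + e]%classic = (2 * e)%:E.
Proof.
move=> e0; rewrite lebesgue_measure_itv /= lte_fin -EFinD.
case: ifPn => [_|]; first by congr EFin; ring.
by rewrite -leNgt => h; congr EFin; lra.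
Qed.

Lemma le_integral_section (R : realType) (phi : R -> \bar R) (c e1 b : R) :
  0 <= e1 -> 0 <= b -> measurable_fun setT phi -> (forall x, 0 <= phi x)%E ->
  (forall x, (phi x <= b%:E)%E) -> (forall x, e1 < `|x - c| -> phi x = 0%E) ->
  (\int[lebesgue_measure]_x phi x <= (2 * e1 * b)%:E)%E.
Proof.
move=> e10 b0 mphi phi0 phib phiv.
have mI : measurable (`[c - e1, c + e1]%classic : set R) by [].
apply: (@le_trans _ _ (\int[lebesgue_measure]_x (b%:E * (\1_(`[c - e1, c + e1]) x)%:E))%E).
  apply: ge0_le_integral => //.
    apply: measurable_funeM; apply/measurable_EFinP; exact: measurable_indic.
  move=> x _; rewrite indicE; case: (boolP (x \in _)) => [_|].
    by rewrite mule1.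
  rewrite notin_setE /= in_itv /= => /negP; rewrite -ler_distlC distrC -ltNge => /phiv ->.
  by rewrite mule0.
rewrite ge0_integralZl//; last first.
  by apply/measurable_EFinP; exact: measurable_indic.
rewrite integral_indic// setIT [X in (_ * X)%E](lebesgue_itvcc_center c e10) -EFinM lee_fin.
by rewrite mulrC.
Qed.

(** Vertical sections lie in intervals of length [2 * e2] centred at [m x]; only their measures
    enter, so [m] is an arbitrary function. *)
Lemma le_area_xsection (R : realType) (B : set (R * R)) (c e1 e2 : R) (m : R -> R) :
  0 <= e1 -> 0 <= e2 -> measurable B ->
  (forall p, B p -> `|p.1 - c| <= e1) ->
  (forall p, B p -> `|p.2 - m p.1| <= e2) ->
  (area2 B <= (2 * e1 * (2 * e2))%:E)%E.
Proof.
move=> e10 e20 mB h1 h2; rewrite /area2 /product_measure1.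
apply: (@le_integral_section _ _ c) => //=.
- by rewrite mulr_ge0.
- exact: measurable_fun_xsection.
- move=> x; rewrite -(lebesgue_itvcc_center (m x))//.
  apply: le_measure; rewrite ?inE//; first exact: measurable_xsection.
  move=> y; rewrite /xsection /= inE => /h2 /=.
  by rewrite in_itv /= distrC ler_distlC.
- move=> x xc; suff -> : xsection B x = set0 by rewrite measure0.
  rewrite -subset0 => y; rewrite /xsection /= inE => /h1 /=.
  by rewrite leNgt xc.
Qed.

Lemma le_area_ysection (R : realType) (B : set (R * R)) (c e1 e2 : R) (m : R -> R) :
  0 <= e1 -> 0 <= e2 -> measurable B ->
  (forall p, B p -> `|p.2 - c| <= e1) ->
  (forall p, B p -> `|p.1 - m p.2| <= e2) ->
  (area2 B <= (2 * e1 * (2 * e2))%:E)%E.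
Proof.
move=> e10 e20 mB h1 h2; rewrite /area2.
(* Horizontal sections are those of the product measure built in the other order; the two agree on
   rectangles, hence everywhere. *)
rewrite (@product_measure_unique _ _ _ _ _ _ _ (lebesgue_measure \x^ lebesgue_measure)%E)//; last first.
  by move=> A1 A2 mA1 mA2; exact: product_measure2E.
apply: (@le_integral_section _ _ c) => //=.
- by rewrite mulr_ge0.
- exact: measurable_fun_ysection.
- move=> x; rewrite -(lebesgue_itvcc_center (m x))//.
  apply: le_measure; rewrite ?inE//; first exact: measurable_ysection.
  move=> y; rewrite /ysection /= inE => /h2 /=.
  by rewrite in_itv /= distrC ler_distlC.
- move=> x xc; suff -> : ysection B x = set0 by rewrite measure0.
  rewrite -subset0 => y; rewrite /ysection /= inE => /h1 /=.
  by rewrite leNgt xc.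
Qed.

(** [E] may fail to be measurable; the intersection over [n] of the finite covers is a measurable
    null set containing it. *)
Lemma negligible_cover (R : realType) (E : set (R * R)) (K : R) :
  (forall n : nat, exists (m : nat) (B : nat -> set (R * R)) (a : R),
    [/\ forall i, measurable (B i), E `<=` \bigcup_(i < m) B i,
        forall i, (area2 (B i) <= a%:E)%E & m%:R * a <= K / n.+1%:R]) ->
  area2.-negligible E.
Proof.
move=> h.
have {}h n : exists B : set (R * R), [/\ measurable B, E `<=` B & (area2 B <= (K / n.+1%:R)%:E)%E].
  have [m [B [a [mB EB Ba ma]]]] := h n.
  exists (\big[setU/set0]_(i < m) B i); split.
  - by apply: bigsetU_measurable => i _.
  - by rewrite -bigcup_mkord.
  apply: (@le_trans _ _ (m%:R * a)%:E); last by rewrite lee_fin.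
  elim: m {EB ma} => [|m ih]; first by rewrite big_ord0 mul0r /area2 measure0.
  rewrite big_ord_recr /= -natr1 mulrDl mul1r EFinD /area2.
  apply: le_trans (leeD ih (Ba m)); apply: measureU2; last exact: mB.
  by apply: bigsetU_measurable => i _; exact: mB.
have /choice[B hB] := h.
exists (\bigcap_n B n); split.
- by apply: bigcap_measurable => // n _; case: (hB n).
- have bn n : (area2 (\bigcap_n B n) <= (K / n.+1%:R)%:E)%E.
    have [mB _] := hB n; apply: le_trans; apply: le_measure; rewrite ?inE//.
    - by apply: bigcap_measurable => // k _; case: (hB k).
    - exact: bigcap_inf.
  apply/eqP; rewrite eq_le measure_ge0 andbT.
  have := bn; case: (area2 _) => [r rn| /(_ 0%N)|]//.
  rewrite lee_fin leNgt; apply/negP => r0.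
  (* An index [n] with [K / n.+1%:R < r]. *)
  have := rn (Num.truncn (K / r)).
  rewrite lee_fin ler_pdivlMr// mulrC -ler_pdivlMr// leNgt truncnS_gt//.
- by move=> p Ep n _; case: (hB n) => _ + _; apply.
Qed.

(** With [e2] much smaller than [e1], a thin band normal to [w] across a square centred at [p]. *)
Definition strip (R : realType) (p w : R * R) (e1 e2 : R) : set (R * R) :=
  [set q | [/\ `|q.1 - p.1| <= e1, `|q.2 - p.2| <= e1 &
     `|w.1 * (q - p).1 + w.2 * (q - p).2| <= e2]].

Lemma measurable_strip (R : realType) (p w : R * R) (e1 e2 : R) :
  measurable (strip p w e1 e2).
Proof.
have mle (f : R * R -> R) (e : R) : measurable_fun setT f -> measurable [set q | `|f q| <= e].
  move=> mf; have := mf measurableT _ (measurable_itv `[- e, e]).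
  by rewrite setTI; congr measurable; apply/seteqP; split=> q /=; rewrite in_itv /= ler_norml.
have m1 : measurable_fun setT (fun q : R * R => q.1 - p.1).
  by apply: measurable_funB => //; exact: measurable_fst.
have m2 : measurable_fun setT (fun q : R * R => q.2 - p.2).
  by apply: measurable_funB => //; exact: measurable_snd.
have -> : strip p w e1 e2 = [set q | `|q.1 - p.1| <= e1] `&` [set q | `|q.2 - p.2| <= e1]
   `&` [set q | `|w.1 * (q.1 - p.1) + w.2 * (q.2 - p.2)| <= e2].
  by apply/seteqP; split=> q /=; [case|case; case].
apply: measurableI; first by apply: measurableI; exact: mle.
by apply: mle; apply: measurable_funD; apply: measurable_funM.
Qed.

Lemma strip_coord (R : realType) (a b x y e2 : R) : 1 <= `|a| -> `|a * x + b * y| <= e2 ->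
  `|x - (- (b / a) * y)| <= e2.
Proof.
move=> a1 h; have a0 : a != 0 by rewrite -normr_gt0 (lt_le_trans _ a1).
have -> : x - (- (b / a) * y) = a^-1 * (a * x + b * y) by field.
rewrite normrM normfV ler_pdivrMl ?(lt_le_trans _ a1)//.
by apply: (le_trans h); rewrite ler_peMl// (le_trans _ h).
Qed.

(** In the max norm some coordinate of [w] has absolute value at least 1; solving for the matching
    coordinate of [q] gives sections of half-length [e2]. *)
Lemma area_strip (R : realType) (p w : R * R) (e1 e2 : R) :
  0 <= e1 -> 0 <= e2 -> 1 <= `|w| ->
  (area2 (strip p w e1 e2) <= (2 * e1 * (2 * e2))%:E)%E.
Proof.
move=> e10 e20; rewrite prod_normE le_max => /orP[] w1.
  apply: (@le_area_ysection _ _ p.2 _ _ (fun y => p.1 - w.2 / w.1 * (y - p.2))) => //.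
  - exact: measurable_strip.
  - by move=> q [].
  move=> q [_ _ /(strip_coord w1)] /=; congr (`|_| <= _); ring.
apply: (@le_area_xsection _ _ p.1 _ _ (fun x => p.2 - w.1 / w.2 * (x - p.1))) => //.
- exact: measurable_strip.
- by move=> q [].
move=> q [_ _]; rewrite addrC => /(strip_coord w1) /=; congr (`|_| <= _); ring.
Qed.

Lemma truncn_dist (R : realType) (x y : R) : 0 <= x -> 0 <= y ->
  Num.truncn x = Num.truncn y -> `|x - y| <= 1.
Proof.
move=> /truncn_itv /andP[x1 x2] /truncn_itv /andP[y1 y2] E.
by rewrite E in x1 x2; rewrite ler_norml; move: x2 y2; rewrite -natr1; lra.
Qed.

(** The shift by 1 makes the argument of [truncn] nonnegative whenever [|x - c| <= 1]; the cells
    have side [n.+1%:R^-1]. *)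
Definition grid (R : realType) (n : nat) (c x : R) : nat :=
  Num.truncn (n.+1%:R * (x - c + 1)).

Lemma gridP (R : realType) (n : nat) (c x y : R) :
  `|x - c| <= 1 -> `|y - c| <= 1 -> grid n c x = grid n c y ->
  `|x - y| <= n.+1%:R^-1.
Proof.
rewrite !ler_norml => /andP[x1 x2] /andP[y1 y2] /truncn_dist.
have N0 : 0 < n.+1%:R :> R by [].
rewrite !pmulr_rge0//= => /(_ _ _)/wrap[]; try lra.
rewrite -mulrBr normrM gtr0_norm// -ler_pdivlMl// mulr1.
have -> : x - c + 1 - (y - c + 1) = x - y by ring.
by rewrite ler_norml.
Qed.

Lemma grid_lt (R : realType) (n : nat) (c x : R) :
  `|x - c| <= 1 -> (grid n c x < (n.+1).*2.+1)%N.
Proof.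
rewrite ler_norml => /andP[x1 x2]; rewrite ltnS /grid.
have N0 : 0 < n.+1%:R :> R by [].
rewrite truncn_le_nat -[_.*2.+1%:R]natr1 -mul2n natrM; nra.
Qed.

(* Sort the points by the cell of side [1 / N] containing [v x]: each of the [O(N^2)] cells maps
   into a strip of size [C / N] by [C / N^2], and the total area is [O(1 / N)]. *)
Lemma strip_negligible (R : realType) (X : Type) (D : set X) (p v : X -> R * R)
    (v0 : R * R) (C : R) : 0 <= C ->
  (forall x, D x -> `|v x - v0| <= 1) ->
  (forall x, D x -> exists2 w : R * R, 1 <= `|w| & forall y, D y ->
     `|p y - p x| <= C * `|v y - v x| /\
     `|w.1 * (p y - p x).1 + w.2 * (p y - p x).2| <= C * `|v y - v x| ^+ 2) ->
  area2.-negligible (p @` D).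
Proof.
(* At most [(3 N) ^ 2] cells, each sent into a strip of area at most [4 C ^ 2 / N ^ 3]. *)
move=> C0 Dv Dw; apply: (@negligible_cover _ _ (36 * C ^+ 2)) => n.
have N0 : 0 < n.+1%:R :> R by [].
set N : R := n.+1%:R in N0 *.
pose M := ((n.+1).*2.+1)%N.
(* Both grid indices are below [M], so they are the digits of [key x] in base [M]. *)
pose key x := (grid n v0.1 (v x).1 * M + grid n v0.2 (v x).2)%N.
have v01 x : D x -> `|(v x).1 - v0.1| <= 1.
  by move=> /Dv; exact: le_trans (norm_fst_le (v x - v0)).
have v02 x : D x -> `|(v x).2 - v0.2| <= 1.
  by move=> /Dv; exact: le_trans (norm_snd_le (v x - v0)).
have key_lt x : D x -> (key x < M ^ 2)%N.
  move=> Dx; have g1 := grid_lt n (v01 _ Dx); have g2 := grid_lt n (v02 _ Dx).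
  by rewrite /key /M in g1 g2 *; nia.
have keyP x y : D x -> D y -> key y = key x -> `|v y - v x| <= N^-1.
  move=> Dx Dy; have g1 := grid_lt n (v02 _ Dx); have g2 := grid_lt n (v02 _ Dy).
  move=> E; have [E1 E2] : grid n v0.1 (v y).1 = grid n v0.1 (v x).1 /\
     grid n v0.2 (v y).2 = grid n v0.2 (v x).2.
    move: E (congr1 (modn^~ M) E) (congr1 (divn^~ M) E); rewrite /key => _.
    by rewrite !modnMDl !divnMDl// !modn_small// !divn_small// !addn0.
  rewrite norm_prod_le; apply/andP; split.
    exact: gridP (v01 _ Dy) (v01 _ Dx) E1.
  exact: gridP (v02 _ Dy) (v02 _ Dx) E2.
pose good i (B : set (R * R)) := [/\ measurable B,
   (area2 B <= (2 * (C / N) * (2 * (C / N ^+ 2)))%:E)%E &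
   forall x, D x -> key x = i -> B (p x)].
have goodE i : exists B, good i B.
  have [[x [Dx <-]]|nx] := pselect (exists x, D x /\ key x = i); last first.
    exists set0; split => //; first by rewrite /area2 measure0 lee_fin !mulr_ge0// ?invr_ge0 ?exprn_ge0// ltW.
    by move=> x Dx xi; exfalso; apply: nx; exists x.
  have [w w1 hw] := Dw x Dx.
  exists (strip (p x) w (C / N) (C / N ^+ 2)); split.
  - exact: measurable_strip.
  - by apply: area_strip => //; rewrite divr_ge0// ?exprn_ge0// ltW.
  - move=> y Dy /(keyP _ _ Dx Dy) vyx; have [h1 h2] := hw y Dy.
    have pyx : `|p y - p x| <= C / N by rewrite (le_trans h1)// ler_wpM2l.
    split.
    + exact: le_trans (norm_fst_le (p y - p x)) pyx.
    + exact: le_trans (norm_snd_le (p y - p x)) pyx.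
    + by rewrite (le_trans h2)// ler_wpM2l// -exprVn lerXn2r ?nnegrE// invr_ge0 ltW.
have /choice[B hB] := goodE.
exists (M ^ 2)%N, B, (2 * (C / N) * (2 * (C / N ^+ 2))); split.
- by move=> i; case: (hB i).
- by move=> _ [x Dx <-]; exists (key x); [exact: key_lt|case: (hB (key x)) => _ _; apply].
- by move=> i; case: (hB i).
have MN : M%:R <= 3 * N :> R by rewrite /M /N -(natrM _ 3) ler_nat; lia.
rewrite natrX ler_pdivlMr//.
have -> : M%:R ^+ 2 * (2 * (C / N) * (2 * (C / N ^+ 2))) * N = 4 * C ^+ 2 * (M%:R / N) ^+ 2.
  by field; lra.
have -> : 36 * C ^+ 2 = 4 * C ^+ 2 * 3 ^+ 2 by ring.
rewrite ler_wpM2l ?mulr_ge0 ?exprn_ge0// lerXn2r ?nnegrE ?divr_ge0 ?(ltW N0)//.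
by rewrite ler_pdivrMr.
Qed.

(** The bound makes [p] a Lipschitz function of the real parameter [s], so at most [3 N] squares of
    area [4 C ^ 2 / N ^ 2] cover the image. *)
Lemma curve_negligible (R : realType) (X : Type) (D : set X) (p : X -> R * R)
    (s : X -> R) (s0 C : R) : 0 <= C ->
  (forall x, D x -> `|s x - s0| <= 1) ->
  (forall x y, D x -> D y -> `|p y - p x| <= C * `|s y - s x|) ->
  area2.-negligible (p @` D).
Proof.
move=> C0 Ds Dp; apply: (@negligible_cover _ _ (12 * C ^+ 2)) => n.
have N0 : 0 < n.+1%:R :> R by [].
set N : R := n.+1%:R in N0 *.
pose key x := grid n s0 (s x).
pose good i (B : set (R * R)) := [/\ measurable B,
   (area2 B <= (2 * (C / N) * (2 * (C / N)))%:E)%E &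
   forall x, D x -> key x = i -> B (p x)].
have goodE i : exists B, good i B.
  have [[x [Dx <-]]|nx] := pselect (exists x, D x /\ key x = i); last first.
    exists set0; split => //; first by rewrite /area2 measure0 lee_fin !mulr_ge0// ?invr_ge0// ltW.
    by move=> x Dx xi; exfalso; apply: nx; exists x.
  exists (strip (p x) e_x (C / N) (C / N)); split.
  - exact: measurable_strip.
  - by apply: area_strip; rewrite ?norm_e_x// divr_ge0// ltW.
  - move=> y Dy /(gridP (Ds _ Dy) (Ds _ Dx)) syx.
    have pyx : `|p y - p x| <= C / N by rewrite (le_trans (Dp _ _ Dx Dy))// ler_wpM2l.
    split.
    + exact: le_trans (norm_fst_le (p y - p x)) pyx.
    + exact: le_trans (norm_snd_le (p y - p x)) pyx.
    + by rewrite mul1r mul0r addr0; exact: le_trans (norm_fst_le (p y - p x)) pyx.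
have /choice[B hB] := goodE.
exists (n.+1).*2.+1, B, (2 * (C / N) * (2 * (C / N))); split.
- by move=> i; case: (hB i).
- move=> _ [x Dx <-]; exists (key x); last by case: (hB (key x)) => _ _; apply.
  exact: grid_lt (Ds _ Dx).
- by move=> i; case: (hB i).
have MN : (n.+1).*2.+1%:R <= 3 * N :> R by rewrite /N -(natrM _ 3) ler_nat; lia.
rewrite ler_pdivlMr//.
have -> : (n.+1).*2.+1%:R * (2 * (C / N) * (2 * (C / N))) * N = 4 * C ^+ 2 * ((n.+1).*2.+1%:R / N).
  by field; lra.
have -> : 12 * C ^+ 2 = 4 * C ^+ 2 * 3 by ring.
by rewrite ler_wpM2l ?mulr_ge0 ?exprn_ge0// ler_pdivrMr.
Qed.

Lemma rat_approx (R : realType) (x e : R) : 0 < e -> exists r : rat, `|x - ratr r| < e.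
Proof.
move=> e0; have [r] : exists r : rat, ratr r \in `]x - e, x + e[.
  by apply: rat_in_itvoo; lra.
by rewrite in_itv /= -ltr_distlC => h; exists r.
Qed.

(** Lindelof's argument: among the countably many balls of rational centre and radius [n.+1%:R^-1],
    those whose part of [D] has negligible image already cover [D]. *)
Lemma local_negligible (R : realType) (D : set ((R * R) * (R * R)))
    (p : (R * R) * (R * R) -> R * R) :
  (forall q0, D q0 -> exists2 d : R, 0 < d &
     area2.-negligible (p @` [set q | D q /\ `|q - q0| < d])) ->
  area2.-negligible (p @` D).
Proof.
move=> h.
pose c (r : (rat * rat) * (rat * rat)) : (R * R) * (R * R) :=
  ((ratr r.1.1, ratr r.1.2), (ratr r.2.1, ratr r.2.2)).
pose box (r : (rat * rat) * (rat * rat)) (n : nat) : set (R * R) :=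
  p @` [set q | D q /\ `|q - c r| < n.+1%:R^-1].
(* Integers that code nothing and boxes that are not negligible contribute [set0], so the union over
   all codes is negligible by construction. *)
pose F (k : nat) : set (R * R) := if @unpickle ((rat * rat) * (rat * rat) * nat)%type k is Some rn then
   (if asbool (area2.-negligible (box rn.1 rn.2)) then box rn.1 rn.2 else set0) else set0.
have : area2.-negligible (\bigcup_k F k).
  apply: negligible_bigcup => k; rewrite /F; case: unpickle => [rn|]; last exact: negligible_set0.
  by case: asboolP => // _; exact: negligible_set0.
apply: negligibleS => _ [q0 Dq0 <-]; have [d d0 nd] := h _ Dq0.
(* Twice the radius is below [d], so a rational ball containing [q0] lies in the ball of radius [d]
   around [q0]. *)
pose n := Num.truncn (2 / d).
have nd2 : 2 * n.+1%:R^-1 < d.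
  by rewrite ltr_pdivrMr// -ltr_pdivrMl// mulrC truncnS_gt.
have n0 : 0 < n.+1%:R^-1 :> R by rewrite invr_gt0.
have [a ha] := rat_approx q0.1.1 n0; have [b hb] := rat_approx q0.1.2 n0.
have [e he] := rat_approx q0.2.1 n0; have [f hf] := rat_approx q0.2.2 n0.
pose r := ((a, b), (e, f)).
have q0r : `|q0 - c r| < n.+1%:R^-1.
  by rewrite prod_normE gt_max !norm_prod_lt /=; apply/andP; split; apply/andP; split.
have Frn : F (pickle (r, n)) = if asbool (area2.-negligible (box r n)) then box r n else set0.
  by rewrite /F pickleK.
move: (pickle _) Frn => j Frn; exists j; rewrite ?Frn//.
case: asboolP => [_|]; first by exists q0.
move=> nn; exfalso; apply: nn; apply: negligibleS nd => _ [q [Dq qr] <-].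
exists q => //; split=> //; apply: lt_trans nd2.
rewrite -(subrK (c r) q) -addrA (le_lt_trans (ler_normD _ _))// mulrDl mul1r ltrD//.
by rewrite distrC.
Qed.

Lemma negligible_point (R : realType) (a : R * R) : area2.-negligible [set a].
Proof.
have -> : [set a] = (fun _ : unit => a) @` setT.
  by apply/seteqP; split=> [_ ->|_ [_ _ <-]]//; exists tt.
apply: (@curve_negligible _ _ _ _ (fun _ => 0) 0 0) => // [_ _|_ _ _ _].
  by rewrite subrr normr0.
by rewrite subrr normr0 mul0r.
Qed.

(** * Sums of gradients with singular Jacobian *)

Lemma sum_bounds (R : realDomainType) (x y p q : R) :
  0 <= x -> 0 <= y -> 0 <= p -> 0 <= q ->
  [/\ 1 <= 1 + x + y + p + q, 1 + x <= 1 + x + y + p + q,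
     1 + y <= 1 + x + y + p + q, p <= 1 + x + y + p + q & q <= 1 + x + y + p + q].
Proof. by move=> x0 y0 p0 q0; split; lra. Qed.

Lemma C1_bounds (R : realType) (U : set (R * R)) (f : R * R -> R) (z0 : R * R) :
  open U -> smooth_on U f -> U z0 ->
  exists2 e : R, 0 < e & exists2 K : R, 1 <= K &
  forall z w, `|z - z0| < e -> `|w - z0| < e ->
  [/\ U z, `|'D_e_x f z| <= K, `|'D_e_y f z| <= K, `|f w - f z| <= K * `|w - z| &
   `|f w - f z - ((w - z).1 * 'D_e_x f z + (w - z).2 * 'D_e_y f z)|
     <= K * `|w - z| ^+ 2].
Proof.
move=> oU sf Uz0; have C := smooth_C1 oU sf Uz0.
have Cx := smooth_C1 oU (smooth_derive e_x sf) Uz0.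
have Cy := smooth_C1 oU (smooth_derive e_y sf) Uz0.
have [e1 e10 [K1 K10 h1]] := C1_lipschitz C.
have [e2 e20 [K2 K20 h2]] := C1_taylor C Cx Cy.
have [_ cx cy] := C.
have [e3 e30 h3] := continuousE_norm cx ltr01.
have [e4 e40 h4] := continuousE_norm cy ltr01.
have [e5 e50 h5] := open_contains_ball oU Uz0.
pose M := 1 + `|'D_e_x f z0| + `|'D_e_y f z0| + K1 + K2.
have n1 := normr_ge0 ('D_e_x f z0); have n2 := normr_ge0 ('D_e_y f z0).
exists (Num.min e1 (Num.min e2 (Num.min e3 (Num.min e4 e5)))).
  by rewrite !lt_min e10 e20 e30 e40.
have [M1 Mx My MK1 MK2] := sum_bounds n1 n2 (ltW K10) (ltW K20).
exists M => // z w; rewrite !lt_min => /and5P[z1 z2 z3 z4 z5] /and5P[w1 w2 w3 w4 w5].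
split.
- exact: h5.
- apply: le_trans Mx; rewrite -lerBlDr; apply: (le_trans (lerB_dist _ _)).
  exact/ltW/h3.
- apply: le_trans My; rewrite -lerBlDr; apply: (le_trans (lerB_dist _ _)).
  exact/ltW/h4.
- by rewrite (le_trans (h1 _ _ z1 w1))// ler_wpM2r.
- by rewrite (le_trans (h2 _ _ z2 w2))// ler_wpM2r// exprn_ge0.
Qed.

(* The matrix has rows [(x, y)] and [(y, z)]. *)
Lemma singular_null_vector (R : realType) (x y z t : R) :
  x + z = t -> x * z = y ^+ 2 -> 0 < t ->
  exists w : R * R, [/\ w.1 * x + w.2 * y = 0, w.1 * y + w.2 * z = 0,
     t <= 2 * `|w|, `|w.1| <= `|x| + `|y| + `|z| & `|w.2| <= `|x| + `|y| + `|z|].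
Proof.
move=> xz xy t0.
have hx := normr_ge0 x; have hy := normr_ge0 y; have hz := normr_ge0 z.
have [h|h] : t <= 2 * `|z| \/ t <= 2 * `|x|.
  have := ler_norm x; have := ler_norm z; case: (lerP t (2 * `|z|)) => ? ? ?; [left|right]; lra.
- exists (z, - y); split => /=; rewrite ?normrN.
  + by rewrite (mulrC z) xy; ring.
  + by ring.
  + by rewrite (le_trans h)// ler_pM2l// (norm_fst_le (z, - y)).
  + lra.
  + lra.
- exists (- y, x); split => /=; rewrite ?normrN.
  + by ring.
  + by rewrite xy; ring.
  + by rewrite (le_trans h)// ler_pM2l// (norm_snd_le (- y, x)).
  + lra.
  + lra.
Qed.

(* Let [A] have rows [(a, b)] and [(b, d)], similarly [A'], and let [w (A + A') = 0]: then
   [w A (h - l) = w (A h + A' l)], and [W] is a multiple of [w A]. *)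
Lemma strip_direction (R : realType) (a b d a' b' d' k K : R) :
  0 < k -> 1 <= K -> a + d = k -> a' + d' = k ->
  `|a| <= K -> `|b| <= K -> `|d| <= K -> `|a'| <= K -> `|b'| <= K -> `|d'| <= K ->
  (a + a') * (d + d') = (b + b') ^+ 2 -> 1 <= K * `|a * d - b ^+ 2| ->
  exists2 W : R * R, 1 <= `|W| & forall h l : R * R, forall e,
   `|h.1 * a + h.2 * b + (l.1 * a' + l.2 * b')| <= e ->
   `|h.1 * b + h.2 * d + (l.1 * b' + l.2 * d')| <= e ->
   `|W.1 * (h - l).1 + W.2 * (h - l).2| <= 24 * K ^+ 3 / k * e.
Proof.
move=> k0 K1 ad ad' aK bK dK aK' bK' dK' S0 detK.
have [w [w1 w2 wk w1K w2K]] : exists w : R * R,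
    [/\ w.1 * (a + a') + w.2 * (b + b') = 0, w.1 * (b + b') + w.2 * (d + d') = 0,
     k <= `|w|, `|w.1| <= 6 * K & `|w.2| <= 6 * K].
  have [|//||w [w1 w2 wk w1K w2K]] := @singular_null_vector _ (a + a') (b + b') (d + d') (2 * k).
  - lra.
  - lra.
  have : `|a + a'| + `|b + b'| + `|d + d'| <= 6 * K.
    have := ler_normD a a'; have := ler_normD b b'; have := ler_normD d d'; lra.
  by exists w; split=> //; lra.
pose V : R * R := (w.1 * a + w.2 * b, w.1 * b + w.2 * d).
(* [V] is [w A]; multiplying by the adjugate of [A] gives [det A] times [w], and [|det A|] is at
   least [1 / K]. *)
have Vw : k <= 2 * K ^+ 2 * `|V|.
  have N0 : 0 <= `|V| by [].
  have det1 : `|a * d - b ^+ 2| * `|w.1| <= 2 * K * `|V|.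
    rewrite -normrM; have -> : (a * d - b ^+ 2) * w.1 = V.1 * d + V.2 * (- b) by rewrite /V /=; ring.
    rewrite (_ : 2 * K = K + K); last by lra.
    by apply: lincomb_bound; rewrite ?normrN ?norm_fst_le ?norm_snd_le.
  have det2 : `|a * d - b ^+ 2| * `|w.2| <= 2 * K * `|V|.
    rewrite -normrM; have -> : (a * d - b ^+ 2) * w.2 = V.1 * (- b) + V.2 * a by rewrite /V /=; ring.
    rewrite (_ : 2 * K = K + K); last by lra.
    by apply: lincomb_bound; rewrite ?normrN ?norm_fst_le ?norm_snd_le.
  have det3 : `|a * d - b ^+ 2| * `|w| <= 2 * K * `|V|.
    by rewrite [`|w|]prod_normE maxr_pMr// ge_max det1.
  have H : K * `|a * d - b ^+ 2| * `|w| <= K * (2 * K * `|V|).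
    by rewrite -mulrA ler_pM2l//; lra.
  apply: (le_trans wk); apply: (@le_trans _ _ (K * `|a * d - b ^+ 2| * `|w|)).
    by rewrite ler_peMl.
  by apply: (le_trans H); rewrite expr2 !mulrA (mulrC K).
have K0 : 0 < 2 * K ^+ 2 / k by rewrite divr_gt0// mulr_gt0// exprn_gt0//; lra.
(* The scaling turns [k <= 2 * K ^+ 2 * |V|] into [1 <= |W|]. *)
exists ((2 * K ^+ 2 / k) *: V).
  rewrite normrZ (gtr0_norm K0) mulrAC ler_pdivlMr// mul1r//.
move=> h l e h1 h2.
set c := 2 * K ^+ 2 / k in K0 *.
have e1 : w.1 * a' + w.2 * b' = - V.1 by rewrite /V /=; lra.
have e2 : w.1 * b' + w.2 * d' = - V.2 by rewrite /V /=; lra.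
have -> : (c *: V).1 * (h - l).1 + (c *: V).2 * (h - l).2 =
   c * (w.1 * (h.1 * a + h.2 * b + (l.1 * a' + l.2 * b')) +
        w.2 * (h.1 * b + h.2 * d + (l.1 * b' + l.2 * d'))).
  transitivity (c * (w.1 * (h.1 * a + h.2 * b) + w.2 * (h.1 * b + h.2 * d) +
      (l.1 * (- V.1) + l.2 * (- V.2)))).
    have [-> ->] : (c *: V).1 = c * V.1 /\ (c *: V).2 = c * V.2 by [].
    have [-> ->] : (h - l).1 = h.1 - l.1 /\ (h - l).2 = h.2 - l.2 by [].
    by rewrite /V /=; ring.
  by rewrite -e1 -e2; ring.
rewrite normrM (gtr0_norm K0).
have -> : 24 * K ^+ 3 / k * e = c * ((e + e) * (6 * K)) by rewrite /c; field; lra.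
by rewrite ler_pM2l//; exact: lincomb_bound.
Qed.

(** Quantifying over all [K] above a threshold lets several such bounds share one constant. *)
Lemma C1_bounds_eventually (R : realType) (U : set (R * R)) (f : R * R -> R) (z0 : R * R) :
  open U -> smooth_on U f -> U z0 ->
  exists2 e : R, 0 < e & exists2 K0 : R, 1 <= K0 &
  forall K z w, K0 <= K -> `|z - z0| < e -> `|w - z0| < e ->
  [/\ U z, `|'D_e_x f z| <= K, `|'D_e_y f z| <= K, `|f w - f z| <= K * `|w - z| &
   `|f w - f z - ((w - z).1 * 'D_e_x f z + (w - z).2 * 'D_e_y f z)|
     <= K * `|w - z| ^+ 2].
Proof.
move=> oU sf Uz0; have [e e0 [K0 K01 h]] := C1_bounds oU sf Uz0.
exists e => //; exists K0 => // K z w KK ze we; have [h1 h2 h3 h4 h5] := h z w ze we.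
split=> //.
- exact: (le_trans h2 KK).
- exact: (le_trans h3 KK).
- by apply: (le_trans h4); rewrite ler_wpM2r.
- by apply: (le_trans h5); rewrite ler_wpM2r// exprn_ge0.
Qed.

Lemma normD_approx0 (R : realType) (x y s t e e' : R) :
  x + y = 0 -> `|x - s| <= e -> `|y - t| <= e' -> `|s + t| <= e + e'.
Proof.
move=> xy hs ht; rewrite (_ : s + t = - ((x - s) + (y - t))); last by lra.
by rewrite normrN (le_trans (ler_normD _ _))// lerD.
Qed.

(* With [F = (f, g)] of symmetric derivative, [u = q.1] and [v = q.2], differentiating
   [F u + F v = 0] bounds [u] by [v] where [DF u] is invertible, and where [DF u + DF v] is singular
   it confines [v - u] to a strip of quadratic width. *)
Lemma transversal_negligible (R : realType) (U : set (R * R)) (f g : R * R -> R)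
    (k s : R) :
  open U -> smooth_on U f -> smooth_on U g ->
  (forall z, U z -> 'D_e_y f z = 'D_e_x g z) ->
  0 < k -> (forall z, U z -> 'D_e_x f z + 'D_e_y g z = k) ->
  area2.-negligible ((fun q : (R * R) * (R * R) => s *: (q.2 - q.1)) @`
    [set q | [/\ U q.1, U q.2, f q.1 + f q.2 = 0, g q.1 + g q.2 = 0 &
      ('D_e_x f q.1 + 'D_e_x f q.2) * ('D_e_y g q.1 + 'D_e_y g q.2)
        = ('D_e_y f q.1 + 'D_e_y f q.2) ^+ 2 /\
      'D_e_x f q.1 * 'D_e_y g q.1 - 'D_e_y f q.1 ^+ 2 != 0]]).
Proof.
move=> oU sf sg sym k0 tr; apply: local_negligible => -[u0 v0] [/= Uu0 Uv0 _ _ [_ det0]].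
pose det z := 'D_e_x f z * 'D_e_y g z - 'D_e_y f z ^+ 2.
have cdet : {for u0, continuous det}.
  have dd (h : R * R -> R) v : smooth_on U h -> differentiable ('D_v h) u0.
    by move=> sh; apply: smooth_diff Uu0; exact: smooth_derive.
  apply: (@continuousB _ _ _ ('D_e_x f * 'D_e_y g) ('D_e_y f ^+ 2)).
    by apply: continuousM; apply: differentiable_continuous; exact: dd.
  by apply: continuousM; apply: differentiable_continuous; exact: dd.
have [e1 e10 [K1 K11 h1]] := C1_bounds_eventually oU sf Uu0.
have [e2 e20 [K2 K21 h2]] := C1_bounds_eventually oU sg Uu0.
have [e3 e30 [K3 K31 h3]] := C1_bounds_eventually oU sf Uv0.
have [e4 e40 [K4 K41 h4]] := C1_bounds_eventually oU sg Uv0.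
have [e5 e50 [K5 K50 h5]] : exists2 d : R, 0 < d & exists2 K : R, 0 < K &
  forall z w, `|z - u0| < d -> `|w - u0| < d ->
    `|w - z| <= K * (`|f w - f z| + `|g w - g z|).
  apply: inverse_lipschitz; try exact: smooth_C1 oU _ Uu0.
  by rewrite -(sym _ Uu0).
have det2 : 0 < `|det u0| / 2 by rewrite divr_gt0// normr_gt0.
have [e6 e60 h6] := continuousE_norm cdet det2.
have := normr_gt0 (det u0); rewrite det0 => det00.
(* Near [u0] the determinant keeps at least half its absolute value, so [K6] bounds its inverse. *)
pose K6 := 2 / `|det u0|.
have K60 : 0 < K6 by rewrite divr_gt0.
pose K := K1 + K2 + K3 + K4 + K5 + K6.
have [[KK1 KK2 KK3] [KK4 KK5 KK6]] :
  [/\ K1 <= K, K2 <= K & K3 <= K] /\ [/\ K4 <= K, K5 <= K & K6 <= K].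
  rewrite /K; move: (K6) K60 K50 K11 K21 K31 K41; clear; move=> x6 *; split; split; lra.
have K_1 : 1 <= K by exact: le_trans KK1.
have K_0 : 0 < K by exact: lt_le_trans K_1.
pose e := Num.min 1 (Num.min e1 (Num.min e2 (Num.min e3 (Num.min e4 (Num.min e5 e6))))).
exists e; first by rewrite /e !lt_min ltr01 e10 e20 e30 e40 e50.
(* The first summand serves the Lipschitz bound on [v - u], the second the width of the strip. *)
pose C := `|s| * (1 + 2 * K ^+ 2) + `|s| * (24 * K ^+ 3 / k * (4 * K ^+ 5 + K)).
have s0 := normr_ge0 s.
have Kn n : 0 <= K ^+ n by rewrite exprn_ge0// ltW.
have P1 : 0 <= 1 + 2 * K ^+ 2 by rewrite addr_ge0// mulr_ge0.
have P2 : 0 <= 24 * K ^+ 3 / k * (4 * K ^+ 5 + K).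
  apply: mulr_ge0; first by apply: divr_ge0; [exact: mulr_ge0|exact: ltW].
  by apply: addr_ge0; [exact: mulr_ge0|exact: ltW].
have C1 : `|s| * (1 + 2 * K ^+ 2) <= C by rewrite lerDl mulr_ge0.
have C2 : `|s| * (24 * K ^+ 3 / k * (4 * K ^+ 5 + K)) <= C by rewrite lerDr mulr_ge0.
apply: (@strip_negligible _ _ _ _ snd v0 C).
- by apply: le_trans C1; exact: mulr_ge0.
- move=> [u v] [_]; rewrite /e prod_normE gt_max /= !lt_min => /andP[_ /andP[+ _]].
  exact: ltW.
move=> [u1 v1] [[/= Uu1 Uv1 f1 g1 [S1 _]]].
rewrite /e prod_normE gt_max /= !lt_min.
move=> /andP[/and5P[_ u11 u12 _ /and3P[_ u15 u16]] /and5P[_ _ _ v13 /and3P[v14 _ _]]].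
have [_ bx by_ _ _] := h1 K _ _ KK1 u11 u11.
have [_ _ cy _ _] := h2 K _ _ KK2 u12 u12.
have [_ bx' by' _ _] := h3 K _ _ KK3 v13 v13.
have [_ _ cy' _ _] := h4 K _ _ KK4 v14 v14.
have detK : 1 <= K * `|det u1|.
  have : `|det u0| / 2 <= `|det u1|.
    have := h6 _ u16; have := ler_distD (det u1) (det u0) 0; rewrite !subr0 distrC.
    by move: (`|_|) (`|_|) (`|_|); clear; move=> *; lra.
  move=> h; apply: (@le_trans _ _ (K6 * (`|det u0| / 2))).
    suff -> : K6 * (`|det u0| / 2) = 1 by [].
    by rewrite /K6; field; rewrite gt_eqF.
  by rewrite ler_pM// ltW.
have [w w1 hw] := strip_direction k0 K_1 (tr _ Uu1) (tr _ Uv1) bx by_ cy bx' by' cy' S1 detK.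
exists w => // -[u v] [[/= Uu Uv fu gu [S _]]].
rewrite /e prod_normE gt_max /= !lt_min.
move=> /andP[/and5P[_ u_1 u_2 _ /and3P[_ u_5 u_6]] /and5P[_ _ _ v_3 /and3P[v_4 _ _]]].
have [_ _ _ _ Tf] := h1 K _ _ KK1 u11 u_1.
have [_ _ _ _ Tg] := h2 K _ _ KK2 u12 u_2.
have [_ _ _ Lf' Tf'] := h3 K _ _ KK3 v13 v_3.
have [_ _ _ Lg' Tg'] := h4 K _ _ KK4 v14 v_4.
have I := h5 _ _ u15 u_5.
have fe : (f u - f u1) + (f v - f v1) = 0 by rewrite addrACA -opprD f1 fu subrr.
have ge : (g u - g u1) + (g v - g v1) = 0 by rewrite addrACA -opprD g1 gu subrr.
set h := u - u1; set l := v - v1.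
(* Inverting [F] near [u0] and using [F u - F u1 = - (F v - F v1)] controls [u] by [v]; this is why
   [v] can serve as the parameter of the covering. *)
have hl : `|h| <= 2 * K ^+ 2 * `|l|.
  apply: (le_trans I); rewrite (eqP (_ : f u - f u1 == - (f v - f v1))); last by rewrite -addr_eq0 fe.
  rewrite (eqP (_ : g u - g u1 == - (g v - g v1))); last by rewrite -addr_eq0 ge.
  rewrite !normrN (_ : 2 * K ^+ 2 * `|l| = K * (K * `|l| + K * `|l|)); last by ring.
  by apply: ler_pM => //; [exact: ltW|exact: lerD].
have hl2 : K * `|h| ^+ 2 + K * `|l| ^+ 2 <= (4 * K ^+ 5 + K) * `|l| ^+ 2.
  rewrite (mulrDl (4 * K ^+ 5)) lerD2r.
  rewrite (_ : 4 * K ^+ 5 * `|l| ^+ 2 = K * (2 * K ^+ 2 * `|l|) ^+ 2); last by ring.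
  by rewrite ler_pM2l// lerXn2r ?nnegrE// mulr_ge0// mulr_ge0// exprn_ge0// ltW.
have E : (s *: (v - u) - s *: (v1 - u1)) = (- s) *: (h - l).
  rewrite -scalerBr scaleNr -scalerN; congr (_ *: _).
  by rewrite /h /l !opprB (addrC u1) addrACA (addrC (- u)).
split.
  rewrite E normrZ normrN; apply: (@le_trans _ _ (`|s| * (1 + 2 * K ^+ 2) * `|l|)); last by rewrite ler_wpM2r.
  rewrite -mulrA ler_wpM2l// mulrDl mul1r (le_trans (ler_normB _ _))// addrC lerD2l//.
have H : `|w.1 * (h - l).1 + w.2 * (h - l).2|
    <= 24 * K ^+ 3 / k * ((4 * K ^+ 5 + K) * `|l| ^+ 2).
  apply: hw; apply: le_trans hl2; first exact: normD_approx0 fe Tf Tf'.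
  rewrite (sym _ Uu1) (sym _ Uv1); exact: normD_approx0 ge Tg Tg'.
change (`|w.1 * (s *: (v - u) - s *: (v1 - u1)).1 + w.2 * (s *: (v - u) - s *: (v1 - u1)).2|
  <= C * `|l| ^+ 2).
rewrite E (_ : w.1 * _ + _ = - s * (w.1 * (h - l).1 + w.2 * (h - l).2)); last first.
  have [-> ->] : (- s *: (h - l)).1 = - s * (h - l).1 /\ (- s *: (h - l)).2 = - s * (h - l).2 by [].
  by ring.
rewrite normrM normrN; apply: (@le_trans _ _ (`|s| * (24 * K ^+ 3 / k * (4 * K ^+ 5 + K)) * `|l| ^+ 2)).
  by rewrite -[X in _ <= X]mulrA ler_wpM2l// -[X in _ <= X]mulrA.
by rewrite ler_wpM2r// exprn_ge0.
Qed.

(** * Unique continuation for holomorphic functions *)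

Lemma is_derive_expansion (R : realType) (f : R -> R) (x c : R) :
  is_derive x (1 : R) f c -> forall e, 0 < e ->
  exists2 d : R, 0 < d & forall h, `|h| < d -> `|f (x + h) - f x - h * c| <= e * `|h|.
Proof.
move=> [df dfc] e e0.
have : (fun h : R => h^-1 *: ((f \o shift x) (h *: (1 : R)) - f x)) @ 0^' --> c.
  by rewrite -dfc; exact: df.
move=> /cvgrPdist_lt /(_ _ e0).
move=> /nbhs_ballP[d /= d0 hd]; exists d => // h hd'.
have [->|h0] := eqVneq h 0; first by rewrite addr0 subrr mul0r subr0 normr0 mulr0.
have /= := hd h; rewrite -ball_normE /= sub0r normrN => /(_ hd' h0).
rewrite [h *: 1]mulr1 (addrC h) distrC => /ltW H.
rewrite (_ : f (x + h) - f x - h * c = h * (h^-1 *: (f (x + h) - f x) - c)); last first.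
  by rewrite mulrBr [h^-1 *: _]/(h^-1 * _) mulrA divff// mul1r.
by rewrite normrM mulrC ler_wpM2r.
Qed.

Lemma second_derivative_test (R : realType) (f f1 : R -> R) (e c : R) :
  0 < e -> (forall t, `|t| < e -> is_derive t (1 : R) f (f1 t)) ->
  is_derive 0 (1 : R) f1 c ->
  (forall t, `|t| < e -> f t <= f 0) -> c <= 0.
Proof.
move=> e0 df df1 fmax.
have in_e (t : R) : t \in `]- e, e[%R -> `|t| < e by rewrite in_itv /= ltr_norml.
have zero_e : 0 \in `](- e), e[%R by rewrite in_itv /= oppr_lt0 e0.
have f10 : f1 0 = 0.
  have ee : - e <= e by lra.
  have dfe (t : R) : t \in `]- e, e[%R -> derivable f t 1 by move=> /in_e /df [].
  have fm (t : R) : t \in `]- e, e[%R -> f t <= f 0 by move=> /in_e /fmax.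
  have [_ d1] := derive1_at_max ee dfe zero_e fm.
  by have [_ d2] := df 0 (in_e _ zero_e); rewrite -d2 d1.
rewrite leNgt; apply/negP => c0.
have c20 : 0 < c / 2 by rewrite divr_gt0.
have [d d0 hd] := is_derive_expansion df1 c20.
pose t := Num.min d e / 2.
have m0 : 0 < Num.min d e by rewrite lt_min d0.
have t0 : 0 < t by rewrite divr_gt0.
have : t < Num.min d e by rewrite ltr_pdivrMr// ltr_pMr// ltr1n.
rewrite lt_min => /andP[td te].
have sub (s : R) : s \in `[0, t]%R -> `|s| < e.
  by rewrite in_itv /= => /andP[s0 st]; rewrite ger0_norm// (le_lt_trans st).
have sub' (s : R) : s \in `]0, t[%R -> is_derive s (1 : R) f (f1 s).
  by move=> /subset_itv_oo_cc /sub /df.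
have cf : {within `[0 : R, t], continuous f}.
  by apply: derivable_within_continuous => s /sub /df [].
have [s s0t] := MVT t0 sub' cf.
have st : `|s| < e by apply/sub/subset_itv_oo_cc.
move: (s0t); rewrite in_itv /= subr0 => /andP[s0 s1] ft.
have := hd s; rewrite add0r f10 subr0 (gtr0_norm s0) (lt_trans s1 td) => /(_ isT).
rewrite ler_norml => /andP[h1 _].
have f1s : 0 < f1 s by apply: lt_le_trans (_ : s * (c / 2) <= _); [exact: mulr_gt0|lra].
have := fmax t; rewrite (gtr0_norm t0) te -subr_le0 ft => /(_ isT).
by rewrite leNgt mulr_gt0.
Qed.

(** The three summands are the second derivatives at 0 of [ln n], [m * ln d] and [d]; [m] will be
    the order of the zero that is divided out. *)
Lemma log_derivative_test (R : realType) (n n1 d d1 : R -> R) (n2 d2 m e : R) :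
  0 < e ->
  (forall t, `|t| < e -> [/\ 0 < n t, 0 < d t, is_derive t (1 : R) n (n1 t) &
     is_derive t (1 : R) d (d1 t)]) ->
  is_derive 0 (1 : R) n1 n2 -> is_derive 0 (1 : R) d1 d2 ->
  (forall t, `|t| < e -> ln (n t) - m * ln (d t) + d t <= ln (n 0) - m * ln (d 0) + d 0) ->
  (n2 * n 0 - n1 0 ^+ 2) / n 0 ^+ 2 - m * ((d2 * d 0 - d1 0 ^+ 2) / d 0 ^+ 2) + d2 <= 0.
Proof.
move=> e0 h dn1 dd1 hmax.
have [n00 d00 dn0 dd0] : [/\ 0 < n 0, 0 < d 0, is_derive 0 (1 : R) n (n1 0) &
     is_derive 0 (1 : R) d (d1 0)] by apply: h; rewrite normr0.
apply: (@second_derivative_test _ (fun t => ln (n t) - m * ln (d t) + d t)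
  (fun t => n1 t / n t - m * (d1 t / d t) + d1 t) e) => //.
- move=> t /h[nt dt dn dd].
  have D1 := is_derive1_comp (is_derive1_ln nt) dn.
  have D2 := is_derive1_comp (is_derive1_ln dt) dd.
  have D3 := is_deriveD (is_deriveB D1 (is_deriveZ m D2)) dd.
  apply: (is_derive_eq D3).
  change ((n t)^-1 * n1 t - m * ((d t)^-1 * d1 t) + d1 t =
    n1 t / n t - m * (d1 t / d t) + d1 t); ring.
- have Vn := is_deriveM dn1 (is_deriveV (lt0r_neq0 n00) dn0).
  have Vd := is_deriveM dd1 (is_deriveV (lt0r_neq0 d00) dd0).
  have D3 := is_deriveD (is_deriveB Vn (is_deriveZ m Vd)) dd1.
  apply: (is_derive_eq D3).
  change (n1 0 * (- n 0 ^- 2 * n1 0) + (n 0)^-1 * n2 -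
     m * (d1 0 * (- d 0 ^- 2 * d1 0) + (d 0)^-1 * d2) + d2 =
   (n2 * n 0 - n1 0 ^+ 2) / n 0 ^+ 2 - m * ((d2 * d 0 - d1 0 ^+ 2) / d 0 ^+ 2) + d2).
  by field; rewrite !gt_eqF.
Qed.

(* [P j + i Q j] is the [j]-th complex derivative of the holomorphic function [P 0 + i Q 0]. *)
Definition holomorphic_seq (R : realType) (U : set (R * R)) (P Q : nat -> R * R -> R) :=
  forall j z, U z ->
    [/\ differentiable (P j) z, differentiable (Q j) z,
        'D_e_x (P j) z = P j.+1 z /\ 'D_e_y (P j) z = - Q j.+1 z &
        'D_e_x (Q j) z = Q j.+1 z /\ 'D_e_y (Q j) z = P j.+1 z].

Definition sqmod (R : realType) (f g : R * R -> R) (z : R * R) : R :=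
  f z * f z + g z * g z.

Lemma is_derive_sumsq (R : realType) (p q p1 q1 : R -> R) (t : R) :
  is_derive t (1 : R) p (p1 t) -> is_derive t (1 : R) q (q1 t) ->
  is_derive t (1 : R) (fun s => p s * p s + q s * q s) (2 * (p t * p1 t + q t * q1 t)).
Proof.
move=> dp dq; have D := is_deriveD (is_deriveM dp dp) (is_deriveM dq dq).
apply: (is_derive_eq D).
change (p t * p1 t + p t * p1 t + (q t * q1 t + q t * q1 t) =
  2 * (p t * p1 t + q t * q1 t)); ring.
Qed.

Lemma is_derive_sumsq2 (R : realType) (p q p1 q1 : R -> R) (t p2 q2 : R) :
  is_derive t (1 : R) p (p1 t) -> is_derive t (1 : R) q (q1 t) ->
  is_derive t (1 : R) p1 p2 -> is_derive t (1 : R) q1 q2 ->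
  is_derive t (1 : R) (fun s => 2 * (p s * p1 s + q s * q1 s))
    (2 * (p1 t ^+ 2 + q1 t ^+ 2 + (p t * p2 + q t * q2))).
Proof.
move=> dp dq dp1 dq1.
have D := is_deriveZ 2 (is_deriveD (is_deriveM dp dp1) (is_deriveM dq dq1)).
apply: (is_derive_eq D).
change (2 * (p t * p2 + p1 t * p1 t + (q t * q2 + q1 t * q1 t)) =
  2 * (p1 t ^+ 2 + q1 t ^+ 2 + (p t * p2 + q t * q2))); ring.
Qed.

Lemma line_derivatives (R : realType) (U : set (R * R)) (P Q : nat -> R * R -> R)
    (z v : R * R) (t : R) j :
  holomorphic_seq U P Q -> U (z + t *: v) ->
  is_derive t (1 : R) (fun s : R => P j (z + s *: v))
    (v.1 * P j.+1 (z + t *: v) - v.2 * Q j.+1 (z + t *: v)) /\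
  is_derive t (1 : R) (fun s : R => Q j (z + s *: v))
    (v.1 * Q j.+1 (z + t *: v) + v.2 * P j.+1 (z + t *: v)).
Proof.
move=> hol Uzt; have [dP dQ [Px Py] [Qx Qy]] := hol j _ Uzt.
split; apply: is_derive_eq.
- exact: is_derive_line.
- by rewrite dir_deriveE// Px Py mulrN.
- exact: is_derive_line.
- by rewrite dir_deriveE// Qx Qy.
Qed.

(** Harmonicity of [ln |f|^2]: the fractions are its second derivatives along [e_x] and [e_y]. By
    the Cauchy-Riemann equations [f = p + i q] has [y]-derivative [- q1 + i p1] and second
    [y]-derivative [- p2 - i q2]. *)
Lemma log_laplacian_identity (R : realType) (p q p1 q1 p2 q2 : R) :
  0 < p * p + q * q ->
  (2 * (p1 ^+ 2 + q1 ^+ 2 + (p * p2 + q * q2)) * (p * p + q * q) -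
     (2 * (p * p1 + q * q1)) ^+ 2) / (p * p + q * q) ^+ 2 +
  (2 * ((- q1) ^+ 2 + p1 ^+ 2 + (p * - p2 + q * - q2)) * (p * p + q * q) -
     (2 * (p * - q1 + q * p1)) ^+ 2) / (p * p + q * q) ^+ 2 = 0.
Proof. by move=> h; field; rewrite gt_eqF. Qed.

(* Away from its zeros a holomorphic function has [ln |f|^2] harmonic, so the Laplacian of
   [ln |f|^2 - m ln |g|^2 + |g|^2] is [4 |g'|^2 > 0]. *)
Lemma no_interior_max (R : realType) (U : set (R * R)) (P Q A B : nat -> R * R -> R)
    (m e : R) (z : R * R) :
  holomorphic_seq U P Q -> holomorphic_seq U A B -> 0 < e ->
  (forall w, `|w - z| < e -> [/\ U w, 0 < sqmod (P 0) (Q 0) w, 0 < sqmod (A 0) (B 0) w &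
    ln (sqmod (P 0) (Q 0) w) - m * ln (sqmod (A 0) (B 0) w) + sqmod (A 0) (B 0) w <=
    ln (sqmod (P 0) (Q 0) z) - m * ln (sqmod (A 0) (B 0) z) + sqmod (A 0) (B 0) z]) ->
  sqmod (A 1) (B 1) z <= 0.
Proof.
move=> hP hA e0 h.
have [Uz Nz Dz _] : [/\ U z, 0 < sqmod (P 0) (Q 0) z, 0 < sqmod (A 0) (B 0) z & True].
  by have [] := h z _; rewrite ?subrr ?normr0.
have z0v (v : R * R) : z + 0 *: v = z by rewrite scale0r addr0.
have line (v : R * R) (t : R) : `|v| = 1 -> `|t| < e -> `|z + t *: v - z| < e.
  by move=> v1; rewrite addrAC subrr add0r normrZ v1 mulr1.
have e00 : `|0 : R| < e by rewrite normr0.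
(* [F P Q] is the second derivative at [z] in the direction [v] of [ln |P 0 + i Q 0|^2]. *)
have test (v : R * R) : `|v| = 1 ->
  (let F (P Q : nat -> R * R -> R) := (2 * ((v.1 * P 1%N z - v.2 * Q 1%N z) ^+ 2
       + (v.1 * Q 1%N z + v.2 * P 1%N z) ^+ 2
       + (P 0%N z * (v.1 * (v.1 * P 2%N z - v.2 * Q 2%N z) - v.2 * (v.1 * Q 2%N z + v.2 * P 2%N z)) +
          Q 0%N z * (v.1 * (v.1 * Q 2%N z + v.2 * P 2%N z) + v.2 * (v.1 * P 2%N z - v.2 * Q 2%N z))))
       * sqmod (P 0%N) (Q 0%N) z -
     (2 * (P 0%N z * (v.1 * P 1%N z - v.2 * Q 1%N z) +
           Q 0%N z * (v.1 * Q 1%N z + v.2 * P 1%N z))) ^+ 2)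
    / sqmod (P 0%N) (Q 0%N) z ^+ 2 in
  F P Q - m * F A B + 2 * ((v.1 * A 1%N z - v.2 * B 1%N z) ^+ 2
       + (v.1 * B 1%N z + v.2 * A 1%N z) ^+ 2
       + (A 0%N z * (v.1 * (v.1 * A 2%N z - v.2 * B 2%N z) - v.2 * (v.1 * B 2%N z + v.2 * A 2%N z)) +
          B 0%N z * (v.1 * (v.1 * B 2%N z + v.2 * A 2%N z) + v.2 * (v.1 * A 2%N z - v.2 * B 2%N z))))
  <= 0).
  move=> v1.
  have UL t : `|t| < e -> U (z + t *: v) by move=> te; case: (h _ (line v t v1 te)).
  pose p (P Q : nat -> R * R -> R) (s : R) := P 0%N (z + s *: v).
  pose p1 (P Q : nat -> R * R -> R) (s : R) :=
    v.1 * P 1%N (z + s *: v) - v.2 * Q 1%N (z + s *: v).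
  pose q (P Q : nat -> R * R -> R) (s : R) := Q 0%N (z + s *: v).
  pose q1 (P Q : nat -> R * R -> R) (s : R) :=
    v.1 * Q 1%N (z + s *: v) + v.2 * P 1%N (z + s *: v).
  have d1 F G t : holomorphic_seq U F G -> `|t| < e ->
      is_derive t (1 : R) (p F G) (p1 F G t) /\ is_derive t (1 : R) (q F G) (q1 F G t).
    by move=> hF te; exact: line_derivatives hF (UL _ te).
  have d2 F G : holomorphic_seq U F G ->
      is_derive 0 (1 : R) (p1 F G)
        (v.1 * (v.1 * F 2%N z - v.2 * G 2%N z) - v.2 * (v.1 * G 2%N z + v.2 * F 2%N z)) /\
      is_derive 0 (1 : R) (q1 F G)
        (v.1 * (v.1 * G 2%N z + v.2 * F 2%N z) + v.2 * (v.1 * F 2%N z - v.2 * G 2%N z)).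
    move=> hF; have [dF dG] := @line_derivatives _ _ _ _ z v 0 1%N hF (UL _ e00).
    rewrite z0v in dF dG; split.
      exact: (is_deriveB (is_deriveZ v.1 dF) (is_deriveZ v.2 dG)).
    exact: (is_deriveD (is_deriveZ v.1 dG) (is_deriveZ v.2 dF)).
  have [dP0 dQ0] := d1 _ _ _ hP e00; have [dA0 dB0] := d1 _ _ _ hA e00.
  have [dP1 dQ1] := d2 _ _ hP; have [dA1 dB1] := d2 _ _ hA.
  have := @log_derivative_test _ _ _ _ _ _ _ m e e0 _ (is_derive_sumsq2 dP0 dQ0 dP1 dQ1)
     (is_derive_sumsq2 dA0 dB0 dA1 dB1).
  move=> /(_ (fun s => sqmod (P 0%N) (Q 0%N) (z + s *: v)) (fun s => sqmod (A 0%N) (B 0%N) (z + s *: v))).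
  rewrite /p /q /p1 /q1 !z0v; apply.
  - move=> t te; have [_ Nt Dt _] := h _ (line v t v1 te).
    have [dP dQ] := d1 _ _ _ hP te; have [dA dB] := d1 _ _ _ hA te.
    split=> //; [exact: is_derive_sumsq dP dQ|exact: is_derive_sumsq dA dB].
  - by move=> t te; have [_ _ _] := h _ (line v t v1 te).
have := test _ (norm_e_x R); have := test _ (norm_e_y R).
rewrite /sqmod /= !mul0r !mul1r !subr0 !addr0 !sub0r !add0r.
rewrite /sqmod in Nz Dz; clear -Nz Dz.
move: (P 0%N z) (P 1%N z) (P 2%N z) (Q 0%N z) (Q 1%N z) (Q 2%N z) Nz => p p1 p2 q q1 q2 Nz.
move: (A 0%N z) (A 1%N z) (A 2%N z) (B 0%N z) (B 1%N z) (B 2%N z) Dz => a a1 a2 b b1 b2 Dz.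
have Hp := log_laplacian_identity p1 q1 p2 q2 Nz.
have Ha := log_laplacian_identity a1 b1 a2 b2 Dz.
move: Hp Ha.
set ax := (2 * (a1 ^+ 2 + _ + _) * _ - _) / _; set ay := (2 * ((- b1) ^+ 2 + _ + _) * _ - _) / _.
set px := (2 * (p1 ^+ 2 + _ + _) * _ - _) / _; set py := (2 * ((- q1) ^+ 2 + _ + _) * _ - _) / _.
move=> Hp Ha.
have Ha' : m * ax + m * ay = 0 by rewrite -mulrDr Ha mulr0.
clearbody ax ay px py; move: (m * ax) (m * ay) Ha' => max may.
rewrite sqrrN !mulrN => Ha' Hy Hx.
have : a1 ^+ 2 + b1 ^+ 2 <= 0 by lra.
by rewrite !expr2.
Qed.

(** Induction on [n] for all orders [j] at once: by the mean value theorem from [z0], decay of order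
    [n] of the next derivative gives decay of order [n.+1]. *)
Lemma flat_decay (R : realType) (U : set (R * R)) (P Q : nat -> R * R -> R) (z0 : R * R) :
  open U -> holomorphic_seq U P Q -> U z0 -> (forall j, P j z0 = 0 /\ Q j z0 = 0) ->
  forall n j, exists2 e : R, 0 < e & exists2 C : R, 0 < C & forall z, `|z - z0| < e ->
    `|P j z| <= C * `|z - z0| ^+ n /\ `|Q j z| <= C * `|z - z0| ^+ n.
Proof.
move=> oU hol Uz0 flat; elim=> [|n IH] j.
  have [dP dQ _ _] := hol j _ Uz0; have [P0 Q0] := flat j.
  have [e1 e10 h1] := continuousE_norm (differentiable_continuous dP) ltr01.
  have [e2 e20 h2] := continuousE_norm (differentiable_continuous dQ) ltr01.
  exists (Num.min e1 e2); first by rewrite lt_min e10.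
  exists 1 => // z; rewrite lt_min expr0 mulr1 => /andP[/h1 + /h2].
  by rewrite P0 Q0 !subr0 => /ltW ? /ltW ?.
have [e e0 [C C0 h]] := IH j.+1.
have [d d0 hd] := open_contains_ball oU Uz0.
exists (Num.min d e); first by rewrite lt_min d0.
exists (C + C) => [|z zde]; first by rewrite addr_gt0.
have := zde; rewrite lt_min => /andP[zd ze].
have z00 : `|z0 - z0| < Num.min d e by rewrite subrr normr0 lt_min d0.
have dP y : `|y - z0| < Num.min d e -> differentiable (P j) y.
  by rewrite lt_min => /andP[/hd /(hol j) []].
have dQ y : `|y - z0| < Num.min d e -> differentiable (Q j) y.
  by rewrite lt_min => /andP[/hd /(hol j) []].
have pw y : `|y - z0| <= `|z - z0| -> C * `|y - z0| ^+ n <= C * `|z - z0| ^+ n.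
  by move=> yz; rewrite ler_pM2l// lerXn2r ?nnegrE.
have [P0 Q0] := flat j.
have := normr_ge0 (z - z0) => N0.
split.
- have [y [yde yz]] := mvt_plane dP z00 zde; rewrite P0 subr0 => ->.
  have [yd ye] : `|y - z0| < d /\ `|y - z0| < e by move: yde; rewrite lt_min => /andP[].
  have [_ _ [Px Py] _] := hol j _ (hd _ yd); have [hP hQ] := h _ ye.
  rewrite dir_deriveE; last exact: dP.
  rewrite Px Py exprSr mulrA (mulrDl C C).
  apply: lincomb_bound; rewrite ?norm_fst_le ?norm_snd_le// ?normrN.
    exact: (le_trans hP (pw _ yz)).
  exact: (le_trans hQ (pw _ yz)).
- have [y [yde yz]] := mvt_plane dQ z00 zde; rewrite Q0 subr0 => ->.
  have [yd ye] : `|y - z0| < d /\ `|y - z0| < e by move: yde; rewrite lt_min => /andP[].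
  have [_ _ _ [Qx Qy]] := hol j _ (hd _ yd); have [hP hQ] := h _ ye.
  rewrite dir_deriveE; last exact: dQ.
  rewrite Qx Qy exprSr mulrA (mulrDl C C).
  apply: lincomb_bound; rewrite ?norm_fst_le ?norm_snd_le//.
    exact: (le_trans hQ (pw _ yz)).
  exact: (le_trans hP (pw _ yz)).
Qed.

(** With [coord_im], the function [z - z0] and its derivatives [1, 0, 0, ...], the comparison
    function of Schwarz's lemma. *)
Definition coord_re (R : realType) (z0 : R * R) (j : nat) (z : R * R) : R :=
  match j with 0 => (z - z0).1 | 1 => 1 | _ => 0 end.

Definition coord_im (R : realType) (z0 : R * R) (j : nat) (z : R * R) : R :=
  match j with 0 => (z - z0).2 | _ => 0 end.

Lemma differentiable_fst (R : realType) (z : R * R) : differentiable (fst : R * R -> R) z.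
Proof.
by apply: (@linear_differentiable _ _ _ (fst : {linear (R * R)%type -> R^o})) => ?; exact: cvg_fst.
Qed.

Lemma differentiable_snd (R : realType) (z : R * R) : differentiable (snd : R * R -> R) z.
Proof.
by apply: (@linear_differentiable _ _ _ (snd : {linear (R * R)%type -> R^o})) => ?; exact: cvg_snd.
Qed.

Lemma derive_fst (R : realType) (z v : R * R) : 'D_v (fst : R * R -> R) z = v.1.
Proof.
rewrite deriveE; last exact: differentiable_fst.
by rewrite (@diff_lin _ _ _ (fst : {linear (R * R)%type -> R^o}))// => ?; exact: cvg_fst.
Qed.

Lemma derive_snd (R : realType) (z v : R * R) : 'D_v (snd : R * R -> R) z = v.2.
Proof.
rewrite deriveE; last exact: differentiable_snd.
by rewrite (@diff_lin _ _ _ (snd : {linear (R * R)%type -> R^o}))// => ?; exact: cvg_snd.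
Qed.

Lemma holomorphic_coord (R : realType) (U : set (R * R)) (z0 : R * R) :
  holomorphic_seq U (coord_re z0) (coord_im z0).
Proof.
have d0 (a : R) z : differentiable (cst a : R * R -> R) z by exact: differentiable_cst.
have D0 (a : R) z v : 'D_v (cst a : R * R -> R) z = 0 by exact: derive_cst.
have Ere : coord_re z0 0 = (fst : R * R -> R) - cst z0.1 by apply/funext.
have Eim : coord_im z0 0 = (snd : R * R -> R) - cst z0.2 by apply/funext.
have dfst z := differentiable_fst z; have dsnd z := differentiable_snd z.
move=> [|[|j]] z _.
- rewrite Ere Eim !deriveB; try exact: diff_derivable.
  rewrite !D0 !derive_fst !derive_snd; split.
  + exact: differentiableB.
  + exact: differentiableB.
  + by rewrite !subr0 /= oppr0.
  + by rewrite !subr0.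
- have -> : coord_re z0 1 = cst 1 by [].
  have -> : coord_im z0 1 = cst 0 by [].
  by rewrite !D0 /= oppr0.
- have -> : coord_re z0 j.+2 = cst 0 by [].
  have -> : coord_im z0 j.+2 = cst 0 by [].
  by rewrite !D0 /= oppr0.
Qed.

Definition square (R : realType) (z0 : R * R) (r : R) : set (R * R) := [set z | `|z - z0| <= r].

Lemma squareE (R : realType) (z0 : R * R) (r : R) :
  square z0 r = `[z0.1 - r, z0.1 + r]%classic `*` `[z0.2 - r, z0.2 + r]%classic.
Proof.
apply/seteqP; split=> -[a b];
  rewrite /square /= norm_prod_le !in_itv /= -!ler_distlC (distrC z0.1) (distrC z0.2).
  by move=> /andP.
by move=> /andP.
Qed.

Lemma compact_square (R : realType) (z0 : R * R) (r : R) : compact (square z0 r).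
Proof. by rewrite squareE; apply: compact_setX; exact: segment_compact. Qed.

Lemma square_max (R : realType) (z0 : R * R) (r : R) (f : R * R -> R) :
  0 <= r -> (forall z, `|z - z0| <= r -> {for z, continuous f}) ->
  exists2 c, `|c - z0| <= r & forall z, `|z - z0| <= r -> f z <= f c.
Proof.
move=> r0 cf; have [] := @compact_EVT_max _ _ f (square z0 r).
- by exists z0; rewrite /square /= subrr normr0.
- exact: compact_square.
- by apply: continuous_in_subspaceT => z; rewrite inE => /cf.
move=> c; rewrite inE => cr h; exists c => // z zr; apply: h; rewrite inE; exact: zr.
Qed.

Lemma sqmod_ge0 (R : realType) (f g : R * R -> R) z : 0 <= sqmod f g z.
Proof. by rewrite addr_ge0// -expr2 sqr_ge0. Qed.

Lemma sqmod_eq0 (R : realType) (f g : R * R -> R) z :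
  sqmod f g z <= 0 -> f z = 0 /\ g z = 0.
Proof.
rewrite /sqmod -!expr2 => h; have := sqr_ge0 (f z); have := sqr_ge0 (g z) => h1 h2.
by split; apply/eqP; rewrite -sqrf_eq0 eq_le; apply/andP; split=> //; lra.
Qed.

Lemma sqmod_coord_bounds (R : realType) (z0 z : R * R) :
  `|z - z0| ^+ 2 <= sqmod (coord_re z0 0) (coord_im z0 0) z <= 2 * `|z - z0| ^+ 2.
Proof.
have -> : sqmod (coord_re z0 0) (coord_im z0 0) z = `|(z - z0).1| ^+ 2 + `|(z - z0).2| ^+ 2.
  by rewrite /sqmod /= -!expr2 !real_normK ?num_real.
have a1 := norm_fst_le (z - z0); have a2 := norm_snd_le (z - z0).
have : `|z - z0| = Num.max `|(z - z0).1| `|(z - z0).2| by rewrite prod_normE.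
move: `|z - z0| `|(z - z0).1| `|(z - z0).2| a1 a2 (normr_ge0 (z - z0).1) (normr_ge0 (z - z0).2).
move=> N x y xN yN x0 y0 NE; apply/andP; split.
  by rewrite NE /Num.max; case: ifP => _; rewrite ?lerDl ?lerDr exprn_ge0.
by rewrite mulr2n mulrDl mul1r; apply: lerD; rewrite lerXn2r ?nnegrE// (le_trans x0).
Qed.

Lemma continuous_sqmod (R : realType) (f g : R * R -> R) z :
  {for z, continuous f} -> {for z, continuous g} -> {for z, continuous (sqmod f g)}.
Proof. by move=> cf cg; apply: continuousD; apply: continuousM. Qed.

Lemma holomorphic_continuous (R : realType) (U : set (R * R)) (P Q : nat -> R * R -> R) j z :
  holomorphic_seq U P Q -> U z -> {for z, continuous (P j)} /\ {for z, continuous (Q j)}.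
Proof.
by move=> hol Uz; have [dP dQ _ _] := hol j z Uz; split; exact: differentiable_continuous.
Qed.

(* Schwarz's lemma for [f / (z - z0)^n], the weight [exp |z - z0|^2] making the maximum
   principle strict. *)
Lemma schwarz_bound (R : realType) (U : set (R * R)) (P Q : nat -> R * R -> R)
    (z0 : R * R) (r M : R) (n : nat) :
  open U -> holomorphic_seq U P Q -> 0 < r -> (forall z, `|z - z0| <= r -> U z) ->
  (forall j, P j z0 = 0 /\ Q j z0 = 0) ->
  (forall z, `|z - z0| <= r -> sqmod (P 0) (Q 0) z <= M) ->
  forall z, `|z - z0| <= r / 2 ->
    sqmod (P 0) (Q 0) z <= M * expR (2 * r ^+ 2) / 2 ^+ n.
Proof.
move=> oU hol r0 rU flat NM z zr.
set N := sqmod (P 0) (Q 0) in NM *.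
pose D := sqmod (coord_re z0 0) (coord_im z0 0).
have DN w : `|w - z0| ^+ 2 <= D w <= 2 * `|w - z0| ^+ 2 := sqmod_coord_bounds z0 w.
have Dpos w : w != z0 -> 0 < D w.
  move=> wz; have /andP[+ _] := DN w; apply: lt_le_trans.
  by rewrite exprn_gt0// normr_gt0 subr_eq0.
have D0 : D z0 = 0.
  by apply/eqP; rewrite eq_le sqmod_ge0 andbT; have /andP[_] := DN z0; rewrite subrr normr0 expr0n mulr0.
have N0 : N z0 = 0 by have [P0 Q0] := flat 0%N; rewrite /N /sqmod P0 Q0 mul0r addr0.
have cD w : {for w, continuous D}.
  by have [c1 c2] := @holomorphic_continuous _ setT _ _ 0 w (@holomorphic_coord _ setT z0) I;
    exact: continuous_sqmod.
have cN w : U w -> {for w, continuous N}.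
  by move=> Uw; have [c1 c2] := holomorphic_continuous 0 hol Uw; exact: continuous_sqmod.
pose F w := N w / D w ^+ n.
pose Phi w := F w * expR (D w).
have Uz0 : U z0 by apply: rU; rewrite subrr normr0 ltW.
(* [F z0 = 0] because [N z0 = 0]; decay of [P 0] and [Q 0] to order [n.+1] beats [D ^+ n], which is
   of order [2 n], after squaring. *)
have cF0 : {for z0, continuous F}.
  have [e e0 [C C0 hC]] := flat_decay oU hol Uz0 flat n.+1 0.
  apply: continuousP_norm => eps eps0.
  have C2 : 0 < 2 * C ^+ 2 by rewrite mulr_gt0// exprn_gt0.
  exists (Num.min e (Num.min 1 (eps / (2 * C ^+ 2)))).
    by rewrite !lt_min e0 ltr01 divr_gt0.
  move=> w; rewrite !lt_min => /and3P[we w1 weps].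
  rewrite /F N0 mul0r subr0.
  have [->|wz] := eqVneq w z0; first by rewrite N0 mul0r normr0.
  rewrite ger0_norm; last by rewrite divr_ge0 ?sqmod_ge0// exprn_ge0// sqmod_ge0.
  rewrite ltr_pdivrMr ?exprn_gt0 ?Dpos//.
  have /andP[D1 _] := DN w.
  have x0 : 0 < `|w - z0| by rewrite normr_gt0 subr_eq0.
  have [hP hQ] := hC w we.
  have Nw : N w <= 2 * C ^+ 2 * `|w - z0| ^+ 2 * (`|w - z0| ^+ 2) ^+ n.
    have -> : 2 * C ^+ 2 * `|w - z0| ^+ 2 * (`|w - z0| ^+ 2) ^+ n =
        (C * `|w - z0| ^+ n.+1) ^+ 2 + (C * `|w - z0| ^+ n.+1) ^+ 2.
      have -> : (`|w - z0| ^+ 2) ^+ n = (`|w - z0| ^+ n) ^+ 2 by rewrite -!exprM mulnC.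
      by rewrite (exprS _ n); ring.
    rewrite /N /sqmod -!expr2 -(real_normK (num_real (P 0%N w))) -(real_normK (num_real (Q 0%N w))).
    have p0 : 0 <= C * `|w - z0| ^+ n.+1 by rewrite mulr_ge0 ?exprn_ge0// ltW.
    by apply: lerD; rewrite lerXn2r ?nnegrE.
  apply: (le_lt_trans Nw); apply: (@lt_le_trans _ _ (eps * (`|w - z0| ^+ 2) ^+ n)).
    rewrite ltr_pM2r ?exprn_gt0// mulrC -ltr_pdivlMr//.
    by apply: le_lt_trans weps; rewrite expr2 ler_piMl// ltW.
  by rewrite ler_pM2l// lerXn2r ?nnegrE ?exprn_ge0 ?sqmod_ge0.
have cPhi w : `|w - z0| <= r -> {for w, continuous Phi}.
  move=> wr; apply: continuousM; last first.
    by apply: continuous_comp; [exact: cD|exact: continuous_expR].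
  have [->|wz] := eqVneq w z0; first exact: cF0.
  apply: continuousM; first exact/cN/rU.
  have Dn0 : D w ^+ n != 0 by rewrite expf_neq0// gt_eqF// Dpos.
  have cDn : {for w, continuous (fun x => D x ^+ n)}.
    by apply: (@continuous_comp _ _ _ D (fun x : R => x ^+ n)); [exact: cD|exact: exprn_continuous].
  exact: (@continuousV R _ (fun x => D x ^+ n) w Dn0 cDn).
have [c cr cmax] := square_max (ltW r0) cPhi.
have zr' : `|z - z0| <= r by apply: (le_trans zr); clear -r0; lra.
have M0 : 0 <= M by rewrite -N0; apply: NM; rewrite subrr normr0 ltW.
have [Nz|Nz] := ltP 0 (N z); last first.
  by rewrite (le_trans Nz)// !mulr_ge0 ?expR_ge0// invr_ge0 exprn_ge0.
have pos w : 0 < Phi w -> 0 < N w /\ w != z0.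
  rewrite /Phi pmulr_lgt0 ?expR_gt0// /F => h; split.
    rewrite lt_neqAle sqmod_ge0 andbT eq_sym; apply: contraTneq h => ->.
    by rewrite mul0r ltxx.
  by apply: contraTneq h => ->; rewrite N0 mul0r ltxx.
have posr w : 0 < N w -> w != z0 -> 0 < Phi w.
  by move=> Nw wz; rewrite mulr_gt0 ?expR_gt0// divr_gt0// exprn_gt0// Dpos.
have zz0 : z != z0 by apply: contraTneq Nz => ->; rewrite N0 ltxx.
have Pz := posr _ Nz zz0.
have [Nc cz0] := pos c (lt_le_trans Pz (cmax _ zr')).
have lnPhi w : 0 < N w -> w != z0 -> ln (Phi w) = ln (N w) - n%:R * ln (D w) + D w.
  move=> Nw wz; rewrite /Phi /F lnM ?posrE ?expR_gt0 ?divr_gt0 ?exprn_gt0 ?Dpos// expRK.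
  by rewrite lnM ?posrE ?invr_gt0 ?exprn_gt0 ?Dpos// lnV ?posrE ?exprn_gt0 ?Dpos// lnXn ?Dpos// mulr_natl.
(* The maximum sits on the boundary: otherwise a ball around [c] avoids [z0] and keeps [N] positive,
   and there [ln Phi] contradicts [no_interior_max], as [z - z0] has derivative 1. *)
have crE : `|c - z0| = r.
  apply/eqP; rewrite eq_le cr /= leNgt; apply/negP => clt.
  have [e1 e10 h1] := continuousE_norm (cN c (rU _ cr)) Nc.
  have e2 : 0 < r - `|c - z0| by rewrite subr_gt0.
  have e3 : 0 < `|c - z0| by rewrite normr_gt0 subr_eq0.
  have := @no_interior_max _ U P Q (coord_re z0) (coord_im z0) n%:R
    (Num.min e1 (Num.min (r - `|c - z0|) `|c - z0|)) c hol (@holomorphic_coord _ U z0).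
  rewrite !lt_min e10 e2 e3 => /(_ isT).
  rewrite /sqmod /= mulr1 mulr0 addr0 ler10 => H; apply/notF/H => w.
  rewrite !lt_min => /and3P[/h1 w1 w2 w3].
  have wr : `|w - z0| <= r.
    rewrite -(subrK c w) -addrA (le_trans (ler_normD _ _))//; move: w2; rewrite ltrBrDr; exact: ltW.
  have wz : w != z0.
    by apply: contraTneq w3 => ->; rewrite distrC ltxx.
  have Nw : 0 < N w.
    by move: w1; rewrite distrC ltr_distlC => /andP[+ _]; rewrite subrr.
  split=> //; [exact: rU|exact: Dpos|].
  rewrite -!/(sqmod _ _ _) -/N -/D -!lnPhi//.
  by rewrite ler_ln ?posrE ?posr//; exact: cmax.
have /andP[Dc1 Dc2] := DN c; rewrite crE in Dc1 Dc2.
have Phic : Phi c <= M / (r ^+ 2) ^+ n * expR (2 * r ^+ 2).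
  apply: ler_pM; rewrite ?expR_ge0 ?ler_expR//.
    by rewrite divr_ge0 ?sqmod_ge0// exprn_ge0// sqmod_ge0.
  apply: ler_pM; rewrite ?sqmod_ge0 ?invr_ge0 ?exprn_ge0 ?sqmod_ge0//; first exact: NM.
  rewrite lef_pV2 ?posrE ?exprn_gt0 ?Dpos//.
  by rewrite lerXn2r ?nnegrE ?exprn_ge0 ?sqmod_ge0// ltW.
(* The source of the gain [2 ^+ n]: [D] is at least [r ^+ 2] at the boundary point [c], but at most
   half of that on the square of half size. *)
have Dz : D z <= r ^+ 2 / 2.
  have /andP[_ Dz2] := DN z; apply: (le_trans Dz2).
  have -> : r ^+ 2 / 2 = 2 * (r / 2) ^+ 2 by field.
  by rewrite ler_pM2l// lerXn2r ?nnegrE// divr_ge0// ltW.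
have Phiz : N z / (r ^+ 2 / 2) ^+ n <= Phi z.
  rewrite /Phi /F -[leLHS]mulr1; apply: ler_pM => //.
  - by rewrite divr_ge0 ?sqmod_ge0// exprn_ge0// divr_ge0// exprn_ge0// ltW.
  - rewrite ler_pM2l// lef_pV2 ?posrE ?exprn_gt0 ?Dpos ?divr_gt0 ?exprn_gt0//.
    by rewrite lerXn2r ?nnegrE ?sqmod_ge0// divr_ge0// exprn_ge0// ltW.
  - by rewrite (le_trans _ (expR_ge1Dx _))// lerDl sqmod_ge0.
have := le_trans Phiz (le_trans (cmax _ zr') Phic).
have X0 : 0 < (r ^+ 2) ^+ n by rewrite !exprn_gt0.
have Y0 : 0 < (2 : R) ^+ n by rewrite exprn_gt0.
rewrite expr_div_n ler_pdivrMr ?divr_gt0// => H; apply: (le_trans H).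
rewrite le_eqVlt; apply/orP; left; apply/eqP.
move: (expR _) ((r ^+ 2) ^+ n) (2 ^+ n) X0 Y0; clear => E X Y X0 Y0.
by field; rewrite !gt_eqF.
Qed.

(** Flatness allows every exponent [n] in [schwarz_bound], whose right-hand side tends to 0. *)
Lemma flat_vanish (R : realType) (U : set (R * R)) (P Q : nat -> R * R -> R) (z0 : R * R) :
  open U -> holomorphic_seq U P Q -> U z0 -> (forall j, P j z0 = 0 /\ Q j z0 = 0) ->
  \forall z \near z0, P 0 z = 0 /\ Q 0 z = 0.
Proof.
move=> oU hol Uz0 flat.
have [d d0 hd] := open_contains_ball oU Uz0.
pose r := d / 2; have r0 : 0 < r by rewrite divr_gt0.
have rU z : `|z - z0| <= r -> U z.
  by move=> zr; apply: hd; apply: (le_lt_trans zr); rewrite /r; lra.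
have cN z : `|z - z0| <= r -> {for z, continuous (sqmod (P 0%N) (Q 0%N))}.
  by move=> /rU Uz; have [c1 c2] := holomorphic_continuous 0 hol Uz; exact: continuous_sqmod.
have [c cr NM] := square_max (ltW r0) cN.
apply/nearE_norm; exists (r / 2) => [|z zr]; first by rewrite divr_gt0.
apply: sqmod_eq0; rewrite leNgt; apply/negP => Nz.
pose K := sqmod (P 0%N) (Q 0%N) c * expR (2 * r ^+ 2).
have H n : sqmod (P 0%N) (Q 0%N) z <= K / 2 ^+ n by exact: schwarz_bound oU hol r0 rU flat NM z (ltW zr).
(* Then [2 ^+ n.+1 > n.+1%:R > K / sqmod (P 0) (Q 0) z]. *)
pose n := Num.truncn (K / sqmod (P 0%N) (Q 0%N) z).
have := H n.+1; rewrite leNgt ltr_pdivrMr ?exprn_gt0//.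
rewrite mulrC -ltr_pdivrMr// (lt_trans (truncnS_gt _))//.
by rewrite -natrX ltr_nat ltn_expl.
Qed.

(** * Level pairs of holomorphic functions *)

Lemma holomorphic_C1 (R : realType) (U : set (R * R)) (P Q : nat -> R * R -> R) j z :
  open U -> holomorphic_seq U P Q -> U z -> C1_at (P j) z /\ C1_at (Q j) z.
Proof.
move=> oU hol Uz.
have [c1 c2] := holomorphic_continuous j.+1 hol Uz.
have nearU : \forall w \near z, U w by exact: open_nbhs_nbhs.
split; split.
- by apply: filterS nearU => w /(hol j) [].
- by apply: continuous_eq_on oU _ Uz c1 => w /(hol j) [_ _ []].
- by apply: continuous_eq_on oU _ Uz (continuousN c2) => w /(hol j) [_ _ []].
- by apply: filterS nearU => w /(hol j) [].
- by apply: continuous_eq_on oU _ Uz c2 => w /(hol j) [_ _ _ []].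
- by apply: continuous_eq_on oU _ Uz c1 => w /(hol j) [_ _ _ []].
Qed.

(** By the Cauchy-Riemann equations the Jacobian determinant of the [j]-th derivative is the squared
    modulus of the next one. *)
Lemma holomorphic_injective (R : realType) (U : set (R * R)) (P Q : nat -> R * R -> R) j z0 :
  open U -> holomorphic_seq U P Q -> U z0 -> 0 < sqmod (P j.+1) (Q j.+1) z0 ->
  exists2 d : R, 0 < d & exists2 K : R, 0 < K &
  forall z w, `|z - z0| < d -> `|w - z0| < d ->
    `|w - z| <= K * (`|P j w - P j z| + `|Q j w - Q j z|).
Proof.
move=> oU hol Uz0 nz; have [CP CQ] := holomorphic_C1 j oU hol Uz0.
apply: inverse_lipschitz => //.
have [_ _ [-> ->] [-> ->]] := hol j _ Uz0.
by rewrite mulNr opprK gt_eqF.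
Qed.

(** On a circle [(y - y') (y + y') = - (x - x') (x + x')], so [y] is a Lipschitz function of [x]
    where [y + y'] is bounded away from 0. *)
Lemma circle_arc (R : realType) (rho b x y x' y' : R) :
  0 < b -> x ^+ 2 + y ^+ 2 = rho -> x' ^+ 2 + y' ^+ 2 = rho -> b <= `|y + y'| ->
  `|y - y'| <= (2 * (rho + 1) / b) * `|x - x'|.
Proof.
move=> b0 e e' by'.
have E : (y - y') * (y + y') = - ((x - x') * (x + x')).
  by rewrite -!subr_sqr; lra.
have x1 (a c : R) : a ^+ 2 + c ^+ 2 = rho -> `|a| <= rho + 1.
  move=> <-; rewrite -(real_normK (num_real a)); have := sqr_ge0 c.
  by move: (c ^+ 2) `|a| (normr_ge0 a) => C A A0 C0; nra.
have xx : `|x + x'| <= 2 * (rho + 1) by have := ler_normD x x'; have := x1 _ _ e; have := x1 _ _ e'; lra.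
rewrite mulrAC ler_pdivlMr//; apply: (@le_trans _ _ (`|y - y'| * `|y + y'|)).
  by rewrite ler_wpM2l.
by rewrite -normrM E normrN normrM mulrC ler_wpM2r.
Qed.

(** Near a point with [g v0] nonzero the circle is a graph over the [f]-axis; composing with the
    Lipschitz local inverses of [(f, g)] makes [u] and [v] Lipschitz functions of the number
    [f v]. *)
Lemma circle_curve_negligible (R : realType) (f g : R * R -> R) (D : set ((R * R) * (R * R)))
    (u0 v0 : R * R) (s rho d K : R) :
  0 < d -> 0 < K ->
  (forall z w, `|z - u0| < d -> `|w - u0| < d -> `|w - z| <= K * (`|f w - f z| + `|g w - g z|)) ->
  (forall z w, `|z - v0| < d -> `|w - v0| < d -> `|w - z| <= K * (`|f w - f z| + `|g w - g z|)) ->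
  {for v0, continuous f} -> {for v0, continuous g} -> g v0 != 0 ->
  (forall q, D q -> [/\ f q.1 = f q.2, g q.1 = g q.2 & f q.2 ^+ 2 + g q.2 ^+ 2 = rho]) ->
  exists2 e : R, 0 < e & area2.-negligible
    ((fun q : (R * R) * (R * R) => s *: (q.2 - q.1)) @` [set q | D q /\ `|q - (u0, v0)| < e]).
Proof.
move=> d0 K0 hu hv cf cg gv0 hD.
have b0 : 0 < `|g v0| by rewrite normr_gt0.
(* Within this tolerance [|g v + g v'|] is at least [|g v0|]. *)
have b20 : 0 < `|g v0| / 2 by rewrite divr_gt0.
have [e1 e10 h1] := continuousE_norm cf ltr01.
have [e2 e20 h2] := continuousE_norm cg b20.
exists (Num.min d (Num.min e1 e2)); first by rewrite !lt_min d0 e10.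
have rho0 q : D q -> 0 <= rho by move=> /hD[_ _ <-]; rewrite addr_ge0// sqr_ge0.
(* If [D] is empty the sign of [rho + 1] is unknown, hence [|L|] in the constants. *)
pose L := 2 * (rho + 1) / `|g v0|.
apply: (@curve_negligible _ _ _ _ (fun q => f q.2) (f v0) (`|s| * (2 * (K * (1 + `|L|))))).
- by rewrite mulr_ge0// mulr_ge0// mulr_ge0 ?addr_ge0// ltW.
- move=> [u v] [_]; rewrite prod_normE gt_max /= !lt_min => /andP[_ /and3P[_ /h1 + _]].
  exact: ltW.
have near2 (u v : R * R) e : `|(u, v) - (u0, v0)| < e -> `|u - u0| < e /\ `|v - v0| < e.
  by rewrite prod_normE gt_max => /andP.
move=> [u v] [u' v'] [Dq /near2[]]; rewrite !lt_min => /and3P[ud _ _] /and3P[vd _ ve].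
move=> [Dq' /near2[]]; rewrite !lt_min => /and3P[ud' _ _] /and3P[vd' _ ve'].
have [/= fuv guv fg] := hD _ Dq; have [/= fuv' guv' fg'] := hD _ Dq'.
have arc : `|g v' - g v| <= `|L| * `|f v' - f v|.
  apply: (@le_trans _ _ (L * `|f v' - f v|)); last by rewrite ler_wpM2r// ler_norm.
  apply: circle_arc fg' fg _ => //.
  have := h2 _ ve; have := h2 _ ve'.
  have := ler_distD (g v' + g v) (2 * g v0) 0.
  rewrite !subr0 normrM ger0_norm//.
  have := ler_normD (g v0 - g v') (g v0 - g v).
  rewrite (distrC (g v0) (g v')) (distrC (g v0) (g v)).
  have -> : g v0 - g v' + (g v0 - g v) = 2 * g v0 - (g v' + g v) by ring.
  move: `|g v0| `|g v' + g v| `|2 * g v0 - _| `|g v' - _| `|g v - _|; clear; move=> *; lra.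
have bound x : `|x| <= K * (`|f v' - f v| + `|g v' - g v|) ->
    `|x| <= K * (1 + `|L|) * `|f v' - f v|.
  by move=> h; apply: (le_trans h); rewrite -mulrA ler_pM2l// mulrDl mul1r lerD2l.
rewrite -scalerBr normrZ -!mulrA ler_wpM2l//.
have -> : v' - u' - (v - u) = (v' - v) - (u' - u) by rewrite !opprB (addrC u (- v)) addrACA (addrC (- u')).
rewrite (le_trans (ler_normB _ _))//.
have -> : 2 * (K * ((1 + `|L|) * `|f v' - f v|)) =
  K * (1 + `|L|) * `|f v' - f v| + K * (1 + `|L|) * `|f v' - f v| by ring.
apply: lerD.
  have := hv _ _ vd vd'; rewrite -mulrA => h; apply: (le_trans h).
  by rewrite ler_pM2l// mulrDl mul1r lerD2l.
have := hu _ _ ud ud'; rewrite fuv guv fuv' guv' -mulrA => h; apply: (le_trans h).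
by rewrite ler_pM2l// mulrDl mul1r lerD2l.
Qed.

(* Stratify by the order of vanishing of the derivative at [u = q.1] and [v = q.2]: the pairs where
   one of them is a critical point are isolated, and elsewhere [v - u] is a Lipschitz function of
   the point [P 0 v + i Q 0 v] of the circle. *)
Lemma conformal_negligible (R : realType) (U : set (R * R)) (P Q : nat -> R * R -> R)
    (rho s : R) :
  open U -> holomorphic_seq U P Q -> 0 < rho ->
  (forall z, U z -> exists j, 0 < sqmod (P j.+1) (Q j.+1) z) ->
  area2.-negligible ((fun q : (R * R) * (R * R) => s *: (q.2 - q.1)) @`
    [set q | [/\ U q.1, U q.2, P 0 q.1 = P 0 q.2, Q 0 q.1 = Q 0 q.2 &
       P 0 q.2 ^+ 2 + Q 0 q.2 ^+ 2 = rho]]).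
Proof.
move=> oU hol rho0 nonflat; set D := [set q | _].
(* The derivatives of orders [1] to [a] vanish at [z] and the next one does not; [a = 0] means that
   [z] is not critical. *)
pose S a (z : R * R) := 0 < sqmod (P a.+1) (Q a.+1) z /\
  (forall i, (i < a)%N -> P i.+1 z = 0 /\ Q i.+1 z = 0).
have exS z : U z -> exists a, S a z.
  move=> Uz; have [j0 hj0] := nonflat z Uz.
  have ex : exists j, 0 < sqmod (P j.+1) (Q j.+1) z by exists j0.
  exists (ex_minn ex); case: ex_minnP => a ha amin; split=> // i ia.
  apply: sqmod_eq0; rewrite leNgt; apply/negP => /amin; by rewrite leqNgt ia.
pose T a b := [set q | [/\ D q, S a q.1 & S b q.2]].
suff H a b : area2.-negligible ((fun q : (R * R) * (R * R) => s *: (q.2 - q.1)) @` T a b).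
  have : area2.-negligible (\bigcup_a \bigcup_b
      ((fun q : (R * R) * (R * R) => s *: (q.2 - q.1)) @` T a b)).
    by apply: negligible_bigcup => a; apply: negligible_bigcup => b; exact: H.
  apply: negligibleS => _ [q Dq <-]; have [Uq1 Uq2 _ _ _] := Dq.
  have [a Sa] := exS _ Uq1; have [b Sb] := exS _ Uq2.
  by exists a => //; exists b => //; exists q.
apply: local_negligible => -[u0 v0] [[/= Uu0 Uv0 PE QE E0] [Su0 Zu0] [Sv0 Zv0]].
have [d1 d10 [K1 K10 h1]] := holomorphic_injective oU hol Uu0 Su0.
have [d2 d20 [K2 K20 h2]] := holomorphic_injective oU hol Uv0 Sv0.
have [cP cQ] := holomorphic_continuous 0 hol Uv0.
have near2 (u v : R * R) e : `|(u, v) - (u0, v0)| < e -> `|u - u0| < e /\ `|v - v0| < e.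
  by rewrite prod_normE gt_max => /andP.
have zero_u (u : R * R) : `|u - u0| < d1 -> P a u = P a u0 -> Q a u = Q a u0 -> u = u0.
  move=> ud Pu Qu; have u00 : `|u0 - u0| < d1 by rewrite subrr normr0.
  have := h1 _ _ u00 ud; rewrite Pu Qu !subrr !normr0 addr0 mulr0.
  by rewrite normr_le0 subr_eq0 => /eqP.
have zero_v (v : R * R) : `|v - v0| < d2 -> P b v = P b v0 -> Q b v = Q b v0 -> v = v0.
  move=> vd Pv Qv; have v00 : `|v0 - v0| < d2 by rewrite subrr normr0.
  have := h2 _ _ v00 vd; rewrite Pv Qv !subrr !normr0 addr0 mulr0.
  by rewrite normr_le0 subr_eq0 => /eqP.
have isolated : (forall u v, T a b (u, v) -> `|u - u0| < d1 -> `|v - v0| < d2 -> u = u0 /\ v = v0) ->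
    exists2 d : R, 0 < d & area2.-negligible ((fun q : (R * R) * (R * R) => s *: (q.2 - q.1)) @`
      [set q | T a b q /\ `|q - (u0, v0)| < d]).
  move=> h; exists (Num.min d1 d2); first by rewrite lt_min d10.
  apply: negligibleS (negligible_point (s *: (v0 - u0))) => y [[u v] [Tuv uv] <-].
  have [] := near2 _ _ _ uv; rewrite !lt_min => /andP[ud _] /andP[_ vd].
  by have [-> ->] := h u v Tuv ud vd.
have level c z : (0 < c)%N -> (forall i, (i < c)%N -> P i.+1 z = 0 /\ Q i.+1 z = 0) ->
    P c z = 0 /\ Q c z = 0 by case: c => // c _; apply.
(* For positive [a] the derivative of order [a] vanishes at [u] and [u0] and is injective near [u0],
   so [u = u0]. Then [v] is determined by its value or, if [b] is positive, by the same argument. *)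
have [a0|a0] := posnP a; last first.
  apply: isolated => u v [[/= Uu Uv Puv Quv _] [_ Zu] [_ Zv]] ud vd.
  have [p1 q1] := level _ _ a0 Zu; have [p2 q2] := level _ _ a0 Zu0.
  have uE : u = u0 by apply: zero_u; rewrite // ?p1 ?p2 ?q1 ?q2.
  split=> //; have [b0|b0] := posnP b.
    by apply: zero_v; rewrite // b0 -?Puv -?Quv uE.
  have [p3 q3] := level _ _ b0 Zv; have [p4 q4] := level _ _ b0 Zv0.
  by apply: zero_v; rewrite // ?p3 ?p4 ?q3 ?q4.
have [b0|b0] := posnP b; last first.
  apply: isolated => u v [[/= Uu Uv Puv Quv _] [_ Zu] [_ Zv]] ud vd.
  have [p3 q3] := level _ _ b0 Zv; have [p4 q4] := level _ _ b0 Zv0.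
  have vE : v = v0 by apply: zero_v; rewrite // ?p3 ?p4 ?q3 ?q4.
  by split=> //; apply: zero_u; rewrite // a0 ?Puv ?Quv vE.
rewrite a0 in h1; rewrite b0 in h2.
pose d := Num.min d1 d2; pose K := Num.max K1 K2.
have d0 : 0 < d by rewrite lt_min d10.
have K0 : 0 < K by rewrite lt_max K10.
have hu z w : `|z - u0| < d -> `|w - u0| < d ->
    `|w - z| <= K * (`|P 0%N w - P 0%N z| + `|Q 0%N w - Q 0%N z|).
  rewrite !lt_min => /andP[z1 _] /andP[w1 _]; apply: (le_trans (h1 _ _ z1 w1)).
  by rewrite ler_wpM2r ?addr_ge0// le_max lexx.
have hv z w : `|z - v0| < d -> `|w - v0| < d ->
    `|w - z| <= K * (`|P 0%N w - P 0%N z| + `|Q 0%N w - Q 0%N z|).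
  rewrite !lt_min => /andP[_ z1] /andP[_ w1]; apply: (le_trans (h2 _ _ z1 w1)).
  by rewrite ler_wpM2r ?addr_ge0// le_max lexx orbT.
(* On a circle with [rho] positive the two coordinates do not vanish together; a nonzero one is
   locally a function of the other. *)
have [Q0|Q0] := eqVneq (Q 0%N v0) 0; last first.
  apply: (@circle_curve_negligible _ (P 0%N) (Q 0%N) _ _ _ _ rho d K) => //.
  by move=> q [[_ _ Pq Qq Eq] _ _]; split.
apply: (@circle_curve_negligible _ (Q 0%N) (P 0%N) _ _ _ _ rho d K) => //.
- by move=> z w; rewrite (addrC `|Q 0%N w - _|); exact: hu.
- by move=> z w; rewrite (addrC `|Q 0%N w - _|); exact: hv.
- apply: contraTneq rho0 => P0; move: E0; rewrite Q0 P0 expr0n addr0 => <-.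
  by rewrite ltxx.
- by move=> q [[_ _ Pq Qq Eq] _ _]; split=> //; rewrite addrC.
Qed.

(** * The period lattice and the Hessian of a Green function *)

(* Coordinates in the basis [e_x, tau]. *)
Definition coord_t (R : realType) (tau z : R * R) : R := z.2 / tau.2.
Definition coord_s (R : realType) (tau z : R * R) : R := z.1 - coord_t tau z * tau.1.

Lemma coord_decomp (R : realType) (tau z : R * R) : tau.2 != 0 ->
  z = coord_s tau z *: e_x + coord_t tau z *: tau.
Proof.
case: z tau => x y [a b] /= b0; rewrite /coord_s /coord_t /=.
congr pair; rewrite /= -?[_ *: _]/(_ * _).
  by change (x = (x - y / b * a) * 1 + y / b * a); ring.
by change (y = (x - y / b * a) * 0 + y / b * b); field.
Qed.

Lemma coord_lattice (R : realType) (tau z : R * R) : tau.2 != 0 -> lattice tau z ->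
  exists m n : int, coord_s tau z = m%:~R /\ coord_t tau z = n%:~R.
Proof.
move=> t0 [m [n ->]]; exists m, n.
have E : (m%:~R *: e_x + n%:~R *: tau).2 = m%:~R * 0 + n%:~R * tau.2 by [].
have E1 : (m%:~R *: e_x + n%:~R *: tau).1 = m%:~R * 1 + n%:~R * tau.1 by [].
by rewrite /coord_s /coord_t E E1; split; field.
Qed.

Lemma coordD (R : realType) (tau z : R * R) (a b : R) : tau.2 != 0 ->
  coord_s tau (z + (a *: e_x + b *: tau)) = coord_s tau z + a /\
  coord_t tau (z + (a *: e_x + b *: tau)) = coord_t tau z + b.
Proof.
move=> t0.
have E : (z + (a *: e_x + b *: tau)).2 = z.2 + (a * 0 + b * tau.2) by [].
have E1 : (z + (a *: e_x + b *: tau)).1 = z.1 + (a * 1 + b * tau.1) by [].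
by rewrite /coord_s /coord_t E E1; split; field.
Qed.

Lemma continuous_coord (R : realType) (tau z : R * R) :
  {for z, continuous (coord_s tau)} /\ {for z, continuous (coord_t tau)}.
Proof.
have ct : {for z, continuous (coord_t tau)}.
  apply: (@continuousM _ _ (snd : R * R -> R) (cst tau.2^-1)); first exact: cvg_snd.
  exact: cst_continuous.
split=> //; apply: continuousB; first exact: cvg_fst.
by apply: (@continuousM _ _ (coord_t tau) (cst tau.1)); [exact: ct|exact: cst_continuous].
Qed.

Definition is_integer (R : realType) (x : R) := exists n : int, x = n%:~R.

Lemma floor_interval (R : realType) (x : R) : ~ is_integer x ->
  (Num.floor x)%:~R < x < (Num.floor x + 1)%:~R.
Proof.
move=> nx; have := floor_itv x; rewrite le_eqVlt => /andP[/orP[/eqP E|->]] //.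
by exfalso; apply: nx; exists (Num.floor x).
Qed.

Lemma between_integers (R : realType) (x : R) (n : int) :
  n%:~R < x < (n + 1)%:~R -> ~ is_integer x.
Proof. by move=> /andP[h1 h2] [m E]; move: h1 h2; rewrite E !ltr_int; lia. Qed.

Lemma near_interval (R : realType) (f : R * R -> R) (z : R * R) (a b : R) :
  {for z, continuous f} -> a < f z < b ->
  exists2 d : R, 0 < d & forall w, `|w - z| < d -> a < f w < b.
Proof.
move=> cf /andP[az zb].
have e0 : 0 < Num.min (f z - a) (b - f z) by rewrite lt_min !subr_gt0 az.
have [d d0 h] := continuousE_norm cf e0.
exists d => // w /h; rewrite lt_min !ltr_norml => /andP[/andP[h1 _] /andP[_ h2]].
by apply/andP; split; lra.
Qed.

(** A non-integral [tau]-coordinate stays non-integral nearby. If it is an integer [n], nearby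
    lattice points have that same [n], and [w.1 - n%:~R * tau.1] stays away from the integers. *)
Lemma lattice_compl_open (R : realType) (tau : R * R) :
  0 < tau.2 -> open (~` lattice tau).
Proof.
move=> t0; have tn0 : tau.2 != 0 by rewrite gt_eqF.
apply: open_norm => z nz.
have [cs ct] := continuous_coord tau z.
have [[n nE]|/floor_interval nt] := pselect (is_integer (coord_t tau z)); last first.
  have [d d0 h] := near_interval ct nt; exists d => // w /h /between_integers ntw lw.
  by have [m [n [_ nw]]] := coord_lattice tn0 lw; apply: ntw; exists n.
have ns : ~ is_integer (coord_s tau z).
  move=> [m mE]; apply: nz; exists m, n; by rewrite -mE -nE; exact: coord_decomp.
have nt : (n - 1)%:~R < coord_t tau z < (n + 1)%:~R by rewrite nE !ltr_int; lia.
have [d1 d10 h1] := near_interval ct nt.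
have cq : {for z, continuous (fun w : R * R => w.1 - n%:~R * tau.1)}.
  by apply: continuousB; [exact: cvg_fst|exact: cst_continuous].
have sE : coord_s tau z = z.1 - n%:~R * tau.1 by rewrite /coord_s nE.
have [d2 d20 h2] := near_interval cq (floor_interval (eq_ind _ (fun x => ~ is_integer x) ns _ sE)).
exists (Num.min d1 d2); first by rewrite lt_min d10.
move=> w; rewrite lt_min => /andP[/h1 w1 /h2 /between_integers w2] lw.
have [m [n' [mw nw]]] := coord_lattice tn0 lw.
move: w1; rewrite nw !ltr_int => w1; have nn' : n' = n by lia.
by apply: w2; exists m; rewrite -mw /coord_s nw nn'.
Qed.

Lemma line_clopen (R : realType) (A : set R) : A 0 ->
  (forall t, A t -> exists2 d : R, 0 < d & forall s, `|s - t| < d -> A s) ->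
  (forall t, ~ A t -> exists2 d : R, 0 < d & forall s, `|s - t| < d -> ~ A s) ->
  forall t, A t.
Proof.
move=> A0 oA cA.
have : connected [set: R] by apply/connected_intervalP.
move=> /(_ A) H t; rewrite H//; first by exists 0.
  by exists A; [exact: open_norm|rewrite setTI].
exists A; last by rewrite setTI.
by rewrite -openC; exact: open_norm.
Qed.

Lemma derive_eq_on (R : realType) (U : set (R * R)) (f g : R * R -> R) (z v : R * R) :
  open U -> (forall w, U w -> f w = g w) -> U z -> 'D_v f z = 'D_v g z.
Proof.
move=> oU fg Uz; apply: near_eq_derive.
have : \forall w \near z, U w by exact: open_nbhs_nbhs.
by apply: filterS => w /fg.
Qed.

Lemma lattice_derive_periodic (R : realType) (tau : R * R) (f : R * R -> R) (v : R * R) :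
  lattice_periodic tau f -> lattice_periodic tau ('D_v f).
Proof.
move=> pf z w lw; rewrite -derivative_shift; congr ('D_v _ z).
by apply/funext => y; exact: pf.
Qed.

Lemma smooth_iter (R : realType) (U : set (R * R)) (f : R * R -> R) (v : R * R) n :
  smooth_on U f -> smooth_on U (iter n (fun g => 'D_v g) f).
Proof. by move=> sf; elim: n => //= n; exact: smooth_derive. Qed.

(** [c] enters only the zeroth term. With [c = k / 2] the circle of singular Hessians is centred at
    the origin. *)
Definition re_seq (R : realType) (f : R * R -> R) (c : R) (j : nat) : R * R -> R :=
  iter j (fun h => 'D_e_x h) f - cst (if j is 0 then c else 0).

Definition im_seq (R : realType) (g : R * R -> R) (j : nat) : R * R -> R :=
  - iter j (fun h => 'D_e_x h) g.

Lemma iter_derive_y (R : realType) (U : set (R * R)) j (f g : R * R -> R) z :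
  open U -> smooth_on U f -> (forall w, U w -> 'D_e_y f w = g w) -> U z ->
  'D_e_y (iter j (fun h => 'D_e_x h) f) z = iter j (fun h => 'D_e_x h) g z.
Proof.
move=> oU sf fg; elim: j z => [|j IH] z Uz; first exact: fg.
rewrite (smooth_mixed oU (smooth_iter e_x j sf) Uz).
exact: (@derive_eq_on _ U _ _ z e_x oU IH Uz).
Qed.

(* The holomorphic function is [f - c - i g]. *)
Lemma cauchy_riemann_seq (R : realType) (U : set (R * R)) (f g : R * R -> R) (c : R) :
  open U -> smooth_on U f -> smooth_on U g ->
  (forall z, U z -> 'D_e_y f z = 'D_e_x g z) ->
  (forall z, U z -> 'D_e_y g z = - 'D_e_x f z) ->
  holomorphic_seq U (re_seq f c) (im_seq g).
Proof.
move=> oU sf sg fg gf j z Uz.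
have iterN n (h : R * R -> R) w : smooth_on U h -> U w ->
    iter n (fun h => 'D_e_x h) (- h) w = - iter n (fun h => 'D_e_x h) h w.
  move=> sh; elim: n w => // n IH w Uw.
  have E : 'D_e_x (iter n (fun h => 'D_e_x h) (- h)) w = 'D_e_x (- iter n (fun h => 'D_e_x h) h) w.
    exact: (@derive_eq_on _ U _ _ w e_x oU IH Uw).
  apply: (etrans E); rewrite deriveN//.
  exact/diff_derivable/(smooth_diff (smooth_iter e_x n sh) Uw).
have dA : differentiable (iter j (fun h => 'D_e_x h) f) z.
  exact: (smooth_diff (smooth_iter e_x j sf) Uz).
have dB : differentiable (iter j (fun h => 'D_e_x h) g) z.
  exact: (smooth_diff (smooth_iter e_x j sg) Uz).
have yA : 'D_e_y (iter j (fun h => 'D_e_x h) f) z = 'D_e_x (iter j (fun h => 'D_e_x h) g) z.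
  by rewrite (iter_derive_y j oU sf fg Uz) -iterSr.
have yB : 'D_e_y (iter j (fun h => 'D_e_x h) g) z = - 'D_e_x (iter j (fun h => 'D_e_x h) f) z.
  rewrite (@iter_derive_y _ U j g (- 'D_e_x f) z oU sg gf Uz).
  by rewrite iterN//; [rewrite -iterSr|exact: smooth_derive].
have re1 : re_seq f c j.+1 z = 'D_e_x (iter j (fun h => 'D_e_x h) f) z.
  exact: subr0.
have im1 : im_seq g j.+1 z = - 'D_e_x (iter j (fun h => 'D_e_x h) g) z by [].
rewrite re1 im1 /re_seq /im_seq.
move: (iter j _ f) (iter j _ g) dA dB yA yB => A B dA dB yA yB; clear -dA dB yA yB.
have DA v : 'D_v (A - cst (if j is 0 then c else 0)) z = 'D_v A z.
  rewrite deriveB; [by rewrite derive_cst subr0|exact: diff_derivable|exact: derivable_cst].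
have DB v : 'D_v (- B) z = - 'D_v B z by rewrite deriveN//; exact: diff_derivable.
split.
- by apply: differentiableB.
- exact: differentiableN.
- by rewrite !DA opprK.
- by rewrite !DB yB opprK.
Qed.

Lemma derive_const_sum (R : realType) (U : set (R * R)) (a d : R * R -> R) (k : R) (z v : R * R) :
  open U -> differentiable a z -> (forall w, U w -> a w + d w = k) -> U z ->
  'D_v d z = - 'D_v a z.
Proof.
move=> oU da E Uz.
have dE w : U w -> d w = (cst k - a) w.
  move=> /E {}E; change (d w = k - a w).
  by move: (a w) (d w) E => x y <-; rewrite addrC addKr.
rewrite (@derive_eq_on _ U d (cst k - a) z v oU dE Uz).
rewrite deriveB; [by rewrite derive_cst sub0r|exact: derivable_cst|exact: diff_derivable].
Qed.

(** Moving ['D_e_x] outwards turns the left side into the [x]-derivative of [G_yy], and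
    [G_yy = k - G_xx]. *)
Lemma hessian_cauchy_riemann (R : realType) (U : set (R * R)) (G : R * R -> R) (k : R) z :
  open U -> smooth_on U G -> (forall z, U z -> laplacian G z = k) -> U z ->
  'D_e_y ('D_e_y ('D_e_x G)) z = - 'D_e_x ('D_e_x ('D_e_x G)) z.
Proof.
move=> oU sG tr Uz.
have bE w : U w -> 'D_e_y ('D_e_x G) w = 'D_e_x ('D_e_y G) w by exact: smooth_mixed.
have E1 : 'D_e_y ('D_e_y ('D_e_x G)) z = 'D_e_y ('D_e_x ('D_e_y G)) z.
  exact: (@derive_eq_on _ U _ _ z e_y oU bE Uz).
have E2 : 'D_e_y ('D_e_x ('D_e_y G)) z = 'D_e_x ('D_e_y ('D_e_y G)) z.
  exact: (@smooth_mixed _ U ('D_e_y G) z oU (smooth_derive e_y sG) Uz).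
have sa : smooth_on U ('D_e_x ('D_e_x G)) by do 2 apply: smooth_derive.
have E3 := @derive_const_sum _ U ('D_e_x ('D_e_x G)) ('D_e_y ('D_e_y G)) k z e_x oU
  (smooth_diff sa Uz) tr Uz.
exact: (etrans E1 (etrans E2 E3)).
Qed.

Definition flat_at (R : realType) (P Q : nat -> R * R -> R) (z : R * R) :=
  forall j, P j.+1 z = 0 /\ Q j.+1 z = 0.

(** [flat_vanish] for the sequence shifted by one kills the first derivative near [z]; the higher
    ones are then derivatives of zero. *)
Lemma flat_at_open (R : realType) (U : set (R * R)) (P Q : nat -> R * R -> R) (z : R * R) :
  open U -> holomorphic_seq U P Q -> U z -> flat_at P Q z ->
  exists2 d : R, 0 < d & forall w, `|w - z| < d -> U w /\ flat_at P Q w.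
Proof.
move=> oU hol Uz fz.
have hol1 : holomorphic_seq U (fun j => P j.+1) (fun j => Q j.+1) by move=> j; exact: hol.
have /nearE_norm[d1 d10 h1] := flat_vanish oU hol1 Uz fz.
have [d2 d20 h2] := open_contains_ball oU Uz.
exists (Num.min d1 d2); first by rewrite lt_min d10.
pose V : set (R * R) := [set w | `|w - z| < Num.min d1 d2].
have VU w : V w -> U w by rewrite /V /= lt_min => /andP[_ /h2].
have oV : open V.
  apply: open_norm => w Vw; exists (Num.min d1 d2 - `|w - z|); first by rewrite subr_gt0.
  move=> y yw; rewrite /V /= -(subrK w y) -addrA (le_lt_trans (ler_normD _ _))//.
  by rewrite -ltrBrDr.
suff H j w : V w -> P j.+1 w = 0 /\ Q j.+1 w = 0.
  by move=> w Vw; split; [exact: VU|move=> j; exact: H].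
elim: j w => [|j IH] w Vw; first by apply: h1; move: Vw; rewrite /V /= lt_min => /andP[].
have [_ _ [<- _] [<- _]] := hol j.+1 w (VU _ Vw).
have D0 (f : R * R -> R) : (forall y, V y -> f y = 0) -> 'D_e_x f w = 0.
  move=> f0; have E : forall y, V y -> f y = (cst 0 : R * R -> R) y by exact: f0.
  by rewrite (@derive_eq_on _ V f (cst 0) w e_x oV E Vw) derive_cst.
by split; apply: D0 => y Vy; have [] := IH y Vy.
Qed.

(** The parameters where flatness holds form an open set by unique continuation and a closed one by
    continuity. Staying on a line reduces connectedness to that of the real numbers. *)
Lemma flat_at_line (R : realType) (U : set (R * R)) (P Q : nat -> R * R -> R) (z v : R * R) :
  open U -> holomorphic_seq U P Q -> (forall t : R, U (z + t *: v)) ->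
  flat_at P Q z -> forall t : R, flat_at P Q (z + t *: v).
Proof.
move=> oU hol Ul fz.
have v0 : 0 < 1 + `|v| by rewrite ltr_pwDl.
have close (d s t : R) : 0 < d -> `|s - t| < d / (1 + `|v|) -> `|z + s *: v - (z + t *: v)| < d.
  move=> d0; rewrite ltr_pdivlMr// mulrDr mulr1 => h.
  rewrite opprD addrACA subrr add0r -scalerBl normrZ.
  by apply: le_lt_trans h; rewrite lerDr.
apply: (@line_clopen _ (fun t => flat_at P Q (z + t *: v))).
- by rewrite scale0r addr0.
- move=> t /(flat_at_open oU hol (Ul t))[d d0 h].
  exists (d / (1 + `|v|)) => [|s st]; first by rewrite divr_gt0.
  by have [] := h _ (close _ _ _ d0 st).
- move=> t nf.
  have [j [x0 | x0]] : exists j, P j.+1 (z + t *: v) != 0 \/ Q j.+1 (z + t *: v) != 0.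
  - apply: contrapT => h; apply: nf => j; split; apply/eqP/negPn/negP => x0; apply: h; exists j;
      [left|right]; exact: x0.
  - have [c1 _] := holomorphic_continuous j.+1 hol (Ul t).
    have e0 : 0 < `|P j.+1 (z + t *: v)| by rewrite normr_gt0.
    have [d d0 h] := continuousE_norm c1 e0.
    exists (d / (1 + `|v|)) => [|s st fs]; first by rewrite divr_gt0.
    have := h _ (close _ _ _ d0 st); have [-> _] := fs j.
    by rewrite sub0r normrN ltxx.
  - have [_ c1] := holomorphic_continuous j.+1 hol (Ul t).
    have e0 : 0 < `|Q j.+1 (z + t *: v)| by rewrite normr_gt0.
    have [d d0 h] := continuousE_norm c1 e0.
    exists (d / (1 + `|v|)) => [|s st fs]; first by rewrite divr_gt0.
    have := h _ (close _ _ _ d0 st); have [_ ->] := fs j.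
    by rewrite sub0r normrN ltxx.
Qed.

Lemma flat_constant (R : realType) (U : set (R * R)) (P Q : nat -> R * R -> R) (z v : R * R) :
  holomorphic_seq U P Q -> (forall t : R, U (z + t *: v)) ->
  (forall t : R, flat_at P Q (z + t *: v)) -> forall t : R,
  P 0%N (z + t *: v) = P 0%N z /\ Q 0%N (z + t *: v) = Q 0%N z.
Proof.
move=> hol Ul fl t.
have D0 s : 'D_(t *: v) (P 0%N) (z + s *: (t *: v)) = 0 /\
            'D_(t *: v) (Q 0%N) (z + s *: (t *: v)) = 0.
  rewrite scalerA; have [dP dQ [Px Py] [Qx Qy]] := hol 0%N _ (Ul (s * t)).
  rewrite (dir_deriveE _ dP) (dir_deriveE _ dQ) Px Py Qx Qy; have [-> ->] := fl (s * t) 0%N.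
  by rewrite oppr0 !mulr0 addr0.
have dP s : 0 <= s <= 1 -> differentiable (P 0%N) (z + s *: (t *: v)).
  by move=> _; rewrite scalerA; have [] := hol 0%N _ (Ul (s * t)).
have dQ s : 0 <= s <= 1 -> differentiable (Q 0%N) (z + s *: (t *: v)).
  by move=> _; rewrite scalerA; have [] := hol 0%N _ (Ul (s * t)).
have [s1 _ E1] := mvt_line dP; have [s2 _ E2] := mvt_line dQ.
split; apply/eqP; rewrite -subr_eq0.
  by rewrite E1; have [-> _] := D0 s1.
by rewrite E2; have [_ ->] := D0 s2.
Qed.

(** The increment over one period is 0, and by the mean value theorem it equals the constant
    slope. *)
Lemma periodic_mean_slope (R : realType) (f : R * R -> R) (z v : R * R) (c : R) :
  (forall t : R, differentiable f (z + t *: v)) -> f (z + v) = f z ->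
  (forall t : R, v.1 * 'D_e_x f (z + t *: v) + v.2 * 'D_e_y f (z + t *: v) = c) -> c = 0.
Proof.
move=> df fz fc; have [|t _] := @mvt_line _ f z v; first by move=> t _; exact: df.
by rewrite fz subrr (dir_deriveE _ (df _)) fc => <-.
Qed.

(** For non-integral coordinates the lines through [z1] along [e_x] and [tau] avoid the lattice. A
    small step along [e_x + tau] stops short of the next integer in both coordinates. *)
Lemma generic_point (R : realType) (tau z : R * R) (d : R) : 0 < tau.2 -> 0 < d ->
  exists z1, [/\ `|z1 - z| < d, ~ is_integer (coord_s tau z1) & ~ is_integer (coord_t tau z1)].
Proof.
move=> t0 d0; have tn0 : tau.2 != 0 by rewrite gt_eqF.
have /andP[s1 s2] := floor_itv (coord_s tau z).
have /andP[t1 t2] := floor_itv (coord_t tau z).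
set m := Num.floor (coord_s tau z) in s1 s2; set n := Num.floor (coord_t tau z) in t1 t2.
pose N := 1 + `|e_x + tau|.
have N0 : 0 < N by rewrite ltr_pwDl.
pose M := Num.min (d / N) (Num.min ((m + 1)%:~R - coord_s tau z) ((n + 1)%:~R - coord_t tau z)).
have M0 : 0 < M by rewrite !lt_min divr_gt0// !subr_gt0 s2.
pose e := M / 2; have e0 : 0 < e by rewrite divr_gt0.
have : e < M by rewrite /e; lra.
rewrite !lt_min => /and3P[ed es et].
have [cs ct] := coordD z e e tn0.
exists (z + (e *: e_x + e *: tau)); split.
- rewrite addrAC subrr add0r -scalerDr normrZ (gtr0_norm e0).
  move: ed; rewrite ltr_pdivlMr//; apply: le_lt_trans.
  by rewrite ler_pM2l// lerDr.
- by rewrite cs; apply: (@between_integers _ _ m); apply/andP; split; lra.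
- by rewrite ct; apply: (@between_integers _ _ n); apply/andP; split; lra.
Qed.

(* If the holomorphic function [G_xx - k / 2 - i G_xy] were flat at a point, the Hessian of [G]
   would be constant along two lines avoiding the lattice, of directions [e_x] and [tau]; by
   periodicity of the gradient it kills both directions, contradicting its trace [k]. *)
Lemma hessian_not_flat (R : realType) (tau : R * R) (G : R * R -> R) (k : R) :
  0 < tau.2 -> lattice_periodic tau G -> smooth_on (~` lattice tau) G ->
  (forall z, ~ lattice tau z -> laplacian G z = k) -> k != 0 ->
  forall z, ~ lattice tau z -> exists j,
    0 < sqmod (re_seq ('D_e_x ('D_e_x G)) (k / 2) j.+1) (im_seq ('D_e_y ('D_e_x G)) j.+1) z.
Proof.
move=> t0 pG sG tr k0 z nz; have tn0 : tau.2 != 0 by rewrite gt_eqF.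
have oU := lattice_compl_open t0; set U := ~` lattice tau in oU sG.
have sx := smooth_derive e_x sG; have sy := smooth_derive e_y sG.
have sxx := smooth_derive e_x sx; have sxy := smooth_derive e_y sx.
have hol : holomorphic_seq U (re_seq ('D_e_x ('D_e_x G)) (k / 2)) (im_seq ('D_e_y ('D_e_x G))).
  have cr1 w : U w -> 'D_e_y ('D_e_x ('D_e_x G)) w = 'D_e_x ('D_e_y ('D_e_x G)) w.
    exact: (smooth_mixed oU sx).
  have cr2 w : U w -> 'D_e_y ('D_e_y ('D_e_x G)) w = - 'D_e_x ('D_e_x ('D_e_x G)) w.
    exact: (hessian_cauchy_riemann oU sG tr).
  exact: (cauchy_riemann_seq (k / 2) oU sxx sxy cr1 cr2).
apply: contrapT => nj.
have fz : flat_at (re_seq ('D_e_x ('D_e_x G)) (k / 2)) (im_seq ('D_e_y ('D_e_x G))) z.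
  move=> j; apply: sqmod_eq0; rewrite leNgt; apply/negP => h; apply: nj; exists j; exact: h.
have [d d0 hd] := flat_at_open oU hol nz fz.
have [z1 [z1d ns nt]] := generic_point z t0 d0.
have [Uz1 fz1] := hd _ z1d.
have Ux (t : R) : U (z1 + t *: e_x).
  move=> /(coord_lattice tn0)[m [n [_ nE]]]; apply: nt; exists n.
  by have [_] := coordD z1 t 0 tn0; rewrite scale0r !addr0 nE.
have Ut (t : R) : U (z1 + t *: tau).
  move=> /(coord_lattice tn0)[m [n [mE _]]]; apply: ns; exists m.
  by have [] := coordD z1 0 t tn0; rewrite scale0r addr0 add0r mE.
have cx := flat_constant hol Ux (flat_at_line oU hol Ux fz1).
have ct := flat_constant hol Ut (flat_at_line oU hol Ut fz1).
have lx : lattice tau e_x by exists 1, 0; rewrite scale1r scale0r addr0.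
have lt : lattice tau tau by exists 0, 1; rewrite scale1r scale0r add0r.
have reE w : re_seq ('D_e_x ('D_e_x G)) (k / 2) 0 w = 'D_e_x ('D_e_x G) w - k / 2 by [].
have imE w : im_seq ('D_e_y ('D_e_x G)) 0 w = - 'D_e_y ('D_e_x G) w by [].
have consts w : re_seq ('D_e_x ('D_e_x G)) (k / 2) 0 w = re_seq ('D_e_x ('D_e_x G)) (k / 2) 0 z1 /\
    im_seq ('D_e_y ('D_e_x G)) 0 w = im_seq ('D_e_y ('D_e_x G)) 0 z1 -> U w ->
    [/\ 'D_e_x ('D_e_x G) w = 'D_e_x ('D_e_x G) z1, 'D_e_y ('D_e_x G) w = 'D_e_y ('D_e_x G) z1,
        'D_e_x ('D_e_y G) w = 'D_e_y ('D_e_x G) z1 & 'D_e_y ('D_e_y G) w = k - 'D_e_x ('D_e_x G) z1].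
  move=> [/addIr E1 /oppr_inj E2] Uw; split; [exact: E1|exact: E2| |].
    exact: (etrans (esym (smooth_mixed oU sG Uw)) E2).
  have solve (x x' y : R) : x = x' -> x + y = k -> y = k - x'.
    by move=> <- <-; rewrite addrC addKr.
  exact: (solve _ _ _ E1 (tr _ Uw)).
have unitcomb (x x' y : R) : x = x' -> 1 * x + 0 * y = x'.
  by move=> ->; rewrite mul1r mul0r addr0.
(* Along [e_x] the gradient is periodic with constant slope [(G_xx, G_xy)], so both vanish; then
   [G_yy = k], and the slope of [G_y] along [tau] is [tau.2 * k]. *)
have a0 : 'D_e_x ('D_e_x G) z1 = 0.
  apply: (@periodic_mean_slope _ ('D_e_x G) z1 e_x).
  - by move=> t; exact: (smooth_diff sx (Ux t)).
  - exact: (lattice_derive_periodic e_x pG).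
  - move=> t; have [E1 _ _ _] := consts _ (cx t) (Ux t).
    exact: (unitcomb _ _ _ E1).
have b0 : 'D_e_y ('D_e_x G) z1 = 0.
  apply: (@periodic_mean_slope _ ('D_e_y G) z1 e_x).
  - by move=> t; exact: (smooth_diff sy (Ux t)).
  - exact: (lattice_derive_periodic e_y pG).
  - move=> t; have [_ _ E1 _] := consts _ (cx t) (Ux t).
    exact: (unitcomb _ _ _ E1).
have : tau.2 * k = 0.
  apply: (@periodic_mean_slope _ ('D_e_y G) z1 tau).
  - by move=> t; exact: (smooth_diff sy (Ut t)).
  - exact: (lattice_derive_periodic e_y pG).
  - move=> t; have [_ _ E1 E2] := consts _ (ct t) (Ut t).
    have comb (x x' y y' : R) : x = x' -> y = k - y' -> x' = 0 -> y' = 0 ->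
      tau.1 * x + tau.2 * y = tau.2 * k by move=> -> -> -> ->; rewrite mulr0 add0r subr0.
    exact: (comb _ _ _ _ E1 E2 b0 a0).
by apply/eqP; rewrite mulf_neq0.
Qed.

Lemma green_pair_derive (R : realType) (U : set (R * R)) (f : R * R -> R) (p w v : R * R) :
  smooth_on U f -> U (w - p) -> U (w + p) ->
  'D_v (green_pair f p) w = green_pair ('D_v f) p w.
Proof.
move=> sf U1 U2.
have d1 : derivable (fun z => f (z - p)) w v.
  by apply/diff_derivable/differentiable_shift/(smooth_diff sf).
have d2 : derivable (fun z => f (z + p)) w v.
  by apply/diff_derivable/differentiable_shift/(smooth_diff sf).
have E : 'D_v (green_pair f p) w = 2^-1 * ('D_v (fun z => f (z - p)) w + 'D_v (fun z => f (z + p)) w).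
  have := deriveZ (2^-1) (derivableD d1 d2); rewrite (deriveD d1 d2); exact.
by rewrite E !derivative_shift.
Qed.

Lemma green_pair_derive2 (R : realType) (U : set (R * R)) (f : R * R -> R) (p z v w : R * R) :
  open U -> smooth_on U f -> U (z - p) -> U (z + p) ->
  'D_w ('D_v (green_pair f p)) z = green_pair ('D_w ('D_v f)) p z.
Proof.
move=> oU sf U1 U2; have sv := smooth_derive v sf.
rewrite -(green_pair_derive w sv U1 U2).
have [d1 d10 h1] := open_contains_ball oU U1.
have [d2 d20 h2] := open_contains_ball oU U2.
apply: near_eq_derive; apply/nearE_norm; exists (Num.min d1 d2); first by rewrite lt_min d10.
move=> y; rewrite lt_min => /andP[y1 y2]; apply: (green_pair_derive v sf).
  by apply: h1; rewrite opprB addrA subrK.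
by apply: h2; rewrite opprD addrACA subrr addr0.
Qed.

(** Strict convexity of the circle: for equal traces the squared distance between [(a, b)] and
    [(a', b')] is a combination of the three determinants, all of which vanish. *)
Lemma equal_rank_one (R : realFieldType) (a b d a' b' d' k : R) :
  a + d = k -> a' + d' = k -> a * d = b ^+ 2 -> a' * d' = b' ^+ 2 ->
  (a + a') * (d + d') = (b + b') ^+ 2 -> a = a' /\ b = b'.
Proof.
move=> h h' e e' E.
have dE : d = k - a by rewrite -h addrC addKr.
have dE' : d' = k - a' by rewrite -h' addrC addKr.
have S : (a - a') ^+ 2 + (b - b') ^+ 2 = 0.
  rewrite dE in e E; rewrite dE' in e' E; move: e e' E; rewrite !expr2; clear => e e' E.
  have -> : (a - a') * (a - a') + (b - b') * (b - b') =
     2 * (b * b - a * (k - a)) + 2 * (b' * b' - a' * (k - a')) +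
     ((a + a') * (k - a + (k - a')) - (b + b') * (b + b')) by ring.
  by rewrite e e' E !subrr !mulr0 !addr0.
by split; apply/eqP; rewrite -subr_eq0 -sqrf_eq0; apply/eqP; move: S;
   have := sqr_ge0 (a - a'); have := sqr_ge0 (b - b'); lra.
Qed.

Lemma half_difference (R : realType) (z p : R * R) : 2^-1 *: (z + p - (z - p)) = p.
Proof.
rewrite opprB (addrC z) addrACA subrr addr0 scalerDr -scalerDl.
have h : 2^-1 + 2^-1 = 1 :> R by field.
by rewrite h scale1r.
Qed.

Lemma nondegenerate_of_laplacian (R : realType) (tau : R * R) (G : R * R -> R) (k : R) :
  0 < tau.2 -> lattice_periodic tau G -> smooth_on (~` lattice tau) G ->
  0 < k -> (forall z, ~ lattice tau z -> laplacian G z = k) ->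
  area2.-negligible [set p | exists z, critical_point tau G p z /\ ~ nondegenerate_at G p z].
Proof.
move=> t0 pG sG k0 tr.
have oU := lattice_compl_open t0; set U := ~` lattice tau in oU sG.
have sx := smooth_derive e_x sG; have sy := smooth_derive e_y sG.
have sxx := smooth_derive e_x sx; have sxy := smooth_derive e_y sx.
have sym z : U z -> 'D_e_y ('D_e_x G) z = 'D_e_x ('D_e_y G) z by exact: (smooth_mixed oU sG).
have cr1 w : U w -> 'D_e_y ('D_e_x ('D_e_x G)) w = 'D_e_x ('D_e_y ('D_e_x G)) w.
  exact: (smooth_mixed oU sx).
have cr2 w : U w -> 'D_e_y ('D_e_y ('D_e_x G)) w = - 'D_e_x ('D_e_x ('D_e_x G)) w.
  exact: (hessian_cauchy_riemann oU sG tr).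
have hol := cauchy_riemann_seq (k / 2) oU sxx sxy cr1 cr2.
have nf := hessian_not_flat t0 pG sG tr (lt0r_neq0 k0).
have rho0 : 0 < (k / 2) ^+ 2 by rewrite exprn_gt0// divr_gt0.
have N1 := transversal_negligible 2^-1 oU sx sy sym k0 tr.
(* Exchanging [u] and [v] changes the sign of the factor; this covers the pairs with [DF v]
   invertible. *)
have N2 := transversal_negligible (- 2^-1) oU sx sy sym k0 tr.
have N3 := conformal_negligible 2^-1 oU hol rho0 nf.
have := negligibleU (negligibleU N1 N2) N3; apply: negligibleS.
move=> p [z [[Uu Uv cx cy]]]; rewrite /nondegenerate_at => /negP; rewrite negbK => /eqP.
rewrite /hessian_det.
have [vE1 vE2] : 2^-1 *: ((z + p) - (z - p)) = p /\ - 2^-1 *: ((z - p) - (z + p)) = p.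
  by split; [|rewrite scaleNr -scalerN opprB]; exact: half_difference.
have c1 := etrans (esym (green_pair_derive e_x sG Uu Uv)) cx.
have c2 := etrans (esym (green_pair_derive e_y sG Uu Uv)) cy.
have half (x y : R) : 2^-1 * (x + y) = 0 -> x + y = 0.
  by move=> /eqP; rewrite mulf_eq0 invr_eq0 pnatr_eq0 => /eqP.
have {c1} fx := half _ _ c1; have {c2} fy := half _ _ c2.
have hxx := green_pair_derive2 e_x e_x oU sG Uu Uv.
have hyy := green_pair_derive2 e_y e_y oU sG Uu Uv.
have hyx := green_pair_derive2 e_y e_x oU sG Uu Uv.
have hxy := green_pair_derive2 e_x e_y oU sG Uu Uv.
have hyx' : 'D_e_x ('D_e_y (green_pair G p)) z = green_pair ('D_e_y ('D_e_x G)) p z.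
  have gp (f g : R * R -> R) : f (z - p) = g (z - p) -> f (z + p) = g (z + p) ->
    green_pair f p z = green_pair g p z by rewrite /green_pair => -> ->.
  exact: (etrans hyx (gp _ _ (esym (sym _ Uu)) (esym (sym _ Uv)))).
have tu : 'D_e_x ('D_e_x G) (z - p) + 'D_e_y ('D_e_y G) (z - p) = k := tr _ Uu.
have tv : 'D_e_x ('D_e_x G) (z + p) + 'D_e_y ('D_e_y G) (z + p) = k := tr _ Uv.
have det (x y t t' a a' b b' d d' : R) : x = 2^-1 * (a + a') -> y = 2^-1 * (d + d') ->
   t = 2^-1 * (b + b') -> t' = 2^-1 * (b + b') -> x * y - t * t' = 0 ->
   (a + a') * (d + d') = (b + b') ^+ 2.
  move=> -> -> -> -> E; apply/eqP; rewrite -subr_eq0; apply/eqP.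
  rewrite (_ : _ - _ = 4 * (2^-1 * (a + a') * (2^-1 * (d + d')) -
    2^-1 * (b + b') * (2^-1 * (b + b')))); last by field.
  by rewrite E mulr0.
move=> /(det _ _ _ _ _ _ _ _ _ _ hxx hyy hyx' hxy) S.
have [du|du] := eqVneq ('D_e_x ('D_e_x G) (z - p) * 'D_e_y ('D_e_y G) (z - p))
   ('D_e_y ('D_e_x G) (z - p) ^+ 2); last first.
  left; left; exists (z - p, z + p); last exact: vE1.
  split; [exact: Uu|exact: Uv|exact: fx|exact: fy|split; first exact: S].
  by rewrite subr_eq0; exact: du.
have [dv|dv] := eqVneq ('D_e_x ('D_e_x G) (z + p) * 'D_e_y ('D_e_y G) (z + p))
   ('D_e_y ('D_e_x G) (z + p) ^+ 2); last first.
  left; right; exists (z + p, z - p); last exact: vE2.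
  split; [exact: Uv|exact: Uu|exact: etrans (addrC _ _) fx|exact: etrans (addrC _ _) fy|].
  split; last by rewrite subr_eq0; exact: dv.
  have comm (x x' y y' t t' : R) : (x + x') * (y + y') = (t + t') ^+ 2 ->
    (x' + x) * (y' + y) = (t' + t) ^+ 2 by rewrite (addrC x) (addrC y) (addrC t).
  exact: comm S.
right; have [aa bb] := equal_rank_one tu tv du dv S.
exists (z - p, z + p); last exact: vE1.
have reE w : re_seq ('D_e_x ('D_e_x G)) (k / 2) 0 w = 'D_e_x ('D_e_x G) w - k / 2 by [].
have imE w : im_seq ('D_e_y ('D_e_x G)) 0 w = - 'D_e_y ('D_e_x G) w by [].
split; [exact: Uu|exact: Uv| | |].
- exact: (congr1 (fun x => x - k / 2) aa).
- exact: (congr1 -%R bb).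
- have circle (a b d : R) : a + d = k -> a * d = b ^+ 2 ->
      (a - k / 2) ^+ 2 + (- b) ^+ 2 = (k / 2) ^+ 2.
    by move=> <- ab; rewrite sqrrN -ab; field.
  exact: circle tv dv.
Qed.

(** * Smooth functions built from exp (-1 / x) *)

(* [x^-k exp (-1/x)], extended by [0] to [x <= 0]; the span of these is closed under
   derivation. *)
Definition flat_exp (R : realType) (k : nat) (x : R) : R :=
  if 0 < x then x^-1 ^+ k * expR (- x^-1) else 0.

(** One term of the exponential series, [y ^ (k + 2) / (k + 2)! <= exp y] at [y = x^-1]. The two
    extra powers give the quadratic decay that makes the derivative at 0 vanish. *)
Lemma flat_exp_bound (R : realType) (k : nat) (x : R) :
  0 <= flat_exp k x <= (k.+2)`!%:R * x ^+ 2.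
Proof.
rewrite /flat_exp; case: ltP => [x0|_]; last by rewrite lexx mulr_ge0// sqr_ge0.
have y0 : 0 < x^-1 by rewrite invr_gt0.
apply/andP; split; first by rewrite mulr_ge0 ?expR_ge0// exprn_ge0// ltW.
have F0 : 0 < (k.+2)`!%:R :> R by rewrite ltr0n fact_gt0.
have H : x^-1 ^+ k.+2 <= (k.+2)`!%:R * expR x^-1.
  rewrite -ler_pdivrMl// mulrC; apply: le_trans (expR_ge1Dxn k.+1 (ltW y0)).
  by rewrite lerDr.
rewrite expRN ler_pdivrMr ?expR_gt0//.
have -> : x^-1 ^+ k = x^-1 ^+ k.+2 * x ^+ 2.
  by rewrite -addn2 exprD -mulrA -exprMn mulVf ?gt_eqF// expr1n mulr1.
by rewrite [leRHS]mulrAC ler_pM2r// exprn_gt0.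
Qed.

Lemma is_derive_of_expansion (R : realType) (f : R -> R) (x c : R) :
  (forall e, 0 < e -> exists2 d : R, 0 < d & forall h, `|h| < d ->
    `|f (x + h) - f x - h * c| <= e * `|h|) -> is_derive x (1 : R) f c.
Proof.
move=> H.
have L : (fun h : R => h^-1 *: ((f \o shift x) (h *: (1 : R)) - f x)) @ 0^' --> c.
  apply/cvgrPdist_le => e e0; have [d d0 hd] := H e e0.
  apply/nbhs_ballP; exists d => //= h; rewrite -ball_normE /= sub0r normrN => hd' h0.
  rewrite [h *: 1]mulr1 (addrC h) distrC.
  rewrite (_ : h^-1 *: (f (x + h) - f x) - c = h^-1 * (f (x + h) - f x - h * c)); last first.
    by rewrite mulrBr mulrA mulVf// mul1r.
  by rewrite normrM normfV ler_pdivrMl ?normr_gt0// (mulrC `|h|) hd.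
split; first by apply/cvg_ex; exists c.
by apply: cvg_lim => //; exact: L.
Qed.

Lemma is_derive_flat_exp (R : realType) (k : nat) (x : R) :
  is_derive x (1 : R) (flat_exp k) (flat_exp k.+2 x - k%:R * flat_exp k.+1 x).
Proof.
have [x0|x0|->] := ltgtP x 0.
- have -> : flat_exp k.+2 x - k%:R * flat_exp k.+1 x = 0.
    by rewrite /flat_exp (lt_gtF x0) mulr0 subr0.
  apply: (near_eq_is_derive (f := cst 0)).
    apply/nearE_norm; exists (- x) => [|y]; first by rewrite oppr_gt0.
    rewrite ltr_distl addrN => /andP[_ y0]; by rewrite /flat_exp (lt_gtF y0).
- have E : \forall y \near x, y^-1 ^+ k * expR (- y^-1) = flat_exp k y.
    apply/nearE_norm; exists x => // y; rewrite distrC ltr_distlC subrr => /andP[y0 _].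
    by rewrite /flat_exp y0.
  apply: (near_eq_is_derive E).
  have -> : (fun y : R => y^-1 ^+ k * expR (- y^-1)) =
      ((fun y : R => y^-1) ^+ k : R -> R) * (expR \o (fun y : R => - y^-1)).
    by apply/funext => y; rewrite fctE exprfctE.
  have D1 : is_derive x (1 : R) (fun y : R => y^-1) (- x ^- 2 *: (1 : R)).
    by apply: is_deriveV; exact: lt0r_neq0.
  have D2 := @is_derive1_comp _ expR (fun y : R => - y^-1) x _ _ (is_derive_expR _) (is_deriveN D1).
  have D3 := is_deriveM (is_deriveX k D1) D2.
  apply: (is_derive_eq D3).
  rewrite exprfctE /flat_exp x0.
  change (x^-1 ^+ k * (expR (- x^-1) * - (- x ^- 2 * 1)) +
      expR (- x^-1) * ((k%:R * x^-1 ^+ k.-1) * (- x ^- 2 * 1)) =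
    x^-1 ^+ k.+2 * expR (- x^-1) - k%:R * (x^-1 ^+ k.+1 * expR (- x^-1))).
  rewrite -exprVn; move: (expR (- x^-1)) (x^-1); clear => E y.
  by case: k => [|k]; rewrite /= !exprS; ring.
- have -> : flat_exp k.+2 0 - k%:R * flat_exp k.+1 0 = 0 :> R.
    by rewrite /flat_exp ltxx mulr0 subr0.
  apply: is_derive_of_expansion => e e0.
  have F0 : 0 < (k.+2)`!%:R :> R by rewrite ltr0n fact_gt0.
  exists (e / (k.+2)`!%:R) => [|h]; first by rewrite divr_gt0.
  rewrite ltr_pdivlMr// => he.
  have /andP[h1 h2] := flat_exp_bound k h.
  rewrite add0r {2}/flat_exp ltxx subr0 mulr0 subr0 ger0_norm// (le_trans h2)//.
  rewrite -(real_normK (num_real h)) expr2 mulrA ler_wpM2r// mulrC; exact: ltW.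
Qed.

Lemma diff_dir (R : realType) (V : normedModType R) (f : V -> R) (z v : V) :
  differentiable f z -> derivable f z v.
Proof. exact: diff_derivable. Qed.

Arguments diff_dir {R V f z} v _.

Lemma affine_derive (R : realType) (a b c : R) (z v : R * R) :
  differentiable (fun w : R * R => a * w.1 + b * w.2 + c) z /\
  'D_v (fun w : R * R => a * w.1 + b * w.2 + c) z = a * v.1 + b * v.2.
Proof.
have d1 := differentiableZ a (differentiable_fst z).
have d2 := differentiableZ b (differentiable_snd z).
have d3 : differentiable (cst c : R * R -> R) z by exact: differentiable_cst.
have d12 := differentiableD d1 d2.
split; first exact: (differentiableD d12 d3).
have := deriveD (diff_dir v (differentiableD d1 d2)) (diff_dir v d3).
rewrite derive_cst addr0 (deriveD (diff_dir v d1) (diff_dir v d2)).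
rewrite (deriveZ a (diff_dir v (differentiable_fst z))).
rewrite (deriveZ b (diff_dir v (differentiable_snd z))).
by rewrite derive_fst derive_snd.
Qed.

Lemma comp_derive (R : realType) (f : R -> R) (g : R * R -> R) (z v : R * R) (c : R) :
  is_derive (g z) (1 : R) f c -> differentiable g z ->
  differentiable (fun w => f (g w)) z /\ 'D_v (fun w => f (g w)) z = c * 'D_v g z.
Proof.
move=> [df dfc] dg.
have df' : differentiable f (g z) by apply/derivable1_diffP.
have dfg : differentiable (f \o g) z by exact: differentiable_comp.
split; first exact: dfg.
rewrite (deriveE v dfg) (diff_comp dg df') /=.
rewrite -(deriveE v dg) (deriv1E df) /= derive1E dfc; exact: mulrC.
Qed.

(* Chosen to be closed under differentiation and to contain a periodic bump function. *)
Inductive trig_exp (R : realType) : (R * R -> R) -> Prop :=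
| TrigCst c : trig_exp (fun=> c)
| TrigAdd f g : trig_exp f -> trig_exp g -> trig_exp (fun z => f z + g z)
| TrigMul f g : trig_exp f -> trig_exp g -> trig_exp (fun z => f z * g z)
| TrigSin a b c : trig_exp (fun z => sin (a * z.1 + b * z.2 + c))
| TrigCos a b c : trig_exp (fun z => cos (a * z.1 + b * z.2 + c))
| TrigFlat k e a b c :
    trig_exp (fun z => flat_exp k (cos (a * z.1 + b * z.2 + c) - e)).

Lemma trig_exp_derive (R : realType) (f : R * R -> R) : trig_exp f ->
  (forall z, differentiable f z) /\ forall v, trig_exp ('D_v f).
Proof.
elim=> [c|{}f g _ [df Sf] _ [dg Sg]|{}f g Tf [df Sf] Tg [dg Sg]|a b c|a b c|k e a b c].
- split=> [z|v]; first exact: differentiable_cst.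
  rewrite (_ : 'D_v _ = fun=> 0); first exact: TrigCst.
  by apply/funext => z; exact: derive_cst.
- split=> [z|v]; first exact: differentiableD.
  rewrite (_ : 'D_v _ = fun z => 'D_v f z + 'D_v g z); first exact: TrigAdd.
  by apply/funext => z; apply: deriveD; exact: diff_derivable.
- split=> [z|v]; first exact: differentiableM.
  rewrite (_ : 'D_v _ = fun z => f z * 'D_v g z + g z * 'D_v f z).
    by apply: TrigAdd; apply: TrigMul.
  by apply/funext => z; apply: deriveM; exact: diff_derivable.
- have D z v : differentiable (fun w : R * R => sin (a * w.1 + b * w.2 + c)) z /\
    'D_v (fun w : R * R => sin (a * w.1 + b * w.2 + c)) z =
     cos (a * z.1 + b * z.2 + c) * (a * v.1 + b * v.2).
    have [dl Dl] := affine_derive a b c z v.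
    by have [d1 ->] := comp_derive v (is_derive_sin (a * z.1 + b * z.2 + c)) dl; rewrite Dl.
  split=> [z|v]; first by have [] := D z 0.
  rewrite (_ : 'D_v _ = fun z => cos (a * z.1 + b * z.2 + c) * (a * v.1 + b * v.2)).
    by apply: TrigMul; [exact: TrigCos|exact: TrigCst].
  by apply/funext => z; have [] := D z v.
- have D z v : differentiable (fun w : R * R => cos (a * w.1 + b * w.2 + c)) z /\
    'D_v (fun w : R * R => cos (a * w.1 + b * w.2 + c)) z =
     sin (a * z.1 + b * z.2 + c) * - (a * v.1 + b * v.2).
    have [dl Dl] := affine_derive a b c z v.
    have [d1 ->] := comp_derive v (is_derive_cos (a * z.1 + b * z.2 + c)) dl.
    by rewrite Dl mulNr mulrN.
  split=> [z|v]; first by have [] := D z 0.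
  rewrite (_ : 'D_v _ = fun z => sin (a * z.1 + b * z.2 + c) * - (a * v.1 + b * v.2)).
    by apply: TrigMul; [exact: TrigSin|exact: TrigCst].
  by apply/funext => z; have [] := D z v.
- pose th (w : R * R) : R := a * w.1 + b * w.2 + c.
  have D z v : differentiable (fun w : R * R => flat_exp k (cos (th w) - e)) z /\
    'D_v (fun w : R * R => flat_exp k (cos (th w) - e)) z =
     (flat_exp k.+2 (cos (th z) - e) + - k%:R * flat_exp k.+1 (cos (th z) - e)) *
       (sin (th z) * - (a * v.1 + b * v.2)).
    have [dl Dl] := affine_derive a b c z v.
    have [d1 E1] := comp_derive v (is_derive_cos (th z)) dl.
    have d2 : differentiable (fun w => cos (th w) - e) z.
      by apply: differentiableB; [exact: d1|exact: differentiable_cst].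
    have [d3 ->] := comp_derive v (is_derive_flat_exp k (cos (th z) - e)) d2.
    split; first exact: d3.
    have -> : 'D_v (fun w => cos (th w) - e) z = sin (th z) * - (a * v.1 + b * v.2).
      have := deriveB (diff_dir v d1) (derivable_cst e z v).
      by rewrite derive_cst subr0 E1 Dl mulNr mulrN.
    by rewrite mulNr.
  split=> [z|v]; first by have [] := D z 0.
  rewrite (_ : 'D_v _ = fun z => (flat_exp k.+2 (cos (th z) - e) +
     - k%:R * flat_exp k.+1 (cos (th z) - e)) * (sin (th z) * - (a * v.1 + b * v.2))).
    apply: TrigMul; last by apply: TrigMul; [exact: TrigSin|exact: TrigCst].
    by apply: TrigAdd; [|apply: TrigMul; [exact: TrigCst|]]; exact: TrigFlat.
  by apply/funext => z; have [] := D z v.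
Qed.

(** Iterated directional derivatives stay in the class, so smoothness reduces to differentiability
    of its members. *)
Lemma trig_exp_smooth (R : realType) (f : R * R -> R) : trig_exp f -> smooth_on setT f.
Proof.
move=> Sf vs z _; suff : trig_exp (foldr (fun v (g : R * R -> R) => 'D_v g) f vs).
  by move=> /trig_exp_derive[].
by elim: vs => //= v vs /trig_exp_derive[].
Qed.

(** * Green's identity on a square *)

Lemma measurable_square (R : realType) (z0 : R * R) (r : R) : measurable (square z0 r).
Proof. by rewrite squareE; apply: measurableX. Qed.

Lemma area_square (R : realType) (z0 : R * R) (r : R) : 0 <= r ->
  area2 (square z0 r) = ((2 * r) * (2 * r))%:E.
Proof.
move=> r0; rewrite squareE /area2.
rewrite (@product_measure1E _ _ _ _ _ lebesgue_measure lebesgue_measure)//.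
by rewrite [X in (X * _)%E](lebesgue_itvcc_center _ r0) [X in (_ * X)%E](lebesgue_itvcc_center _ r0).
Qed.

(** Measurability refers to the product sigma-algebra; an open set is a union of countably many
    closed squares with rational centres. *)
Lemma open_measurable_plane (R : realType) (O : set (R * R)) : open O -> measurable O.
Proof.
move=> oO.
pose c (k : (rat * rat) * nat) : R * R := (ratr k.1.1, ratr k.1.2).
pose box k := square (c k) (k.2.+1%:R^-1).
pose F (i : nat) : set (R * R) := if @unpickle ((rat * rat) * nat)%type i is Some k then
   (if asbool (box k `<=` O) then box k else set0) else set0.
have -> : O = \bigcup_i F i.
  apply/seteqP; split=> z.
    move=> Oz; have [d d0 hd] := open_contains_ball oO Oz.
    pose n := Num.truncn (2 / d).
    have nd2 : 2 * n.+1%:R^-1 < d.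
      by rewrite ltr_pdivrMr// -ltr_pdivrMl// mulrC truncnS_gt.
    have n0 : 0 < n.+1%:R^-1 :> R by rewrite invr_gt0.
    have [a ha] := rat_approx z.1 n0; have [b hb] := rat_approx z.2 n0.
    have zc : `|z - c (a, b, n)| < n.+1%:R^-1 by rewrite norm_prod_lt /=; apply/andP; split.
    have FE : F (pickle ((a, b), n)) = if asbool (box (a, b, n) `<=` O) then box (a, b, n) else set0.
      by rewrite /F pickleK.
    move: (pickle _) FE => j FE; exists j; rewrite ?FE//.
    case: asboolP => [_|]; first exact: ltW.
    move=> nO; exfalso; apply: nO => w wc; apply: hd; apply: le_lt_trans nd2.
    rewrite -(subrK (c (a, b, n)) w) -addrA (le_trans (ler_normD _ _))// mulrDl mul1r.
    by apply: lerD; [exact: wc|rewrite distrC ltW].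
  by move=> [i _]; rewrite /F; case: unpickle => // k; case: asboolP => // h /h.
apply: bigcupT_measurable => i; rewrite /F; case: unpickle => // k.
by case: asboolP => // _; exact: measurable_square.
Qed.

Lemma continuous_measurable_square (R : realType) (f : R * R -> R) (z0 : R * R) (r : R) :
  (forall z, square z0 r z -> {for z, continuous f}) -> measurable_fun (square z0 r) f.
Proof.
move=> cf; apply: (measurability _ (RGenOpens.measurableE R)).
move=> _ [_ [a [b ->] <-]].
have -> : square z0 r `&` f @^-1` `]a, b[ = square z0 r `&` interior (f @^-1` `]a, b[).
  apply/seteqP; split=> z [Sz fz]; split=> //; last exact: interior_subset fz.
  by apply: (cf z Sz); apply: open_nbhs_nbhs; split=> //; exact: interval_open.
by apply: measurableI; [exact: measurable_square|apply: open_measurable_plane; exact: open_interior].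
Qed.

Lemma continuous_integrable_square (R : realType) (f : R * R -> R) (z0 : R * R) (r : R) :
  0 <= r -> (forall z, square z0 r z -> {for z, continuous f}) ->
  area2.-integrable (square z0 r) (EFin \o f).
Proof.
move=> r0 cf.
have cn z : `|z - z0| <= r -> {for z, continuous (fun w => `|f w|)}.
  move=> zr; apply: continuousP_norm => e e0; have [d d0 h] := continuousE_norm (cf z zr) e0.
  by exists d => // w /h; apply: le_lt_trans; exact: ler_dist_dist.
have [c _ cM] := square_max r0 cn.
apply: measurable_bounded_integrable.
- exact: measurable_square.
- by rewrite [X in (X < _)%E](area_square z0 r0) ltry.
- exact: continuous_measurable_square.
- exists `|f c|; split; first exact: num_real.
  by move=> M cMlt z Sz; apply: (le_trans (cM z Sz)); exact: ltW.
Qed.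

Lemma integral_line_zero (R : realType) (g dg : R -> R) (a b : R) : a < b ->
  (forall t, a <= t <= b -> is_derive t (1 : R) g (dg t)) ->
  (forall t, a <= t <= b -> {for t, continuous dg}) -> g a = 0 -> g b = 0 ->
  (\int[lebesgue_measure]_(t in `[a, b]) (dg t)%:E = 0)%E.
Proof.
move=> ab dgt cdg ga gb.
have cg t : a <= t <= b -> {for t, continuous g}.
  by move=> /dgt[d _]; apply/differentiable_continuous/derivable1_diffP.
rewrite (@continuous_FTC2 _ dg g)//.
- by rewrite ga gb -EFinB subrr.
- by apply: continuous_in_subspaceT => t; rewrite inE /= in_itv /= => /cdg.
- split.
  + by move=> t; rewrite in_itv /= => /andP[at1 tb]; have [] := dgt t; rewrite ?ltW.
  + apply: cvg_at_right_filter; apply: cg; by rewrite lexx ltW.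
  + apply: cvg_at_left_filter; apply: cg; by rewrite lexx ltW.
- move=> t; rewrite in_itv /= => /andP[at1 tb]; rewrite derive1E.
  by have [_ ->] : is_derive t (1 : R) g (dg t) by apply: dgt; rewrite !ltW.
Qed.

Lemma derive_vertical (R : realType) (K : R * R -> R) (x y : R) :
  differentiable K (x, y) -> is_derive y (1 : R) (fun t => K (x, t)) ('D_e_y K (x, y)).
Proof.
have E t : (x, t) = (x, 0) + t *: e_y :> R * R.
  by congr pair; [exact: esym (etrans (congr1 _ (mulr0 t)) (addr0 x))|
                  exact: esym (etrans (add0r _) (mulr1 t))].
rewrite E => dK; have -> : (fun t => K (x, t)) = (fun t => K ((x, 0) + t *: e_y)).
  by apply/funext => t; rewrite -E.
exact: is_derive_line.
Qed.

Lemma derive_horizontal (R : realType) (K : R * R -> R) (x y : R) :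
  differentiable K (x, y) -> is_derive x (1 : R) (fun t => K (t, y)) ('D_e_x K (x, y)).
Proof.
have E t : (t, y) = (0, y) + t *: e_x :> R * R.
  by congr pair; [exact: esym (etrans (add0r _) (mulr1 t))|
                  exact: esym (etrans (congr1 _ (mulr0 t)) (addr0 y))].
rewrite E => dK; have -> : (fun t => K (t, y)) = (fun t => K ((0, y) + t *: e_x)).
  by apply/funext => t; rewrite -E.
exact: is_derive_line.
Qed.

Lemma continuous_vertical (R : realType) (f : R * R -> R) (x y : R) :
  {for (x, y), continuous f} -> {for y, continuous (fun t => f (x, t))}.
Proof.
move=> cf; apply: continuousP_norm => e e0; have [d d0 h] := continuousE_norm cf e0.
exists d => // t ty; apply: h; rewrite norm_prod_lt /= subrr normr0 d0; exact: ty.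
Qed.

Lemma continuous_horizontal (R : realType) (f : R * R -> R) (x y : R) :
  {for (x, y), continuous f} -> {for x, continuous (fun t => f (t, y))}.
Proof.
move=> cf; apply: continuousP_norm => e e0; have [d d0 h] := continuousE_norm cf e0.
exists d => // t tx; apply: h; rewrite norm_prod_lt /= subrr normr0 d0 andbT; exact: tx.
Qed.

(** Extension by zero brings the square under Fubini's theorem on the whole plane, in either
    order. *)
Lemma Rintegral_square_fubini (R : realType) (f : R * R -> R) (z0 : R * R) (r : R) :
  0 <= r -> (forall z, square z0 r z -> {for z, continuous f}) ->
  (\int[lebesgue_measure]_x \int[lebesgue_measure]_y ((f \_ (square z0 r)) (x, y))%:E =
     \int[area2]_(z in square z0 r) (f z)%:E)%E /\
  (\int[lebesgue_measure]_y \int[lebesgue_measure]_x ((f \_ (square z0 r)) (x, y))%:E =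
     \int[area2]_(z in square z0 r) (f z)%:E)%E.
Proof.
move=> r0 cf; have I := continuous_integrable_square r0 cf.
have I' : area2.-integrable setT (EFin \o (f \_ (square z0 r))).
  rewrite -restrict_EFin.
  by have [+ _] := @integrable_mkcond _ _ _ (lebesgue_measure \x lebesgue_measure)%E
    (square z0 r) (EFin \o f) (measurable_square z0 r); apply.
have E : (\int[area2]_(z in square z0 r) (f z)%:E = \int[area2]_z ((f \_ (square z0 r)) z)%:E)%E.
  by rewrite integral_mkcond; apply: eq_integral => z _; rewrite restrict_EFin.
by rewrite E; split; [exact: (integral12_prod_meas1 I')|exact: (integral21_prod_meas1 I')].
Qed.

(** Fubini, then the fundamental theorem of calculus on each vertical chord, whose ends lie on the
    boundary of the square, where [K] vanishes. *)
Lemma integral_derive_y (R : realType) (K : R * R -> R) (z0 : R * R) (r : R) :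
  0 < r -> (forall z, square z0 r z -> differentiable K z) ->
  (forall z, square z0 r z -> {for z, continuous ('D_e_y K)}) ->
  (forall z, `|z - z0| = r -> K z = 0) ->
  \int[area2]_(z in square z0 r) 'D_e_y K z = 0.
Proof.
move=> r0 dK cK K0; rewrite /Rintegral.
have [<- _] := Rintegral_square_fubini (ltW r0) cK.
rewrite [X in fine X](_ : _ = 0%E)//.
apply: integral0_eq => x _.
have [xr|xr] := leP `|x - z0.1| r; last first.
  apply: integral0_eq => y _; rewrite patchE memNset// /square /= norm_prod_le /=.
  by move=> /andP[]; rewrite leNgt xr.
have sq y : z0.2 - r <= y <= z0.2 + r -> square z0 r (x, y).
  by rewrite -ler_distlC distrC => yr; rewrite /square /= norm_prod_le; apply/andP; split.
have edge y : `|y - z0.2| = r -> K (x, y) = 0.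
  move=> yr; apply: K0; apply/eqP; rewrite eq_le norm_prod_le /= xr yr lexx /=.
  by rewrite prod_normE le_max /= yr lexx orbT.
rewrite -[RHS](@integral_line_zero _ (fun y => K (x, y)) (fun y => 'D_e_y K (x, y))
   (z0.2 - r) (z0.2 + r)); first last.
- by apply: edge; rewrite addrAC subrr add0r gtr0_norm.
- by apply: edge; rewrite addrAC subrr add0r normrN gtr0_norm.
- by move=> t tr; exact: (@continuous_vertical _ ('D_e_y K) x t (cK _ (sq _ tr))).
- by move=> t tr; exact: (derive_vertical (dK _ (sq _ tr))).
- by lra.
rewrite [RHS]integral_mkcond; apply: eq_integral => y _.
have Sy : (square z0 r (x, y)) = (`[z0.2 - r, z0.2 + r]%classic y).
  rewrite /square /= norm_prod_le /= xr in_itv /= -ler_distlC distrC; by [].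
rewrite !patchE; case: (pselect (square z0 r (x, y))) => S.
  by rewrite !mem_set// -Sy.
by rewrite !memNset// -Sy.
Qed.

Lemma integral_derive_x (R : realType) (K : R * R -> R) (z0 : R * R) (r : R) :
  0 < r -> (forall z, square z0 r z -> differentiable K z) ->
  (forall z, square z0 r z -> {for z, continuous ('D_e_x K)}) ->
  (forall z, `|z - z0| = r -> K z = 0) ->
  \int[area2]_(z in square z0 r) 'D_e_x K z = 0.
Proof.
move=> r0 dK cK K0; rewrite /Rintegral.
have [_ <-] := Rintegral_square_fubini (ltW r0) cK.
rewrite [X in fine X](_ : _ = 0%E)//.
apply: integral0_eq => y _.
have [yr|yr] := leP `|y - z0.2| r; last first.
  apply: integral0_eq => x _; rewrite patchE memNset// /square /= norm_prod_le /=.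
  by move=> /andP[_]; rewrite leNgt yr.
have sq x : z0.1 - r <= x <= z0.1 + r -> square z0 r (x, y).
  by rewrite -ler_distlC distrC => xr; rewrite /square /= norm_prod_le; apply/andP; split.
have edge x : `|x - z0.1| = r -> K (x, y) = 0.
  move=> xr; apply: K0; apply/eqP; rewrite eq_le norm_prod_le /= xr yr lexx /=.
  by rewrite prod_normE le_max /= xr lexx.
rewrite -[RHS](@integral_line_zero _ (fun x => K (x, y)) (fun x => 'D_e_x K (x, y))
   (z0.1 - r) (z0.1 + r)); first last.
- by apply: edge; rewrite addrAC subrr add0r gtr0_norm.
- by apply: edge; rewrite addrAC subrr add0r normrN gtr0_norm.
- by move=> t tr; exact: (@continuous_horizontal _ ('D_e_x K) t y (cK _ (sq _ tr))).
- by move=> t tr; exact: (derive_horizontal (dK _ (sq _ tr))).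
- by lra.
rewrite [RHS]integral_mkcond; apply: eq_integral => x _.
have Sx : (square z0 r (x, y)) = (`[z0.1 - r, z0.1 + r]%classic x).
  rewrite /square /= norm_prod_le /= yr andbT in_itv /= -ler_distlC distrC; by [].
rewrite !patchE; case: (pselect (square z0 r (x, y))) => S.
  by rewrite !mem_set// -Sx.
by rewrite !memNset// -Sx.
Qed.

Lemma continuous_laplacian (R : realType) (U : set (R * R)) (f : R * R -> R) z :
  smooth_on U f -> U z -> {for z, continuous (laplacian f)}.
Proof.
move=> sf Uz; apply: differentiable_continuous.
exact: (differentiableD (smooth_diff (smooth_derive e_x (smooth_derive e_x sf)) Uz)
  (smooth_diff (smooth_derive e_y (smooth_derive e_y sf)) Uz)).
Qed.

Section green_identity.
Context {R : realType}.
Variables (U : set (R * R)) (G phi : R * R -> R) (z0 : R * R) (r : R).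
Hypotheses (oU : open U) (sG : smooth_on U G) (sphi : smooth_on U phi).
Hypotheses (r0 : 0 < r) (SU : square z0 r `<=` U).
Hypothesis phi0 : forall z, `|z - z0| = r -> phi z = 0 /\ forall v, 'D_v phi z = 0.

(** Component of Green's field [G grad phi - phi grad G]. In its derivative along [v] the products
    of first derivatives cancel, leaving [E v]; the sum over [e_x] and [e_y] produces both
    Laplacians. *)
Let K (v : R * R) (z : R * R) : R := G z * 'D_v phi z - phi z * 'D_v G z.
Let E (v : R * R) (z : R * R) : R := G z * 'D_v ('D_v phi) z - phi z * 'D_v ('D_v G) z.

Let dG z : U z -> differentiable G z. Proof. exact: smooth_diff. Qed.
Let dphi z : U z -> differentiable phi z. Proof. exact: smooth_diff. Qed.
Let dvG v z : U z -> differentiable ('D_v G) z.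
Proof. exact: (smooth_diff (smooth_derive v sG)). Qed.
Let dvphi v z : U z -> differentiable ('D_v phi) z.
Proof. exact: (smooth_diff (smooth_derive v sphi)). Qed.
Let dvvG v z : U z -> differentiable ('D_v ('D_v G)) z.
Proof. exact: (smooth_diff (smooth_derive v (smooth_derive v sG))). Qed.
Let dvvphi v z : U z -> differentiable ('D_v ('D_v phi)) z.
Proof. exact: (smooth_diff (smooth_derive v (smooth_derive v sphi))). Qed.

Let dK v z : U z -> differentiable (K v) z.
Proof.
move=> Uz; exact: (differentiableB (differentiableM (dG Uz) (dvphi v Uz))
  (differentiableM (dphi Uz) (dvG v Uz))).
Qed.

Let KE v z : U z -> 'D_v (K v) z = E v z.
Proof.
move=> Uz.
have d1 := diff_dir v (differentiableM (dG Uz) (dvphi v Uz)).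
have d2 := diff_dir v (differentiableM (dphi Uz) (dvG v Uz)).
have e0 := deriveB d1 d2.
have e1 := deriveM (diff_dir v (dG Uz)) (diff_dir v (dvphi v Uz)).
have e2 := deriveM (diff_dir v (dphi Uz)) (diff_dir v (dvG v Uz)).
have comb (d k1 k2 g gp f fp a b : R) : d = k1 - k2 -> k1 = g * a + fp * gp ->
    k2 = f * b + gp * fp -> d = g * a - f * b by move=> -> -> ->; ring.
exact: comb e0 e1 e2.
Qed.

Let cE v z : U z -> {for z, continuous (E v)}.
Proof.
move=> Uz; apply: differentiable_continuous.
exact: (differentiableB (differentiableM (dG Uz) (dvvphi v Uz))
  (differentiableM (dphi Uz) (dvvG v Uz))).
Qed.

Let K0 v z : `|z - z0| = r -> K v z = 0.
Proof. by move=> /phi0[p0 pv]; rewrite /K p0 pv mulr0 mul0r subrr. Qed.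

Let cDK v z : square z0 r z -> {for z, continuous ('D_v (K v))}.
Proof. move=> /SU Uz.
exact: (@continuous_eq_on R U ('D_v (K v)) (E v) z oU (fun w Uw => KE v Uw) Uz (@cE v z Uz)). Qed.

Let intE_x : \int[area2]_(z in square z0 r) E e_x z = 0.
Proof.
rewrite -[RHS](@integral_derive_x _ (K e_x) z0 r r0 (fun z Sz => dK e_x (SU Sz))
  (fun z Sz => cDK Sz) (K0 e_x)).
by apply: eq_Rintegral => z; rewrite inE => Sz; exact: esym (KE e_x (SU Sz)).
Qed.

Let intE_y : \int[area2]_(z in square z0 r) E e_y z = 0.
Proof.
rewrite -[RHS](@integral_derive_y _ (K e_y) z0 r r0 (fun z Sz => dK e_y (SU Sz))
  (fun z Sz => cDK Sz) (K0 e_y)).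
by apply: eq_Rintegral => z; rewrite inE => Sz; exact: esym (KE e_y (SU Sz)).
Qed.

Lemma green_identity :
  \int[area2]_(z in square z0 r) (G z * laplacian phi z) =
  \int[area2]_(z in square z0 r) (phi z * laplacian G z).
Proof.
have I1 : area2.-integrable (square z0 r) (EFin \o (fun z => G z * laplacian phi z)).
  apply: (continuous_integrable_square (ltW r0)) => z /SU Uz.
  apply: continuousM; [exact: differentiable_continuous (dG Uz)|exact: continuous_laplacian sphi Uz].
have I2 : area2.-integrable (square z0 r) (EFin \o (fun z => phi z * laplacian G z)).
  apply: (continuous_integrable_square (ltW r0)) => z /SU Uz.
  apply: continuousM; [exact: differentiable_continuous (dphi Uz)|exact: continuous_laplacian sG Uz].
have J v : area2.-integrable (square z0 r) (EFin \o E v).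
  by apply: (continuous_integrable_square (ltW r0)) => z /SU; exact: cE.
have mS := measurable_square z0 r.
have eB := @RintegralB _ _ _ (@area2 R) (square z0 r) _ _ mS I1 I2.
have eD := @RintegralD _ _ _ (@area2 R) (square z0 r) _ _ mS (J e_x) (J e_y).
have eBD : \int[area2]_(z in square z0 r) (G z * laplacian phi z - phi z * laplacian G z) =
    \int[area2]_(z in square z0 r) (E e_x z + E e_y z).
  have expand (g p a b c d : R) : g * (a + b) - p * (c + d) = (g * a - p * c) + (g * b - p * d).
    ring.
  apply: eq_Rintegral => z _; exact: expand.
have comb (a b c d e f : R) : c = a - b -> d = e + f -> c = d -> e = 0 -> f = 0 -> a = b.
  by move=> -> -> h e0 f0; apply/eqP; rewrite -subr_eq0 h e0 f0 addr0.
exact: comb eB eD eBD intE_x intE_y.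
Qed.

End green_identity.

(** [f] stays above [f z0 / 2] on a smaller square of positive area around [z0]. *)
Lemma Rintegral_square_neq0 (R : realType) (f : R * R -> R) (z0 : R * R) (r : R) :
  0 < r -> (forall z, square z0 r z -> {for z, continuous f}) ->
  (forall z, square z0 r z -> 0 <= f z) -> 0 < f z0 ->
  \int[area2]_(z in square z0 r) f z <> 0.
Proof.
move=> r0 cf f0 fz0 I0.
have Sz0 : square z0 r z0 by rewrite /square /= subrr normr0 ltW.
have f20 : 0 < f z0 / 2 by rewrite divr_gt0.
have [d d0 hd] := continuousE_norm (cf _ Sz0) f20.
pose e := Num.min r (d / 2).
have e0 : 0 < e by rewrite lt_min r0 divr_gt0.
have ed : e < d by rewrite /e gt_min; apply/orP; right; rewrite ltr_pdivrMr// ltr_pMr// ltr1n.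
have er : e <= r by rewrite ge_min lexx.
have mS := measurable_square z0 r; have me := measurable_square z0 e.
have int_f := continuous_integrable_square (ltW r0) cf.
have fin : (\int[area2]_(z in square z0 r) (f z)%:E)%E \is a fin_num by exact: integrable_fin_num.
have : ((f z0 / 2)%:E * area2 (square z0 e) <= \int[area2]_(z in square z0 r) (f z)%:E)%E.
  have -> : ((f z0 / 2)%:E * area2 (square z0 e) =
     \int[area2]_(z in square z0 r) ((f z0 / 2)%:E * (\1_(square z0 e) z)%:E))%E.
    rewrite ge0_integralZl//; first last.
    - by rewrite lee_fin ltW.
    - by apply/measurable_EFinP; exact: measurable_indic.
    rewrite integral_indic//; congr (_ * area2 _)%E.
    by rewrite setIidl// => z; rewrite /square /= => /le_trans; apply.
  apply: ge0_le_integral => //.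
  - by move=> z _; rewrite mule_ge0// lee_fin ltW.
  - by apply: measurable_funeM; apply/measurable_EFinP; exact: measurable_indic.
  - by apply/measurable_EFinP; exact: continuous_measurable_square.
  move=> z Sz; rewrite indicE; case: (boolP (z \in square z0 e)) => [|_].
    rewrite inE => Se; rewrite mule1 lee_fin.
    have : `|f z - f z0| < f z0 / 2 by apply: hd; apply: le_lt_trans ed.
    rewrite ltr_norml => /andP[h _]; lra.
  by rewrite mule0 lee_fin; exact: f0.
rewrite (area_square z0 (ltW e0)) -(fineK fin) -EFinM lee_fin.
rewrite [fine _](_ : _ = 0)//; rewrite leNgt; apply/negP; rewrite negbK.
by rewrite !mulr_gt0.
Qed.

(** * The Laplacian of the Green function *)

Lemma cos_periodic_int (R : realType) (x : R) (n : int) : cos (x + 2 * pi * n%:~R) = cos x.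
Proof.
have P (y : R) (m : nat) : cos (y + 2 * pi * m%:R) = cos y.
  elim: m => [|m IH]; first by rewrite mulr0 addr0.
  have E : 2 * pi = pi *+ 2 :> R by rewrite mulr_natl.
  have -> : 2 * pi * m.+1%:R = 2 * pi * m%:R + pi *+ 2 :> R by rewrite -E -natr1; ring.
  by rewrite addrA cosD2pi.
case: n => n; first exact: P.
by rewrite NegzE mulrNz mulrN -[in RHS](subrK (2 * pi * (n.+1)%:R) x) P.
Qed.

(** Evenness and the symmetry [x |-> 1 - x] fold the range onto [[eta, 1/2]], where [cos (2 pi x)]
    decreases. *)
Lemma cos_away_from_integers (R : realType) (eta x : R) :
  0 < eta -> eta <= 2^-1 -> eta <= `|x| <= 1 - eta -> cos (2 * pi * x) <= cos (2 * pi * eta).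
Proof.
move=> e0 e1 /andP[x1 x2].
have pi0 := pi_gt0 R.
have -> : cos (2 * pi * x) = cos (2 * pi * `|x|).
  have P0 : 0 <= 2 * pi :> R by rewrite mulr_ge0// ltW.
  by rewrite -cos_norm normrM (ger0_norm P0).
have mon (y : R) : eta <= y -> y <= 2^-1 -> cos (2 * pi * y) <= cos (2 * pi * eta).
  move=> ey y2.
  have M (a : R) : 0 <= a -> a <= 2^-1 -> 2 * pi * a \in `[0, pi]%R.
    by move=> a0 a2; rewrite in_itv /=; apply/andP; split; nra.
  rewrite leNgt; apply/negP; rewrite ltr_cos; first by nra.
  - by apply: M => //; lra.
  - by apply: M => //; lra.
have [x2'|x2'] := leP `|x| 2^-1; first exact: mon.
have -> : cos (2 * pi * `|x|) = cos (2 * pi * (1 - `|x|)).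
  rewrite -(cosN (2 * pi * (1 - _))) -(cos_periodic_int (- (2 * pi * _)) 1).
  by congr cos; rewrite mulr1z; ring.
by apply: mon; lra.
Qed.

Lemma cos_lt1 (R : realType) (eta : R) : 0 < eta -> eta <= 2^-1 -> cos (2 * pi * eta) < 1.
Proof.
move=> e0 e1; have pi0 := pi_gt0 R; rewrite -[ltRHS](cos0 R) ltr_cos ?in_itv /=.
- by rewrite !mulr_gt0.
- by rewrite lexx ltW.
- by apply/andP; split; nra.
Qed.

(** In lattice coordinates the cosines are periodic and reach 1 at [z0]; [flat_exp 0] cuts off
    smoothly where a cosine is at most [e]. For [e] close to 1 a small parallelogram around each
    lattice translate of [z0] remains. *)
Definition bump (R : realType) (tau z0 : R * R) (e : R) (z : R * R) : R :=
  flat_exp 0 (cos (2 * pi * (coord_s tau z - coord_s tau z0)) - e) *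
  flat_exp 0 (cos (2 * pi * (coord_t tau z - coord_t tau z0)) - e).

Lemma bump_smooth (R : realType) (tau z0 : R * R) (e : R) : smooth_on setT (bump tau z0 e).
Proof.
apply: trig_exp_smooth.
have -> : bump tau z0 e = fun z =>
   flat_exp 0 (cos ((2 * pi) * z.1 + (- (2 * pi * (tau.1 / tau.2))) * z.2
     + - (2 * pi * coord_s tau z0)) - e) *
   flat_exp 0 (cos (0 * z.1 + (2 * pi / tau.2) * z.2 + - (2 * pi * coord_t tau z0)) - e).
  apply/funext => z; rewrite /bump; congr (flat_exp 0 (cos _ - e) * flat_exp 0 (cos _ - e)).
    by rewrite (_ : coord_s tau z = z.1 - z.2 / tau.2 * tau.1)//; ring.
  by rewrite (_ : coord_t tau z = z.2 / tau.2)//; ring.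
by apply: TrigMul; exact: TrigFlat.
Qed.

Lemma bump_periodic (R : realType) (tau z0 : R * R) (e : R) :
  tau.2 != 0 -> lattice_periodic tau (bump tau z0 e).
Proof.
move=> t0 z _ [m [n ->]]; rewrite /bump.
have [-> ->] := coordD z m%:~R n%:~R t0.
have P (x y : R) (k : int) : cos (2 * pi * (x + k%:~R - y)) = cos (2 * pi * (x - y)).
  by rewrite -[RHS](cos_periodic_int _ k); congr cos; ring.
by rewrite !P.
Qed.

Lemma bump_ge0 (R : realType) (tau z0 : R * R) (e : R) z : 0 <= bump tau z0 e z.
Proof.
have P (x : R) : 0 <= flat_exp 0 x by case/andP: (flat_exp_bound 0 x).
exact: mulr_ge0.
Qed.

Lemma bump_near0 (R : realType) (tau z0 z : R * R) (e : R) :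
  cos (2 * pi * (coord_s tau z - coord_s tau z0)) < e \/
  cos (2 * pi * (coord_t tau z - coord_t tau z0)) < e ->
  exists2 d : R, 0 < d & forall w, `|w - z| < d -> bump tau z0 e w = 0.
Proof.
have [cs ct] := continuous_coord tau z.
have F (x : R) : x < e -> flat_exp 0 (x - e) = 0.
  by move=> xe; rewrite /flat_exp subr_gt0 (lt_gtF xe).
have K (g : R * R -> R) (a : R) : {for z, continuous g} -> cos (2 * pi * (g z - a)) < e ->
    exists2 d : R, 0 < d & forall w, `|w - z| < d -> cos (2 * pi * (g w - a)) < e.
  move=> cg ge.
  have ch : {for z, continuous (fun w => cos (2 * pi * (g w - a)))}.
    apply: (@continuous_comp _ _ _ (fun w => 2 * pi * (g w - a)) cos); last exact: continuous_cos.
    apply: continuousM; first exact: cst_continuous.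
    by apply: continuousB; [exact: cg|exact: cst_continuous].
  have e0 : 0 < e - cos (2 * pi * (g z - a)) by rewrite subr_gt0.
  have [d d0 h] := continuousE_norm ch e0; exists d => // w /h.
  by rewrite ltr_norml => /andP[_]; rewrite ltrD2r.
by case=> [/(K _ _ cs)|/(K _ _ ct)] [d d0 h]; exists d => // w /h /F E;
  rewrite /bump E ?mul0r ?mulr0.
Qed.

Lemma bump_center_gt0 (R : realType) (tau z0 : R * R) (e : R) : e < 1 -> 0 < bump tau z0 e z0.
Proof.
move=> e1; rewrite /bump !subrr !mulr0 cos0 /flat_exp subr_gt0 e1.
by rewrite !expr0 !mul1r mulr_gt0// expR_gt0.
Qed.

(** Vanishing in a whole neighbourhood, also at distance exactly [r], kills the derivatives too, as
    needed for the boundary terms of Green's identity and for the integrals outside the square. *)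
Lemma cell_bump (R : realType) (tau z0 : R * R) (r : R) : 0 < tau.2 ->
  0 < coord_s tau z0 < 1 -> 0 < coord_t tau z0 < 1 -> 0 < r ->
  exists phi : R * R -> R, [/\ smooth_on setT phi, lattice_periodic tau phi,
    forall z, 0 <= phi z, 0 < phi z0 &
    forall z, cell tau z -> r <= `|z - z0| ->
      exists2 d : R, 0 < d & forall w, `|w - z| < d -> phi w = 0].
Proof.
move=> t0 /andP[s00 s01] /andP[t00 t01] r0.
have tn0 : tau.2 != 0 by rewrite gt_eqF.
set s0 := coord_s tau z0 in s00 s01 *; set u0 := coord_t tau z0 in t00 t01 *.
have T0 : 0 < 1 + `|tau| by rewrite ltr_pwDl.
(* [eta <= 2^-1] serves the monotonicity of the cosine, [eta * (1 + |tau|) <= r] fits the support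
   into the square, and the distances to 0 and 1 keep the other lattice translates of the support
   off the cell. *)
have [eta [[e0 e12 er es] et]] : exists eta : R, [/\ 0 < eta, eta <= 2^-1,
    eta * (1 + `|tau|) <= r & eta <= s0 /\ eta <= 1 - s0] /\ (eta <= u0 /\ eta <= 1 - u0).
  exists (Num.min (Num.min 2^-1 (r / (1 + `|tau|)))
    (Num.min (Num.min s0 (1 - s0)) (Num.min u0 (1 - u0)))).
  have m_pos : 0 < Num.min (Num.min 2^-1 (r / (1 + `|tau|)))
      (Num.min (Num.min s0 (1 - s0)) (Num.min u0 (1 - u0))).
    by rewrite !lt_min !(subr_gt0 _ 1) s00 s01 t00 t01 invr_gt0 ltr0n divr_gt0.
  do !split; rewrite ?m_pos -?ler_pdivlMr// !ge_min lexx ?orbT //.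
have c1 := cos_lt1 e0 e12.
pose e := (1 + cos (2 * pi * eta)) / 2.
have e1 : e < 1 by rewrite /e; lra.
have ce : cos (2 * pi * eta) < e by rewrite /e; lra.
exists (bump tau z0 e); split.
- exact: bump_smooth.
- exact: bump_periodic.
- exact: bump_ge0.
- exact: bump_center_gt0.
move=> z [s [t [/andP[s_0 s_1] /andP[t_0 t_1] zE]]] rz.
have [sE tE] := coordD 0 s t tn0.
have zero : coord_s tau 0 = 0 /\ coord_t tau 0 = 0.
  by rewrite /coord_s /coord_t /= !mul0r subrr.
have {}sE : coord_s tau z = s by rewrite -[s]add0r -zero.1 -sE add0r zE.
have {}tE : coord_t tau z = t by rewrite -[t]add0r -zero.2 -tE add0r zE.
apply: bump_near0; rewrite sE tE -/s0 -/u0.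
have [h1|h1] := leP eta `|s - s0|; [left|have [h2|h2] := leP eta `|t - u0|; [right|exfalso]].
- apply: le_lt_trans ce; apply: cos_away_from_integers => //; rewrite h1 ler_norml.
  by apply/andP; split; lra.
- apply: le_lt_trans ce; apply: cos_away_from_integers => //; rewrite h2 ler_norml.
  by apply/andP; split; lra.
move: rz; apply/negP; rewrite -ltNge; apply: lt_le_trans er.
have -> : z - z0 = (s - s0) *: e_x + (t - u0) *: tau.
  rewrite {1}(coord_decomp z0 tn0) zE !scalerBl opprD -/s0 -/u0.
  by rewrite addrACA.
rewrite mulrDr mulr1; apply: le_lt_trans (ler_normD _ _) _.
rewrite !normrZ norm_e_x mulr1; apply: ltr_leD => //.
by apply: ler_wpM2r => //; exact: ltW.
Qed.

Lemma derive_locally0 (R : realType) (f : R * R -> R) (z v : R * R) :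
  (exists2 d : R, 0 < d & forall w, `|w - z| < d -> f w = 0) ->
  exists2 d : R, 0 < d & forall w, `|w - z| < d -> 'D_v f w = 0.
Proof.
move=> [d d0 f0]; exists d => // w wd.
rewrite (_ : 0 = 'D_v (cst 0 : R * R -> R) w); last by rewrite derive_cst.
apply: near_eq_derive; apply/nearE_norm; exists (d - `|w - z|); first by rewrite subr_gt0.
move=> y yw; apply: f0; rewrite -[y - z](subrKA w).
by apply: le_lt_trans (ler_normD _ _) _; rewrite -ltrBrDr.
Qed.

Lemma laplacian_locally0 (R : realType) (f : R * R -> R) (z : R * R) :
  (exists2 d : R, 0 < d & forall w, `|w - z| < d -> f w = 0) ->
  [/\ f z = 0, forall v, 'D_v f z = 0 & laplacian f z = 0].
Proof.
have at0 (g : R * R -> R) :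
    (exists2 d : R, 0 < d & forall w, `|w - z| < d -> g w = 0) -> g z = 0.
  by move=> [d d0]; apply; rewrite subrr normr0.
move=> f0; have D v := derive_locally0 v f0.
have DD v := at0 _ (derive_locally0 v (D v)).
split; [exact: at0 f0|by move=> v; exact: at0 (D v)|].
exact: etrans (congr2 _ (DD e_x) (DD e_y)) (addr0 0).
Qed.

Lemma Rintegral_subset_support (R : realType) (A B : set (R * R)) (f : R * R -> R) :
  B `<=` A -> (forall z, A z -> ~ B z -> f z = 0) ->
  \int[area2]_(z in A) f z = \int[area2]_(z in B) f z.
Proof.
move=> BA f0; rewrite !(Rintegral_mkcond area2 _ f); congr (Rintegral _ _ _).
apply/funext => z; rewrite !patchE.
have [Bz|nB] := pselect (B z); first by rewrite (mem_set Bz) (mem_set (BA _ Bz)).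
have [Az|nA] := pselect (A z); last by rewrite !memNset.
by rewrite (mem_set Az) (memNset nB) f0.
Qed.

Lemma open_cell (R : realType) (tau z : R * R) : tau.2 != 0 ->
  0 < coord_s tau z < 1 -> 0 < coord_t tau z < 1 -> cell tau z /\ ~ lattice tau z.
Proof.
move=> t0 sI tI; split.
  exists (coord_s tau z), (coord_t tau z); split; last exact: coord_decomp.
    by case/andP: sI => /ltW -> ->.
  by case/andP: tI => /ltW -> ->.
move=> /(coord_lattice t0)[m [_ [mE _]]].
by apply: (@between_integers _ (coord_s tau z) 0); [rewrite add0r|exists m].
Qed.

(** For a bump concentrated near [z0], Green's identity moves the Laplacian onto [G], so
    [laplacian G - c] integrates to 0 against the bump; a nonzero value at [z0] would keep its sign
    nearby. *)
Lemma green_laplacian_open_cell (R : realType) (tau : R * R) (G : R * R -> R) (z0 : R * R) :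
  0 < tau.2 -> is_green tau G -> 0 < coord_s tau z0 < 1 -> 0 < coord_t tau z0 < 1 ->
  laplacian G z0 = (torus_area tau)^-1.
Proof.
move=> t0 [_ sG _ eqnG _] s0I t0I; set c := (torus_area tau)^-1.
have tn0 : tau.2 != 0 by rewrite gt_eqF.
have oU := lattice_compl_open t0.
apply/eqP; rewrite -subr_eq0; apply/negPn/negP => a0.
(* The constant factor makes [F] positive near [z0] whatever the sign of the defect. *)
pose F z := (laplacian G z0 - c) * (laplacian G z - c).
have cF z : ~ lattice tau z -> {for z, continuous F}.
  move=> Uz; apply: continuousM; first exact: cst_continuous.
  by apply: continuousB; [exact: continuous_laplacian sG Uz|exact: cst_continuous].
have F0 : 0 < F z0 by rewrite /F -expr2 exprn_even_gt0.
have [_ Uz0] := open_cell tn0 s0I t0I.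
have [cs ct] := continuous_coord tau z0.
have [d1 d10 h1] := near_interval cs s0I.
have [d2 d20 h2] := near_interval ct t0I.
have FI : 0 < F z0 < F z0 + 1 by apply/andP; split; [exact: F0|rewrite ltrDl ltr01].
have [d3 d30 h3] := near_interval (cF _ Uz0) FI.
have [r r0 [rd1 rd2 rd3]] : exists2 r, 0 < r & [/\ r < d1, r < d2 & r < d3].
  exists (Num.min d1 (Num.min d2 d3) / 2); first by rewrite divr_gt0// !lt_min d10 d20.
  have m0 : 0 < Num.min d1 (Num.min d2 d3) by rewrite !lt_min d10 d20.
  have : Num.min d1 (Num.min d2 d3) / 2 < Num.min d1 (Num.min d2 d3).
    by rewrite ltr_pdivrMr// ltr_pMr// ltr1n.
  by rewrite {2}/Num.min !lt_min => /andP[-> /andP[-> ->]].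
have SI z : square z0 r z -> cell tau z /\ ~ lattice tau z.
  by move=> zr; apply: open_cell => //; [apply: h1|apply: h2]; exact: le_lt_trans zr _.
have SU : square z0 r `<=` ~` lattice tau by move=> z /SI[].
have SC : square z0 r `<=` cell tau by move=> z /SI[].
have [phi [sphi pphi phi_ge0 phi_z0 phi0]] := cell_bump t0 s0I t0I r0.
have {}phi0 z : cell tau z -> r <= `|z - z0| ->
    [/\ phi z = 0, forall v, 'D_v phi z = 0 & laplacian phi z = 0].
  by move=> Cz zr; apply: laplacian_locally0; exact: phi0.
have lattice0 : lattice tau 0 by exists 0, 0; rewrite !scale0r addr0.
(* The Dirac term drops out: the origin is a point of the cell outside the square. *)
have phi00 : phi 0 = 0.
  have C0 : cell tau 0.
    by exists 0, 0; rewrite lexx ltr01; split=> //; rewrite !scale0r addr0.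
  have r0z : r <= `|0 - z0| by rewrite leNgt; apply/negP => /ltW /SU.
  by have [] := phi0 0 C0 r0z.
have outside z : ~ square z0 r z -> r <= `|z - z0|.
  by move=> /negP; rewrite /square /= -ltNge => /ltW.
have := eqnG phi pphi sphi; rewrite phi00 /torus_integral.
rewrite (Rintegral_subset_support SC); last first.
  by move=> z Cz nS; have [_ _ ->] := phi0 z Cz (outside z nS); rewrite mulr0.
rewrite (Rintegral_subset_support SC); last first.
  by move=> z Cz nS; have [-> _ _] := phi0 z Cz (outside z nS).
have sphiU : smooth_on (~` lattice tau) phi by move=> vs z _; exact: sphi.
rewrite (green_identity oU sG sphiU r0 SU); last first.
  move=> z zr; have Sz : square z0 r z by rewrite /square /= zr.
  by have [|p0 dp0 _] := phi0 z (SC z Sz); [rewrite zr|].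
have cphi z : {for z, continuous phi}.
  by apply: differentiable_continuous; exact: (smooth_diff sphi).
have I1 : area2.-integrable (square z0 r) (EFin \o (fun z => phi z * laplacian G z)).
  apply: (continuous_integrable_square (ltW r0)) => z /SU Uz.
  by apply: continuousM; [exact: cphi|exact: continuous_laplacian sG Uz].
have I2 : area2.-integrable (square z0 r) (EFin \o phi).
  by apply: (continuous_integrable_square (ltW r0)) => z _; exact: cphi.
have I3 : area2.-integrable (square z0 r) (EFin \o (fun z => c * phi z)).
  apply: (continuous_integrable_square (ltW r0)) => z _.
  by apply: continuousM; [exact: cst_continuous|exact: cphi].
have I4 : area2.-integrable (square z0 r)
    (EFin \o (fun z => phi z * laplacian G z - c * phi z)).
  apply: (continuous_integrable_square (ltW r0)) => z /SU Uz.
  apply: continuousB; apply: continuousM; first exact: cphi.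
  - exact: continuous_laplacian sG Uz.
  - exact: cst_continuous.
  - exact: cphi.
have mS := measurable_square z0 r.
have eB := @RintegralB _ _ _ (@area2 R) (square z0 r) _ _ mS I1 I3.
have eZ := @RintegralZl _ _ _ (@area2 R) (square z0 r) _ c mS I2.
have eA := @RintegralZl _ _ _ (@area2 R) (square z0 r) _ (laplacian G z0 - c) mS I4.
move=> eqn.
apply: (@Rintegral_square_neq0 R (fun z => phi z * F z) z0 r r0).
- by move=> z /SU Uz; apply: continuousM; [exact: cphi|exact: cF].
- move=> z Sz; apply: mulr_ge0; first exact: phi_ge0.
  by apply/ltW; case/andP: (h3 z (le_lt_trans Sz rd3)).
- exact: mulr_gt0.
have fE : \int[area2]_(z in square z0 r) (phi z * F z) = \int[area2]_(z in square z0 r)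
    ((laplacian G z0 - c) * (phi z * laplacian G z - c * phi z)).
  have comb (p a l : R) : p * (a * (l - c)) = a * (p * l - c * p) by ring.
  by apply: eq_Rintegral => z _; exact: comb.
have comb (x y p q w i a : R) : - x = 0 - c * y -> p = x - q -> q = c * y -> w = a * p ->
    i = w -> i = 0.
  move=> h -> -> -> ->; rewrite (_ : x = c * y) ?subrr ?mulr0//.
  by apply: oppr_inj; rewrite h sub0r.
exact: comb eqn eB eZ eA fE.
Qed.

(** A lattice translation brings points with non-integral coordinates into the open cell; such
    points are dense, and continuity gives the rest. *)
Lemma green_laplacian (R : realType) (tau : R * R) (G : R * R -> R) (z : R * R) :
  0 < tau.2 -> is_green tau G -> ~ lattice tau z -> laplacian G z = (torus_area tau)^-1.
Proof.
move=> t0 gG Uz; apply/eqP; rewrite -subr_eq0; apply/negPn/negP => a0.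
have tn0 : tau.2 != 0 by rewrite gt_eqF.
have cL := continuous_laplacian (green_smooth gG) Uz.
have a1 : 0 < `|laplacian G z - (torus_area tau)^-1| by rewrite normr_gt0.
have [d d0 hd] := continuousE_norm cL a1.
have [z1 [/hd z1d ns nt]] := generic_point z t0 d0.
suff E : laplacian G z1 = (torus_area tau)^-1 by move: z1d; rewrite E distrC ltxx.
set m := Num.floor (coord_s tau z1); set n := Num.floor (coord_t tau z1).
have lw : lattice tau ((- m)%:~R *: e_x + (- n)%:~R *: tau) by exists (- m), (- n).
have [pxx pyy] : lattice_periodic tau ('D_e_x ('D_e_x G)) /\
    lattice_periodic tau ('D_e_y ('D_e_y G)).
  by split; do 2 apply: lattice_derive_periodic; exact: green_periodic gG.
have -> : laplacian G z1 = laplacian G (z1 + ((- m)%:~R *: e_x + (- n)%:~R *: tau)).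
  exact: esym (congr2 _ (pxx z1 _ lw) (pyy z1 _ lw)).
have [sE tE] := coordD z1 (- m)%:~R (- n)%:~R tn0.
apply: green_laplacian_open_cell => //.
- rewrite sE mulrNz; have /andP[h1 h2] := floor_interval ns.
  by rewrite subr_gt0 h1 ltrBlDl -intrD1.
- rewrite tE mulrNz; have /andP[h1 h2] := floor_interval nt.
  by rewrite subr_gt0 h1 ltrBlDl -intrD1.
Qed.

Theorem theorem1p8 (R : realType) (tau : R * R) (htau : upper_half_plane tau)
    (G : R * R -> R) (hG : is_green tau G) :
  {ae area2, forall p : R * R, ~ two_torsion tau p ->
     forall z : R * R, critical_point tau G p z -> nondegenerate_at G p z}.
Proof.
have k0 : 0 < (torus_area tau)^-1 by rewrite invr_gt0.
have N := nondegenerate_of_laplacian htau (green_periodic hG) (green_smooth hG) k0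
  (fun z => green_laplacian htau hG).
apply: negligibleS N => p /= /not_implyP[_ /existsNP[z /not_implyP[cz nz]]].
by exists z.
Qed.
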